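(* Fix $t\geq0$ and let $Y_t$ be the splitting tessellation of $\mathbb{S}^2$ at time $t$. For $\mathbf X\in\{\mathbf Z,\mathbf E,\mathbf V,\mathbf S,\mathbf M\}$ let $\lambda_{\mathbf X}$ be the expected number of objects of class $\mathbf X$ of $Y_t$ (for $\mathbf S$ counted with multiplicity). Then $$\lambda_{\mathbf Z}=t^2+2t+2,\quad \lambda_{\mathbf E}=3(t^2+2t),\quad \lambda_{\mathbf V}=2(t^2+2t),\quad \lambda_{\mathbf S}=2\big(2(t^2+2t)+e^{-t}\big),\quad \lambda_{\mathbf M}=t^2+2t.$$
   Context: $\mathbb{S}^2\subset\mathbb{R}^3$ is the unit sphere; $\sigma_2$ is the normalized spherical Lebesgue measure ($\sigma_2(\mathbb{S}^2)=1$). $\tau$ is the rotation-invariant probability measure on the set $\mathscr G$ of great circles (image of $\sigma_2$ under $u\mapsto\mathbb{S}^2\cap u^\perp$). For $B\subseteq\mathbb{S}^2$, $[B]:=\{g\in\mathscr G:g\cap B\ne\emptyset\}$. A spherically convex polygon is a finite intersection of closed hemispheres (the whole sphere allowed). A tessellation of $\mathbb{S}^2$ is a finite set of spherically convex polygons (cells) with pairwise disjoint interiors covering $\mathbb{S}^2$, identified with the union of the cell boundaries. For a tessellation $T$, a cell $p$ and $g\in[p]$, $\oslash_{p,g}(T)$ is obtained by replacing $p$ by $p\cap g^+$ and $p\cap g^-$, $g^\pm$ the closed hemispheres bounded by $g$. Let $A=\mathbb{S}^2\cap\{z=0\}$ (equator), $\mathbb{S}^2_\pm=\mathbb{S}^2\cap\{\pm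 z\ge0\}$. The splitting tessellation process $(Y_t)_{t\ge0}$ is the continuous-time Markov process on tessellations with $Y_0=A$ (cells $\mathbb{S}^2_\pm$) and generator $\mathbb Lf(T)=\sum_{p\text{ cell of }T}\int_{[p]}[f(\oslash_{p,g}(T))-f(T)]\tau(\mathrm dg)$: each cell $p$ lives an independent exponential time with parameter $\tau([p])$, then is split by a great circle with law $\tau(\cdot\cap[p])/\tau([p])$, the daughters evolving independently in the same way. Object classes of $Y_t$: $\mathbf Z$ = cells; $\mathbf V$ = vertices, i.e. non-empty intersections of three different cells; $\mathbf E$ = edges, i.e. spherical line segments in the boundary of some cell, bounded by two different vertices, with no vertex in the relative interior; $\mathbf S$ = sides, i.e. the $1$-dimensional faces of the cells, regarded as a multiset (a side common to two cells counted twice; at time $0$, $\mathbf S=\{A,A\}$); $\mathbf M$ = maximal segments, i.e. maximal unions of connected edges lying on a common great circle with different endpoints (equivalently the segments created by splits up to time $t$; $A$ is not a maximal segment). *)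

(* Defs.v *)
From HB Require Import structures.
From mathcomp Require Import all_boot all_order all_algebra.
From mathcomp Require Import finmap.
From Stdlib Require List.
From mathcomp Require Import all_classical all_reals all_analysis.
Set Implicit Arguments. Unset Strict Implicit. Unset Printing Implicit Defensive.
Import Order.TTheory GRing.Theory Num.Theory.
Import numFieldNormedType.Exports.
Local Open Scope classical_set_scope.
Local Open Scope ring_scope.

Section Splitting.
Variable R : realType.

Definition V3 := (R * R * R)%type.
Definition dot (x y : V3) : R := x.1.1 * y.1.1 + x.1.2 * y.1.2 + x.2 * y.2.
Definition lin2 (a b : R) (u w : V3) : V3 :=
  (a * u.1.1 + b * w.1.1, a * u.1.2 + b * w.1.2, a * u.2 + b * w.2).

Definition sphere : set V3 := [set x | dot x x = 1].
Definition gc (u : V3) : set V3 := [set x | sphere x /\ dot x u = 0].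
Definition hemi_p (u : V3) : set V3 := [set x | sphere x /\ 0 <= dot x u].
Definition hemi_m (u : V3) : set V3 := [set x | sphere x /\ dot x u <= 0].

Definition sph (th ph : R) : V3 := (sin th * cos ph, sin th * sin ph, cos th).

(* integral of a nonnegative function against the normalized spherical
   Lebesgue measure sigma_2 on S^2 *)
Definition sig2int (h : V3 -> \bar R) : \bar R :=
  (((4 * pi)^-1)%:E *
  (\int[lebesgue_measure]_(ph in `[0%R, (2 * pi)%R]%classic)
     \int[lebesgue_measure]_(th in `[0%R, pi%R]%classic)
        (h (sph th ph) * (sin th)%:E)))%E.

Definition hits (p : set V3) : set V3 := [set u | gc u `&` p !=set0].
Definition tau_hit (p : set V3) : \bar R := sig2int (fun u => (\1_(hits p) u)%:E).

Record tess := Tess { cells : seq (set V3); segs : seq (set V3) }.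

Definition e3 : V3 := (0, 0, 1).
Definition Y0 : tess := Tess [:: hemi_p e3; hemi_m e3] [::].

Definition split (T : tess) (i : nat) (u : V3) : tess :=
  let p := nth set0 (cells T) i in
  Tess (take i (cells T) ++ [:: p `&` hemi_p u; p `&` hemi_m u] ++ drop i.+1 (cells T))
       (rcons (segs T) (p `&` gc u)).

Definition rate (T : tess) : R := \sum_(p <- cells T) fine (tau_hit p).

Definition jump (h : tess -> \bar R) (T : tess) : \bar R :=
  (\sum_(i < size (cells T))
     sig2int (fun u => (\1_(hits (nth set0 (cells T) i)) u)%:E * h (split T i u)))%E.

(* Pn f n t T = E_T[ f(Y_t) ; exactly n splits occurred by time t ]
   (standard jump-chain / first-jump decomposition of the pure jump Markov
   process with generator L) *)
Fixpoint Pn (f : tess -> \bar R) (n : nat) (t : R) (T : tess) : \bar R :=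
  match n with
  | 0 => ((expR (- (rate T * t)))%:E * f T)%E
  | n'.+1 => (\int[lebesgue_measure]_(s in `[0%R, t]%classic)
                ((expR (- (rate T * s)))%:E * jump (Pn f n' (t - s)) T))%E
  end.

Definition Expect (f : tess -> \bar R) (t : R) (T : tess) : \bar R :=
  (\sum_(0 <= n <oo) Pn f n t T)%E.

Definition count_set (X : choiceType) (A : set X) : nat := (#|` fset_set A |)%fset.

Definition cellset (T : tess) : set (set V3) := [set p | List.In p (cells T)].

Definition is_vertex (T : tess) (x : V3) : Prop :=
  exists p1 p2 p3, [/\ cellset T p1, cellset T p2, cellset T p3,
    [/\ p1 <> p2, p1 <> p3 & p2 <> p3] & [/\ p1 x, p2 x & p3 x]].

Definition bdry (p : set V3) : set V3 := p `&` closure (sphere `\` p).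

Definition arc (u w : V3) (a : R) : set V3 :=
  [set lin2 (cos th) (sin th) u w | th in `[0, a]%classic].

Definition is_edge (T : tess) (e : set V3) : Prop :=
  exists u w a, [/\ dot u u = 1, dot w w = 1, dot u w = 0, 0 < a <= pi
    & [/\ e = arc u w a,
          exists2 p, cellset T p & e `<=` bdry p,
          is_vertex T u, is_vertex T (lin2 (cos a) (sin a) u w)
        & forall th, 0 < th < a -> ~ is_vertex T (lin2 (cos th) (sin th) u w)]].

(* 1-dimensional faces (sides) of a spherically convex polygon *)
Definition is_side (p : set V3) (s : set V3) : Prop :=
  exists u, [/\ dot u u = 1, p `<=` hemi_p u, s = p `&` gc u & infinite_set s].

Definition nZ (T : tess) : nat := count_set (cellset T).
Definition nV (T : tess) : nat := count_set (is_vertex T).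
Definition nE (T : tess) : nat := count_set (is_edge T).
Definition nS (T : tess) : nat :=
  (\sum_(p <- fset_set (cellset T)) count_set (is_side p))%N.
Definition nM (T : tess) : nat := count_set [set s | List.In s (segs T)].

Definition lam (n : tess -> nat) (t : R) : \bar R :=
  Expect (fun T => ((n T)%:R : R)%:E) t Y0.

End Splitting.

(* Main.v *)
Require Import Defs.
From HB Require Import structures.
From mathcomp Require Import all_boot all_order all_algebra.
From mathcomp Require Import ring lra.
From mathcomp Require Import finmap.
From mathcomp Require Import all_classical all_reals all_analysis measurable_realfun.
Import Order.TTheory GRing.Theory Num.Theory.
Import numFieldNormedType.Exports.
Set Implicit Arguments. Unset Strict Implicit. Unset Printing Implicit Defensive.
Local Open Scope classical_set_scope.
Local Open Scope ring_scope.

(** Each cell is encoded by the seq of its unit inner normals. Almost every great circle is in general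
    position with respect to the normals and vertices already present, and splitting by such a circle adds
    one cell, one maximal segment, two vertices, three edges and four sides, except that splitting a
    hemisphere, which has a single side, adds only three. So every count is of the form A (N - 2) + B + C H,
    with N the number of cells and H the number of unsplit hemispheres.

    Let L be the total splitting rate. Splitting p by g raises L by the measure of the great circles
    hitting p and g together; an independent great circle meets g in two antipodal points, each interior
    to one cell, so these increments sum to 2 over the cells. Every great circle hits a hemisphere, so H
    decays at rate 1. This gives the candidate mean A (N - 2 + L t + t^2) + B + C H exp (- t), which solves
    the first-jump equation. The partial sums over the number of splits stay below it by induction, and
    since L <= N the remainder after k splits is at most M N (N + 1) exp (2 t) / (N + k + 1). *)

(** The candidate mean comes from the generator, which sends N to L, L to the constant 2 and H to -
    H: the span of 1, N, L and H is invariant, and the means solve a linear system of differential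
    equations. The first-jump equation alone does not single out the expectation, which is its least
    nonnegative solution; the remainder bound excludes mass lost through infinitely many splits. Its
    weight N (N + 1) grows by 2 (N + 1) at a split, so at rate L <= N the generator at most doubles
    it.

    The obstacle is measurability: the expectation is built from iterated integrals of functions of
    sets, the indicator of [hits] among them, with no sigma-algebra on tessellations. Integrals are
    therefore compared as lower integrals, which are monotone and blind to null sets for all
    nonnegative functions, and are transferred to lists of normals, where each condition is a finite
    combination of signs of polynomials. Additivity is used only there. *)

(** * Vector algebra, polyhedral cones and general position *)

Section VectorAlgebra.
Variable R : realType.
Implicit Types (x y z u n c w : V3 R) (a b : R) (ns : seq (V3 R)).

Definition negv x : V3 R := (- x.1.1, - x.1.2, - x.2).
Definition cross x y : V3 R :=
  (x.1.2 * y.2 - x.2 * y.1.2, x.2 * y.1.1 - x.1.1 * y.2,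
   x.1.1 * y.1.2 - x.1.2 * y.1.1).
Definition det x y z : R := dot x (cross y z).
Definition zerov : V3 R := (0, 0, 0).

Lemma dotC x y : dot x y = dot y x.
Proof. rewrite /dot; ring. Qed.
Lemma dot_lin2r n a b x y : dot n (lin2 a b x y) = a * dot n x + b * dot n y.
Proof. rewrite /dot /lin2 /=; ring. Qed.
Lemma dot_lin2l n a b x y : dot (lin2 a b x y) n = a * dot x n + b * dot y n.
Proof. rewrite /dot /lin2 /=; ring. Qed.
Lemma dot_negr x n : dot x (negv n) = - dot x n.
Proof. rewrite /dot /negv /=; ring. Qed.
Lemma dot_negl x n : dot (negv x) n = - dot x n.
Proof. rewrite /dot /negv /=; ring. Qed.
Lemma negvK : involutive negv.
Proof. by move=> [[a b] c]; rewrite /negv /= !opprK. Qed.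
Lemma dot_crossl x y : dot x (cross x y) = 0.
Proof. rewrite /dot /cross /=; ring. Qed.
Lemma dot_crossr x y : dot y (cross x y) = 0.
Proof. rewrite /dot /cross /=; ring. Qed.
Lemma dot0r x : dot x zerov = 0.
Proof. rewrite /dot /=; ring. Qed.
Lemma negv_eq x y : negv x = y -> x = negv y.
Proof. by move=> <-; rewrite negvK. Qed.

Lemma dotxx_ge0 x : 0 <= dot x x.
Proof. by rewrite /dot !addr_ge0 // -expr2 sqr_ge0. Qed.

Lemma dotxx_eq0 x : (dot x x == 0) = (x == zerov).
Proof.
case: x => [[a b] c]; rewrite /dot /zerov /= !xpair_eqE -!expr2.
by rewrite paddr_eq0 ?addr_ge0 ?sqr_ge0 // paddr_eq0 ?sqr_ge0 // !sqrf_eq0.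
Qed.

Lemma dotxx_gt0 x : x <> zerov -> 0 < dot x x.
Proof. by move=> /eqP xN0; rewrite lt_neqAle dotxx_ge0 eq_sym dotxx_eq0 xN0. Qed.

Lemma unit_neq0 x : dot x x = 1 -> x <> zerov.
Proof. by move=> x1 x0; move: x1; rewrite x0 dot0r => /esym/eqP; rewrite oner_eq0. Qed.

Lemma V3P x y : (forall z, dot z x = dot z y) -> x = y.
Proof.
move=> xy; have := (xy (1, 0, 0), xy (0, 1, 0), xy (0, 0, 1)).
rewrite /dot /= !(mul0r, mul1r, add0r, addr0).
by case: x y {xy} => [[? ?] ?] [[? ?] ?] /= [[-> ->] ->].
Qed.

Lemma detC1 x y z : det x y z = det y z x.
Proof. rewrite /det /dot /cross /=; ring. Qed.
Lemma detC2 x y z : det x y z = - det y x z.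
Proof. rewrite /det /dot /cross /=; ring. Qed.

(** Expansion of v in the basis dual to x, y, z, tested against m. With the determinant multiplied
    out it is a polynomial identity, valid for dependent vectors as well. *)
Lemma cramer x y z v m : det x y z * dot m v =
  dot x v * dot m (cross y z) + dot y v * dot m (cross z x) + dot z v * dot m (cross x y).
Proof. rewrite /det /dot /cross /=; ring. Qed.

Lemma det_orth0 x y z v : det x y z != 0 -> dot x v = 0 -> dot y v = 0 ->
  dot z v = 0 -> v = zerov.
Proof.
move=> dN0 xv yv zv; apply: V3P => m; rewrite dot0r.
apply/eqP; rewrite -(mulrI_eq0 _ (mulfI dN0)) cramer xv yv zv; apply/eqP; ring.
Qed.

Lemma dot_crossxx x y : dot (cross x y) (cross x y) = dot x x * dot y y - dot x y ^+ 2.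
Proof. rewrite /dot /cross /=; ring. Qed.

Definition onf u c w := [/\ dot u u = 1, dot c c = 1, dot w w = 1 & [/\ dot u c = 0, dot u w = 0 & dot c w = 0]].

Lemma onf_cross u c : dot u u = 1 -> dot c c = 1 -> dot u c = 0 -> onf u c (cross u c).
Proof.
move=> uu cc uc; split=> //; first by rewrite dot_crossxx uu cc uc; ring.
by split=> //; rewrite ?dot_crossl ?dot_crossr.
Qed.

Lemma onf_expand u c x : dot u u = 1 -> dot c c = 1 -> dot u c = 0 -> dot u x = 0 ->
  x = lin2 (dot c x) (dot (cross u c) x) c (cross u c).
Proof.
move=> uu cc uc ux; apply: V3P => m.
have d1 : det u c (cross u c) = 1.
  have -> : det u c (cross u c) = dot u u * dot c c - dot u c ^+ 2.
    by rewrite /det /dot /cross /=; ring.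
  by rewrite uu cc uc; ring.
have := cramer u c (cross u c) x m; rewrite d1 mul1r ux mul0r add0r => ->.
rewrite dot_lin2r; congr (_ * _ + _ * _).
have -> : cross (cross u c) u = lin2 (dot u u) (- dot u c) c u.
  rewrite /cross /lin2 /dot /=; congr (_, _, _); ring.
by rewrite dot_lin2r uu uc; ring.
Qed.

Definition normv x : V3 R := let r := (Num.sqrt (dot x x))^-1 in lin2 r 0 x x.

Lemma dot_normv n x : dot n (normv x) = (Num.sqrt (dot x x))^-1 * dot n x.
Proof. by rewrite dot_lin2r mul0r addr0. Qed.

Lemma sqrt_dot_gt0 x : x <> zerov -> 0 < (Num.sqrt (dot x x))^-1.
Proof. by move=> /dotxx_gt0 x0; rewrite invr_gt0 sqrtr_gt0. Qed.

Lemma normv1 x : x <> zerov -> dot (normv x) (normv x) = 1.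
Proof.
move=> x0; rewrite dot_normv dotC dot_normv mulrA -invfM -expr2 sqr_sqrtr ?dotxx_ge0 //.
by rewrite mulVf // gt_eqF // dotxx_gt0.
Qed.

(** Polygons are studied through the cones over them, where points may be added and scaled freely;
    [normv] leads back to the sphere. *)
Definition cone ns x := all (fun n => 0 <= dot n x) ns.
Definition icone ns x := all (fun n => 0 < dot n x) ns.
Definition spoly ns : set (V3 R) := [set x | sphere x /\ cone ns x].

Lemma coneP ns x : reflect (forall n, n \in ns -> 0 <= dot n x) (cone ns x).
Proof. exact: allP. Qed.
Lemma iconeP ns x : reflect (forall n, n \in ns -> 0 < dot n x) (icone ns x).
Proof. exact: allP. Qed.

Lemma cone_normv ns x : x <> zerov -> cone ns (normv x) = cone ns x.
Proof. by move=> x0; apply: eq_all => n /=; rewrite dot_normv pmulr_rge0 // sqrt_dot_gt0. Qed.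
Lemma dot_normv_eq0 n x : x <> zerov -> (dot n (normv x) == 0) = (dot n x == 0).
Proof. by move=> x0; rewrite dot_normv mulf_eq0 gt_eqF ?sqrt_dot_gt0. Qed.
Lemma dot_normv_gt0 n x : x <> zerov -> (0 < dot n (normv x)) = (0 < dot n x).
Proof. by move=> x0; rewrite dot_normv pmulr_rgt0 // sqrt_dot_gt0. Qed.

Lemma cone_lin2 ns a b x y : 0 <= a -> 0 <= b -> cone ns x -> cone ns y -> cone ns (lin2 a b x y).
Proof.
move=> a0 b0 /coneP cx /coneP cy; apply/coneP => n nns.
by rewrite dot_lin2r addr_ge0 // mulr_ge0 ?cx ?cy.
Qed.

Lemma icone_cone ns x : icone ns x -> cone ns x.
Proof. by move=> /iconeP h; apply/coneP => n /h /ltW. Qed.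

Lemma icone_perturb ns x y : icone ns x ->
  exists2 e, 0 < e & forall t, `|t| <= e -> icone ns (lin2 1 t x y).
Proof.
elim: ns => [|n ns ih] /=; first by exists 1.
move=> /andP[nx /ih[e e0 he]].
(* This bound keeps [t * dot n y] below half of [dot n x]; the summand 1 avoids a zero
   denominator. *)
pose e' := Num.min e (dot n x / (2 * (1 + `|dot n y|))).
have p0 : 0 < 1 + `|dot n y| by rewrite ltr_pwDl.
exists e'; first by rewrite lt_min e0 divr_gt0 // mulr_gt0.
move=> t; rewrite le_min => /andP[te tn]; rewrite he // andbT dot_lin2r mul1r.
have : `|t * dot n y| < dot n x.
  rewrite normrM; apply: (@le_lt_trans _ _ (dot n x / 2)); last by lra.
  apply: (@le_trans _ _ (dot n x / (2 * (1 + `|dot n y|)) * (1 + `|dot n y|))).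
    by apply: ler_pM => //; lra.
  by rewrite invfM mulrA mulfVK // gt_eqF.
by rewrite ltr_norml; lra.
Qed.

Lemma argmax_seq (f : V3 R -> R) ns : ns != [::] ->
  exists2 n, n \in ns & forall m, m \in ns -> f m <= f n.
Proof.
elim: ns => // n ns ih _; have [->|/ih[m mns hm]] := eqVneq ns [::].
  by exists n; rewrite ?mem_head // => m; rewrite inE => /eqP ->.
have [fnm|/ltW fmn] := lerP (f n) (f m).
  by exists m; rewrite ?inE ?mns ?orbT // => k; rewrite inE => /orP[/eqP->|/hm].
exists n; rewrite ?mem_head // => k; rewrite inE => /orP[/eqP->//|/hm h].
exact: le_trans h fmn.
Qed.

(** Since each [dot n c] is positive, each normal bounds t from below by [- (dot n w / dot n c)] on
    the line w + t c; the largest of these bounds is al. *)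
Lemma halfline_end ns c w : icone ns c -> ns != [::] ->
  exists al, exists2 n, n \in ns & dot n (lin2 al 1 c w) = 0 /\
    forall t, cone ns (lin2 t 1 c w) = (al <= t).
Proof.
move=> /iconeP ic /(argmax_seq (fun n => - (dot n w / dot n c)))[n nns nmax].
exists (- (dot n w / dot n c)), n => //; split.
  by rewrite dot_lin2r mul1r mulNr mulfVK ?gt_eqF ?ic // addrC subrr.
move=> t; apply/coneP/idP => [/(_ _ nns)|h m mns].
  by rewrite dot_lin2r mul1r -mulNr ler_pdivrMr ?ic // => ?; lra.
rewrite dot_lin2r mul1r -lerBlDr add0r -ler_pdivrMr ?ic // mulNr.
exact: le_trans (nmax _ mns) h.
Qed.

(** For unit vectors this is linear independence, that is, different great circles. Both signs are
    excluded because D contains each normal with both. *)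
Definition apar x y := (x != y) && (x != negv y).

Lemma apar_sym x y : apar x y = apar y x.
Proof.
rewrite /apar eq_sym; congr (_ && ~~ _).
by apply/eqP/eqP => ->; rewrite negvK.
Qed.
Lemma apar_negl x y : apar (negv x) y = apar x y.
Proof.
rewrite /apar andbC; congr (~~ _ && ~~ _); last by apply/eqP/eqP => [/negv_eq|->]; rewrite ?negvK.
by rewrite (inj_eq (can_inj negvK)).
Qed.
Lemma apar_negr x y : apar x (negv y) = apar x y.
Proof. by rewrite apar_sym apar_negl apar_sym. Qed.
Lemma apar_irr x : apar x x = false.
Proof. by rewrite /apar eqxx. Qed.

Lemma detN x y z : det (negv x) y z = - det x y z.
Proof. by rewrite /det dot_negl. Qed.

(** In terms of great circles: three different circles of D never pass through a common point. *)
Definition genpos (D : seq (V3 R)) :=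
  [/\ forall d, d \in D -> dot d d = 1,
      forall d d', d \in D -> d' \in D -> apar d d' -> cross d d' <> zerov &
      forall d1 d2 d3, d1 \in D -> d2 \in D -> d3 \in D ->
        apar d1 d2 -> apar d2 d3 -> apar d1 d3 -> det d1 d2 d3 != 0].

Definition generic (D : seq (V3 R)) u :=
  [/\ dot u u = 1, forall d, d \in D -> cross u d <> zerov &
      forall d1 d2, d1 \in D -> d2 \in D -> apar d1 d2 -> det u d1 d2 != 0].

Lemma crossC x y : cross x y = negv (cross y x).
Proof. by rewrite /negv /cross /=; congr (_, _, _); ring. Qed.
Lemma crossN x y : cross (negv x) y = negv (cross x y).
Proof. by rewrite /negv /cross /=; congr (_, _, _); ring. Qed.
Lemma negv0 : negv zerov = zerov.
Proof. by rewrite /negv /= oppr0. Qed.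

Lemma generic_neg D u : generic D u -> generic D (negv u).
Proof.
move=> [uu uc ud]; split; first by rewrite dot_negl dot_negr opprK.
  by move=> d dD; rewrite crossN => /negv_eq; rewrite negv0; exact: uc.
by move=> d1 d2 h1 h2 h; rewrite detN oppr_eq0 ud.
Qed.

Lemma generic_apar D u d : generic D u -> d \in D -> apar u d.
Proof.
move=> [_ uc _] /uc udN; apply/andP; split; apply/eqP => e; apply: udN.
  by rewrite e /cross /zerov; congr (_, _, _); ring.
by rewrite e /cross /zerov /=; congr (_, _, _); ring.
Qed.

Lemma genpos_cons1 D u : genpos D -> generic D u -> genpos (u :: D).
Proof.
move=> [Du Dc Dd] [uu uc ud]; split.
- by move=> d; rewrite inE => /orP[/eqP->|/Du].
- move=> d d'; rewrite !inE => /orP[/eqP->|dD] /orP[/eqP->|d'D]; rewrite ?apar_irr // => dd'.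
  + exact: uc.
  + by rewrite crossC => /negv_eq; rewrite negv0; exact: uc.
  + exact: Dc.
- move=> d1 d2 d3; rewrite !inE => /orP[/eqP->|h1] /orP[/eqP->|h2] /orP[/eqP->|h3];
    rewrite ?apar_irr // => ab bc ac.
  + exact: ud.
  + by rewrite detC1 ud // apar_sym.
  + by rewrite detC1 detC1 ud.
  + exact: Dd.
Qed.

(** A pairwise [apar] pair or triple contains at most one of u and [negv u], so the one-vector case
    for that sign applies. *)
Lemma genpos_cons D u : genpos D -> generic D u -> genpos (u :: negv u :: D).
Proof.
move=> gD gu; have [uu _ _] := gu; have gNu := generic_neg gu.
have [Du Dc Dd] := genpos_cons1 gD gu; have [Nu Nc Nd] := genpos_cons1 gD gNu.
split.
- move=> d; rewrite inE => /orP[/eqP->//|]; exact: Nu.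
- move=> d d'; rewrite !inE.
  move=> /or3P[/eqP->|/eqP->|h] /or3P[/eqP->|/eqP->|h'];
    rewrite ?apar_negl ?apar_negr ?apar_irr // => dd';
    by [apply: Dc; rewrite ?inE ?eqxx ?h ?h' ?orbT // |
        apply: Nc; rewrite ?inE ?eqxx ?h ?h' ?orbT // ?apar_negl ?apar_negr].
- move=> d1 d2 d3; rewrite !inE.
  move=> /or3P[/eqP->|/eqP->|h1] /or3P[/eqP->|/eqP->|h2] /or3P[/eqP->|/eqP->|h3];
    rewrite ?apar_negl ?apar_negr ?apar_irr // => ab bc ac;
    by [apply: Dd; rewrite ?inE ?eqxx ?h1 ?h2 ?h3 ?orbT // |
        apply: Nd; rewrite ?inE ?eqxx ?h1 ?h2 ?h3 ?orbT // ?apar_negl ?apar_negr].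
Qed.

Lemma icone_apar ns c n m : icone ns c -> n \in ns -> m \in ns -> n != m -> apar n m.
Proof.
move=> /iconeP ic nns mns nm; rewrite /apar nm; apply/eqP => e.
by have := ic _ nns; rewrite e dot_negl oppr_gt0 lt_gtF ?ic.
Qed.

(** At a point x of the circle of u at most one normal n0 of the cell vanishes, since two would make
    three planes share the line of x. Moving x inside the plane of u towards n0 makes that product
    positive, and a short move keeps the others positive. *)
Lemma generic_interior D ns u c x : genpos D -> generic D u -> {subset ns <= D} -> icone ns c ->
  cone ns x -> dot u x = 0 -> x <> zerov ->
  exists c', [/\ icone ns c', dot u c' = 0 & dot c' c' = 1].
Proof.
move=> gD gu sD ic cx ux xN0.
suff [y iy uy] : exists2 y, icone ns y & dot u y = 0.
  (* Without normals nothing prevents y from being zero, so x itself is taken. *)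
  have [->|ne] := eqVneq ns [::].
    exists (normv x); split=> //; last exact: normv1.
    by apply/eqP; rewrite dot_normv_eq0 ?ux.
  have yN0 : y <> zerov.
    case: ns ne iy {sD ic cx} => // n ns _ /= /andP[+ _] y0.
    by rewrite y0 dot0r ltxx.
  exists (normv y); split; last exact: normv1; last by apply/eqP; rewrite dot_normv_eq0 ?uy.
  by apply/iconeP => n nns; rewrite dot_normv_gt0 // (iconeP _ _ iy).
have [ix|/allPn[n0 n0ns]] := boolP (icone ns x); first by exists x.
rewrite -leNgt => n0x; have {}n0x : dot n0 x = 0.
  by apply/eqP; rewrite eq_le n0x (coneP _ _ cx).
have others m : m \in rem n0 (undup ns) -> 0 < dot m x.
  rewrite mem_rem_uniq ?undup_uniq // !inE mem_undup => /andP[mn0 mns].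
  rewrite lt_neqAle (coneP _ _ cx) // andbT eq_sym; apply/eqP => mx.
  have [_ _ ud] := gu.
  apply/xN0/(@det_orth0 u n0 m) => //; apply: ud; rewrite ?sD //.
  by rewrite apar_sym; apply: icone_apar ic mns n0ns mn0.
have [uu uc _] := gu.
(* The projection of n0 to the plane of u; its product with n0 is positive because u and n0 are
   independent. *)
pose y := lin2 1 (- dot n0 u) n0 u.
have uy : dot u y = 0 by rewrite dot_lin2r uu mul1r mulr1 (dotC n0) subrr.
have n0y : 0 < dot n0 y.
  have n0n0 : dot n0 n0 = 1 by case: gD => + _ _; apply; exact: sD.
  rewrite dot_lin2r n0n0 mul1r mulNr -expr2.
  have := dotxx_gt0 (uc _ (sD _ n0ns)); rewrite dot_crossxx uu n0n0 dotC; lra.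
have [e e0 he] : exists2 e, 0 < e & forall t, `|t| <= e -> icone (rem n0 (undup ns)) (lin2 1 t x y).
  by apply: icone_perturb; apply/iconeP.
exists (lin2 1 e x y); last by rewrite dot_lin2r ux uy; ring.
apply/iconeP => m mns; have [->|mn0] := eqVneq m n0.
  by rewrite dot_lin2r n0x mulr0 add0r mulr_gt0.
have /he/iconeP : `|e| <= e by rewrite ger0_norm // ltW.
by apply; rewrite mem_rem_uniq ?undup_uniq // !inE mem_undup mn0.
Qed.

End VectorAlgebra.
Arguments icone_perturb {R ns x} y _.

(** * Great circles in polar angle and their intersection with a cone *)

Section Arcs.
Variable R : realType.
Implicit Types (x y z u n c w : V3 R) (a b th : R) (ns : seq (V3 R)).

Definition pt c w th : V3 R := lin2 (cos th) (sin th) c w.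

Lemma dot_pt n c w th : dot n (pt c w th) = cos th * dot n c + sin th * dot n w.
Proof. exact: dot_lin2r. Qed.

Lemma pt0 c w : pt c w 0 = c.
Proof. by apply: V3P => m; rewrite dot_pt cos0 sin0; ring. Qed.
Lemma ptN c w th : pt c w (- th) = pt c (negv w) th.
Proof. by apply: V3P => m; rewrite !dot_pt cosN sinN dot_negr; ring. Qed.
(** Changes the base point of a circle: the angle a + pi / 2 gives the tangent direction at the
    point of angle a. *)
Lemma pt_rot c w a b : pt (pt c w a) (pt c w (a + pi / 2)) b = pt c w (a + b).
Proof.
apply: V3P => m; rewrite !dot_pt !sinDpihalf !cosDpihalf cosD sinD; ring.
Qed.

Definition onp x y := [/\ dot x x = 1, dot y y = 1 & dot x y = 0].

Lemma onp_pt x y th : onp x y -> dot (pt x y th) (pt x y th) = 1.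
Proof.
move=> [xx yy xy]; rewrite dot_pt !dot_lin2l xx yy xy (dotC y x) xy.
by rewrite -[RHS](cos2Dsin2 th); ring.
Qed.

Lemma onp_rot x y th : onp x y -> onp (pt x y th) (pt x y (th + pi / 2)).
Proof.
move=> h; split; rewrite ?onp_pt //; case: h => xx yy xy.
by rewrite dot_pt !dot_lin2l xx yy xy (dotC y x) xy sinDpihalf cosDpihalf; ring.
Qed.

Lemma cot_angle a : exists th, 0 < th < pi /\ cos th = a * sin th.
Proof.
exists (pi / 2 - atan a); have := (@atan_gtNpi2 _ a, @atan_ltpi2 _ a) => -[h1 h2].
split; first lra.
rewrite cosB sinB cos_pihalf sin_pihalf !mul0r !mul1r add0r subr0.
have c0 : cos (atan a) != 0 by rewrite gt_eqF // cos_gt0_pihalf // h1 h2.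
by rewrite -{2}(atanK a) /tan mulfVK.
Qed.

Lemma unit_angle a b : a ^+ 2 + b ^+ 2 = 1 -> exists th, [/\ - pi <= th <= pi, a = cos th & b = sin th].
Proof.
move=> ab.
have a1 : -1 <= a <= 1.
  rewrite -ler_norml -(@ler_pXn2r _ 2) ?nnegrE // expr1n real_normK ?num_real //.
  by have := sqr_ge0 b; lra.
have := acos_ge0 a1; have := acos_lepi a1 => ap a0.
have s2 : sin (acos a) = `|b|.
  by rewrite sin_acos // (_ : 1 - a ^+ 2 = b ^+ 2) ?sqrtr_sqr //; lra.
have [b0|b0] := lerP 0 b.
  exists (acos a); rewrite acosK ?in_itv // s2 ger0_norm //; split=> //; lra.
exists (- acos a); rewrite cosN acosK ?in_itv // sinN s2 ltr0_norm // opprK; split=> //; lra.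
Qed.

Lemma sin_ge0_iff th : - pi < th < pi -> (0 <= sin th) = (0 <= th).
Proof.
move=> /andP[h1 h2]; have [h|h] := lerP 0 th.
  by rewrite sin_ge0_pi // h ltW.
by apply/negbTE; rewrite -ltNge -oppr_gt0 -sinN sin_gt0_pi //; lra.
Qed.

(* A plane section of a cone with an interior ray c on the section, seen in the polar angle from c. *)
Lemma half_section ns c w : icone ns c -> ns != [::] ->
  exists th0 n al, [/\ 0 < th0 < pi, n \in ns, dot n (pt c w th0) = 0,
    cos th0 = al * sin th0 & (forall th, 0 < th < pi -> cone ns (pt c w th) = (th <= th0)) /\
    (forall t, cone ns (lin2 t 1 c w) = (al <= t))].
Proof.
move=> ic ne; have [al [n nns [n0 hal]]] := halfline_end w ic ne.
have [th0 [th0I c0]] := cot_angle al.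
have s0 := sin_gt0_pi th0I.
have cpt th : 0 < th < pi -> cone ns (pt c w th) = cone ns (lin2 (cos th / sin th) 1 c w).
  move=> /sin_gt0_pi sth; apply: eq_all => m.
  rewrite dot_pt dot_lin2r -[RHS](pmulr_rge0 _ sth).
  by congr (_ <= _); field; rewrite gt_eqF.
exists th0, n, al; split=> //.
  by rewrite dot_pt c0 -[RHS](mulr0 (sin th0)) -n0 dot_lin2r; ring.
split=> // th thI; rewrite cpt // hal; have sth := sin_gt0_pi thI.
(* Both sines being positive, the comparison of cotangents [al <= cos th / sin th] becomes
   [0 <= sin (th0 - th)]. *)
rewrite ler_pdivlMr // -(ler_pM2r s0) -subr_ge0.
rewrite (_ : _ - _ = sin (th0 - th)) ?sin_ge0_iff ?subr_ge0 //; first by lra.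
by rewrite sinB c0; ring.
Qed.

(** Two half sections, in the directions w and [negv w], are glued at the interior point c. The
    antipode of c is outside because some normal is positive at c. *)
Lemma section_arc ns c w : icone ns c -> ns != [::] ->
  exists th1 th2 n1 n2, [/\ [/\ 0 < th1 < pi, 0 < th2 < pi & th1 + th2 <= pi],
    n1 \in ns /\ dot n1 (pt c w th1) = 0, n2 \in ns /\ dot n2 (pt c w (- th2)) = 0,
    forall th, - pi <= th <= pi -> cone ns (pt c w th) = (- th2 <= th <= th1) &
    forall th, - th2 < th < th1 -> icone ns (pt c w th)].
Proof.
move=> ic ne.
have [th1 [n1 [a1 [th1I n1ns n10 c1 [h1 g1]]]]] := half_section w ic ne.
have [th2 [n2 [a2 [th2I n2ns n20 c2 [h2 g2]]]]] := half_section (negv w) ic ne.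
exists th1, th2, n1, n2.
have s1 := sin_gt0_pi th1I; have s2 := sin_gt0_pi th2I.
(* The points a1 c + w and a2 c - w both lie in the cone; adding their products with n1 leaves (a1 +
   a2) [dot n1 c]. By the sine addition formula this is what bounds th1 + th2 by pi. *)
have a12 : 0 <= a1 + a2.
  have := lexx a1; rewrite -g1 => /coneP/(_ _ n1ns); rewrite dot_lin2r mul1r => e1.
  have := lexx a2; rewrite -g2 => /coneP/(_ _ n1ns); rewrite dot_lin2r mul1r dot_negr => e2.
  have : 0 < dot n1 c by exact: (iconeP _ _ ic).
  by move=> nc; rewrite -(pmulr_lge0 _ nc); lra.
have t12 : th1 + th2 <= pi.
  rewrite leNgt; apply/negP => gt.
  have : 0 < sin (th1 + th2 - pi) by apply: sin_gt0_pi; lra.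
  rewrite sinB sinpi mulr0 subr0 cospi mulrN1 sinD c1 c2 => lt0.
  have : 0 <= sin th1 * sin th2 * (a1 + a2) by rewrite !mulr_ge0 // ltW.
  by lra.
have cN th : - pi < th < 0 -> cone ns (pt c w th) = (- th2 <= th).
  by move=> thI; rewrite -[th in LHS]opprK ptN h2 ?lerN2 1?lerNl //; lra.
have nc n : n \in ns -> 0 < dot n c by exact: (iconeP _ _ ic).
split=> //; first by rewrite ptN.
  move=> th thI; have [th0|th0|->] := ltrgtP th 0.
  - have [->|thp] := eqVneq th (- pi).
      transitivity false; last by apply/esym/negbTE; rewrite negb_and -!ltNge; apply/orP; left; lra.
      apply/negbTE/negP => /coneP/(_ _ n1ns); rewrite dot_pt cosN sinN cospi sinpi.
      by have := nc _ n1ns; lra.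
    have lt : - pi < th by rewrite lt_neqAle eq_sym thp; case/andP: thI.
    by rewrite cN ?lt //; rewrite [th <= th1](_ : _ = true) ?andbT //; lra.
  - have [->|thp] := eqVneq th pi.
      transitivity false; last by apply/esym/negbTE; rewrite negb_and -!ltNge; apply/orP; right; lra.
      apply/negbTE/negP => /coneP/(_ _ n1ns); rewrite dot_pt cospi sinpi.
      by have := nc _ n1ns; lra.
    have lt : th < pi by rewrite lt_neqAle thp; case/andP: thI.
    by rewrite h1 ?th0 //; rewrite [- th2 <= th](_ : _ = true) //; lra.
  rewrite pt0 icone_cone //; apply/esym; lra.
(* Spherical interpolation: a point strictly between c and the end is a positive combination of the
   two, and c is interior. *)
have conv w' a th n : 0 < a < pi -> 0 < th < a -> n \in ns -> 0 <= dot n (pt c w' a) ->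
    0 < dot n (pt c w' th).
  move=> aI thI nns na; have sa := sin_gt0_pi aI.
  have sth : 0 < sin th by apply: sin_gt0_pi; lra.
  have sb : 0 < sin (a - th) by apply: sin_gt0_pi; lra.
  rewrite -(pmulr_rgt0 _ sa).
  rewrite (_ : _ * _ = sin (a - th) * dot n c + sin th * dot n (pt c w' a)).
    by rewrite ltr_pwDl ?mulr_gt0 ?nc // mulr_ge0 // ltW.
  by rewrite sinB !dot_pt; ring.
move=> th thI; apply/iconeP => n nns; have [th0|th0|->] := ltrgtP th 0.
- rewrite -[th]opprK ptN (conv _ th2) //; first by lra.
  by have := h2 th2 th2I; rewrite lexx => /coneP; exact.
- rewrite (conv _ th1) //; first by lra.
  by have := h1 th1 th1I; rewrite lexx => /coneP; exact.
- by rewrite pt0 nc.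
Qed.

End Arcs.

(** * Combinatorics of encoded tessellations and its preservation by a split *)

Section Good.
Variable R : realType.
Implicit Types (x y z u n c w d : V3 R) (a b th : R) (ns ms : seq (V3 R)).
Implicit Types (nss : seq (seq (V3 R))) (D : seq (V3 R)).

(* D collects the normals of all splits so far, with both signs. A cell may list redundant normals. *)
Record good nss D : Prop := Good {
  g_uniq : uniq nss;
  g_gp : genpos D;
  g_sub : forall ns, ns \in nss -> {subset ns <= D};
  g_ne : forall ns, ns \in nss -> ns != [::];
  g_un : forall ns, ns \in nss -> uniq ns;
  g_int : forall ns, ns \in nss -> exists c, icone ns c;
  g_sep : forall ns ms, ns \in nss -> ms \in nss -> ns <> ms ->
    exists2 d, d \in ns & negv d \in ms;
  g_cover : forall x, exists2 ns, ns \in nss & cone ns x;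
  g_bd : forall ns n x, ns \in nss -> n \in ns -> cone ns x -> dot n x = 0 ->
    exists ms, [/\ ms \in nss, ms <> ns & cone ms x] }.

Definition hitc ns u := exists x, [/\ x <> zerov R, dot u x = 0 & cone ns x].

Definition splitn nss i u :=
  let ns := nth [::] nss i in
  take i nss ++ [:: u :: ns; negv u :: ns] ++ drop i.+1 nss.

Lemma perm_splitn nss i u : (i < size nss)%N ->
  perm_eq (splitn nss i u)
    ((u :: nth [::] nss i) :: (negv u :: nth [::] nss i) :: rem (nth [::] nss i) nss).
Proof.
move=> isz; rewrite /splitn; cbv zeta.
have p1 : perm_eq (take i nss ++ drop i.+1 nss) (rem (nth [::] nss i) nss).
  have := perm_to_rem (mem_nth [::] isz).
  rewrite -{1}(cat_take_drop i nss) (drop_nth [::] isz).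
  by rewrite -[_ :: drop _ _]cat1s perm_catCA /= perm_cons.
by rewrite perm_catCA /= !perm_cons.
Qed.

(** A split up to the order of the cells: none of the counts depends on positions in the list. *)
Definition refines nss ns u nss' :=
  perm_eq nss' ((u :: ns) :: (negv u :: ns) :: rem ns nss).

Lemma mem_refines nss D ns u nss' ms : good nss D -> refines nss ns u nss' ->
  (ms \in nss') = [|| ms == u :: ns, ms == negv u :: ns | (ms != ns) && (ms \in nss)].
Proof.
move=> g /perm_mem ->; rewrite !inE mem_rem_uniq ?inE //; exact: g_uniq g.
Qed.

Lemma size_refines nss ns u nss' : ns \in nss -> refines nss ns u nss' ->
  size nss' = (size nss).+1.
Proof.
move=> h /perm_size ->; rewrite /= size_rem // prednK //.
by case: nss h.
Qed.

Lemma refines_sum (f : seq (V3 R) -> nat) nss ns u nss' : ns \in nss -> refines nss ns u nss' ->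
  (\sum_(m <- nss') f m + f ns = \sum_(m <- nss) f m + f (u :: ns) + f (negv u :: ns))%N.
Proof.
move=> h p; rewrite (perm_big _ p) (perm_big _ (perm_to_rem h)) !big_cons /=.
ring.
Qed.

Lemma section_interior nss D ns u : good nss D -> generic D u -> ns \in nss -> hitc ns u ->
  exists c, [/\ icone ns c, dot u c = 0 & dot c c = 1].
Proof.
move=> g gu h [x [x0 ux cx]]; have [c0 ic0] := g_int g h.
exact: (generic_interior (g_gp g) gu (g_sub g h) ic0 cx ux x0).
Qed.

Lemma subcell_interior ns u c : icone ns c -> dot u c = 0 -> dot u u = 1 ->
  (exists c', icone (u :: ns) c') /\ (exists c', icone (negv u :: ns) c').
Proof.
move=> /(icone_perturb u)[e e0 he] uc uu; split.
  exists (lin2 1 e c u); rewrite /= he ?ger0_norm ?lexx ?ltW // andbT.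
  by rewrite dot_lin2r uc uu; lra.
exists (lin2 1 (- e) c u); rewrite /= he ?normrN ?ger0_norm ?lexx ?ltW // andbT.
by rewrite dot_lin2r !dot_negl uc uu; lra.
Qed.

(** Neither u nor [negv u] is in D, so both halves differ from every old list. The halves are
    separated from each other by u and from the other cells by a normal of the parent; a point of
    the parent lies in the half on its side of u. *)
Lemma good_split nss D ns u nss' : good nss D -> generic D u -> ns \in nss -> hitc ns u ->
  refines nss ns u nss' -> good nss' (u :: negv u :: D).
Proof.
move=> g gu nsin hit ref; have mem ms := mem_refines ms g ref.
have [c [ic uc _]] := section_interior g gu nsin hit.
have [uu _ _] := gu.
have uND : u \notin D by apply/negP => /(generic_apar gu); rewrite apar_irr.
have NuND : negv u \notin D.
  by apply/negP => /(generic_apar gu); rewrite apar_negr apar_irr.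
have uNu : u != negv u.
  apply/eqP => e; have : dot u (negv u) = 1 by rewrite -e.
  by rewrite dot_negr uu => ?; lra.
have notin ms m : ms \in nss -> m \notin D -> m \notin ms.
  by move=> h; apply: contra; exact: (g_sub g h).
have nsN ms : ms \in nss -> ms <> ns -> ms \in nss'.
  by move=> h /eqP hN; rewrite mem h hN !orbT.
have p1 : u :: ns \in nss' by rewrite mem eqxx.
have p2 : negv u :: ns \in nss' by rewrite mem eqxx !orbT.
split.
- rewrite (perm_uniq ref) /= !inE rem_uniq ?(g_uniq g) // andbT eqseq_cons (negbTE uNu) /=.
  by apply/andP; split; apply/negP => /mem_rem h; [move: (notin _ _ h uND)|move: (notin _ _ h NuND)];
    rewrite mem_head.
- exact: genpos_cons (g_gp g) gu.
- move=> ms; rewrite mem => /or3P[/eqP->|/eqP->|/andP[_ h]] m; rewrite !inE.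
  + by case/orP=> [->//|/(g_sub g nsin) ->]; rewrite !orbT.
  + by case/orP=> [->|/(g_sub g nsin) ->]; rewrite !orbT.
  + by move=> /(g_sub g h) ->; rewrite !orbT.
- by move=> ms; rewrite mem => /or3P[/eqP->|/eqP->|/andP[_ /(g_ne g)]].
- move=> ms; rewrite mem => /or3P[/eqP->|/eqP->|/andP[_ /(g_un g)]] //=.
  + by rewrite notin // (g_un g).
  + by rewrite notin // (g_un g).
- have [i1 i2] := subcell_interior ic uc uu.
  by move=> ms; rewrite mem => /or3P[/eqP->|/eqP->|/andP[_ /(g_int g)]].
- have sep ms m : ms \in nss -> ms <> ns ->
     (exists2 d, d \in m :: ns & negv d \in ms) /\ (exists2 d, d \in ms & negv d \in m :: ns).
    move=> h hN; split.
      by have [d dn dm] := g_sep g nsin h (nesym hN); exists d; rewrite ?inE ?dn ?orbT.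
    by have [d dn dm] := g_sep g h nsin hN; exists d; rewrite ?inE ?dm ?orbT.
  move=> ms ms'; rewrite !mem.
  move=> /or3P[/eqP->|/eqP->|/andP[/eqP hN h]] /or3P[/eqP->|/eqP->|/andP[/eqP hN' h']] // hh.
  + by exists u; rewrite inE eqxx.
  + by case: (sep _ u h' hN').
  + by exists (negv u); rewrite ?negvK inE eqxx.
  + by case: (sep _ (negv u) h' hN').
  + by case: (sep _ u h hN).
  + by case: (sep _ (negv u) h hN).
  + exact: (g_sep g h h' hh).
- move=> x; have [ms h cx] := g_cover g x.
  have [e|/eqP hN] := eqVneq ms ns; last by exists ms => //; exact: nsN.
  have [ux|ux] := lerP 0 (dot u x); [exists (u :: ns)|exists (negv u :: ns)] => //.
    by rewrite /= ux -e.
  by rewrite /= dot_negl oppr_ge0 ltW // -e.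
(* Boundary points on an old normal: the neighbour of the old cell ms still serves, and if it is the
   cell being split, its half containing x does. *)
- have main ms' ms n x : ms' \in nss' -> ms \in nss -> cone ms x -> n \in ms -> dot n x = 0 ->
     (ms = ns \/ ms' = ms) -> {subset ms <= ms'} ->
     exists ks, [/\ ks \in nss', ks <> ms' & cone ks x].
    move=> h' h cx nms nx hh sub; have [ks [kin kN kx]] := g_bd g h nms cx nx.
    have [e|/eqP ksN] := eqVneq ks ns; last first.
      exists ks; split=> //; first exact: nsN.
      case: hh => [e|-> //]; move: h'; rewrite mem => /or3P[/eqP e'|/eqP e'|/andP[/eqP h1 h2]].
      - by move=> e2; have := notin _ _ kin uND; rewrite e2 e' mem_head.
      - by move=> e2; have := notin _ _ kin NuND; rewrite e2 e' mem_head.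
      - move=> e2.
        have [d dm dms] := g_sep g h kin (nesym kN).
        have [c1 /iconeP ic1] := g_int g h2.
        have := ic1 _ (sub _ dm); have := ic1 (negv d); rewrite -e2 dot_negl => /(_ dms).
        by move=> *; lra.
    case: hh => [e'|e']; first by case: kN; rewrite e.
    have [ux|ux] := lerP 0 (dot u x); [exists (u :: ns)|exists (negv u :: ns)]; split=> //.
    + by rewrite e' => e2; have := notin _ _ h uND; rewrite -e2 mem_head.
    + by rewrite /= ux -e.
    + by rewrite e' => e2; have := notin _ _ h NuND; rewrite -e2 mem_head.
    + by rewrite /= dot_negl oppr_ge0 ltW // -e.
  move=> ms n x hms; move: (hms); rewrite mem => /or3P[/eqP e|/eqP e|/andP[/eqP hN h]].
  + rewrite e inE => /orP[/eqP->|nns] /= /andP[ux cx] nx.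
      exists (negv u :: ns); split=> //; last by rewrite /= cx dot_negl nx oppr0 lexx.
      by move=> [/esym/eqP]; rewrite (negbTE uNu).
    rewrite -e; apply: (main ms ns n x) => //; first by left.
    by move=> m; rewrite e inE orbC => ->.
  + rewrite e inE => /orP[/eqP->|nns] /= /andP[ux cx] nx.
      have ux0 : dot u x = 0 by apply/eqP; rewrite -oppr_eq0 -dot_negl nx.
      exists (u :: ns); split=> //; last by rewrite /= cx ux0 lexx.
      by move=> [/eqP]; rewrite (negbTE uNu).
    rewrite -e; apply: (main ms ns n x) => //; first by left.
    by move=> m; rewrite e inE orbC => ->.
  + by move=> nms cx nx; apply: (main ms ms n x) => //; right.
Qed.

End Good.

Lemma count_setE (X : choiceType) (A : set X) (s : seq X) :
  uniq s -> (forall x, A x <-> x \in s) -> count_set A = size s.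
Proof.
move=> us As.
have e : [set` [fset x in s]%fset] = A.
  by apply/seteqP; split=> x /=; rewrite inE /= => /As.
by rewrite /count_set -e set_fsetK card_fseq undup_id.
Qed.

Lemma InP (X : eqType) (s : seq X) x : List.In x s <-> x \in s.
Proof.
elim: s => //= y s ih; rewrite inE; split.
  by case=> [->|/ih ->]; rewrite ?eqxx ?orbT.
by case/orP => [/eqP->|/ih]; [left|right].
Qed.

Lemma infinite_of_interval (R : realType) (X : Type) (S : set X) (f : X -> R) e :
  0 < e -> (forall t, 0 <= t <= e -> exists2 x, S x & f x = t) -> infinite_set S.
Proof.
move=> e0 h /(finite_image f) fin.
have inj : {in [set: nat] &, injective (fun k : nat => e / k.+1%:R)}.
  move=> i j _ _ /(mulfI (lt0r_neq0 e0)) /invr_inj /eqP.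
  by rewrite eqr_nat eqSS => /eqP.
apply: infinite_nat; rewrite -(eq_finite_set (inj_card_eq inj)).
apply: sub_finite_set fin => _ [k _ <-] /=.
have [|x Sx fx] := h (e / k.+1%:R); last by exists x.
apply/andP; split; first by rewrite divr_ge0 // ltW.
by rewrite ler_pdivrMr ?ltr0n // ler_peMr ?ler1n // ltW.
Qed.

(** * Cells, maximal segments and vertices *)

Section Counts.
Variable R : realType.
Implicit Types (x y z u n c w d : V3 R) (a b th : R) (ns ms : seq (V3 R)).
Implicit Types (nss : seq (seq (V3 R))) (D : seq (V3 R)).

Definition mktess nss (segs : seq (set (V3 R))) := Tess (map (@spoly R) nss) segs.

Lemma spoly_ge0 ns x n : spoly ns x -> n \in ns -> 0 <= dot n x.
Proof. by move=> [_ /coneP]; apply. Qed.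

(** Objects are counted as sets of points, so different lists must give different sets: an interior
    point of one cell is positive on a normal d whose opposite belongs to the other cell. *)
Lemma spoly_inj nss D : good nss D -> {in nss &, injective (@spoly R)}.
Proof.
move=> g ns ms h h' e; apply/eqP/negPn/negP => /eqP hN.
have [d dn dm] := g_sep g h h' hN; have [c ic] := g_int g h.
have dc : 0 < dot d c by exact: (iconeP _ _ ic).
have c0 : c <> zerov R by move=> c0; move: dc; rewrite c0 dot0r ltxx.
have : spoly ns (normv c) by split; [exact: normv1|rewrite cone_normv // icone_cone].
rewrite e => /spoly_ge0 /(_ dm); rewrite dot_negl dot_normv oppr_ge0 pmulr_rle0 ?sqrt_dot_gt0 //.
by rewrite leNgt dc.
Qed.

Lemma cellsetP nss segs p : cellset (mktess nss segs) p <-> exists2 ns, ns \in nss & p = spoly ns.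
Proof.
rewrite /cellset /= InP; split; last by case=> ns h ->; exact: map_f.
by move=> /mapP.
Qed.

Lemma nZE nss D segs : good nss D -> nZ (mktess nss segs) = size nss.
Proof.
move=> g; rewrite /nZ (@count_setE _ _ (map (@spoly R) nss)) ?size_map //.
  by rewrite map_inj_in_uniq ?(g_uniq g) //; exact: spoly_inj g.
by move=> p; rewrite cellsetP; split=> [[ns h ->]|/mapP//]; exact: map_f.
Qed.

Lemma nME nss segs : uniq segs -> nM (mktess nss segs) = size segs.
Proof. by move=> us; rewrite /nM (@count_setE _ _ segs) // => x /=; exact: InP. Qed.

Definition vtx nss x := sphere x /\ exists m1 m2 m3,
  [/\ m1 \in nss, m2 \in nss, m3 \in nss,
    [/\ m1 <> m2, m1 <> m3 & m2 <> m3] & [/\ cone m1 x, cone m2 x & cone m3 x]].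

Lemma is_vertexE nss D segs x : good nss D -> is_vertex (mktess nss segs) x <-> vtx nss x.
Proof.
move=> g; split.
  case=> p1 [p2 [p3 [/cellsetP[m1 h1 ->] /cellsetP[m2 h2 ->] /cellsetP[m3 h3 ->]]]].
  move=> [n12 n13 n23] [[sx c1] [_ c2] [_ c3]]; split=> //; exists m1, m2, m3; split=> //.
  by split; [move: n12|move: n13|move: n23] => /[swap] ->.
case=> sx [m1 [m2 [m3 [h1 h2 h3 [n12 n13 n23] [c1 c2 c3]]]]].
exists (spoly m1), (spoly m2), (spoly m3).
split.
- by apply/cellsetP; exists m1.
- by apply/cellsetP; exists m2.
- by apply/cellsetP; exists m3.
- by split=> /(spoly_inj g) e; [apply: n12|apply: n13|apply: n23]; apply: e.
- by split.
Qed.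

Section Split.
Variables (nss : seq (seq (V3 R))) (D : seq (V3 R)) (ns : seq (V3 R)) (u : V3 R).
Variable nss' : seq (seq (V3 R)).
Hypotheses (g : good nss D) (gu : generic D u) (nsin : ns \in nss) (hit : hitc ns u).
Hypothesis ref : refines nss ns u nss'.

Let mem ms := mem_refines ms g ref.

Definition parent ms := if (ms == u :: ns) || (ms == negv u :: ns) then ns else ms.
(** For fixed x this is an injection of the old cells into the new ones that preserves whether x
    belongs to the cell; hence cells meeting at x before the split yield as many afterwards. *)
Definition child x ms := if ms == ns then (if 0 <= dot u x then u :: ns else negv u :: ns) else ms.

Lemma uND : u \notin D.
Proof. by apply/negP => /(generic_apar gu); rewrite apar_irr. Qed.
Lemma NuND : negv u \notin D.
Proof. by apply/negP => /(generic_apar gu); rewrite apar_negr apar_irr. Qed.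
Lemma notin_cell ms m : ms \in nss -> m \notin D -> m \notin ms.
Proof. by move=> h; apply: contra; exact: (g_sub g h). Qed.

Lemma u_neq_negu : u != negv u.
Proof.
have [uu _ _] := gu; apply/eqP => e; have : dot u (negv u) = 1 by rewrite -e.
by rewrite dot_negr uu => ?; lra.
Qed.

Lemma child_in x ms : ms \in nss -> child x ms \in nss'.
Proof.
move=> h; rewrite /child mem; case: (eqVneq ms ns) => [_|hN]; last by rewrite h hN !orbT.
by case: ifP; rewrite eqxx ?orbT.
Qed.

Lemma child_cone x ms : cone (child x ms) x = cone ms x.
Proof.
rewrite /child; case: (eqVneq ms ns) => [->|//].
by case: lerP => ux /=; rewrite ?ux // dot_negl oppr_ge0 ltW.
Qed.

Lemma child_inj x : {in nss &, injective (child x)}.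
Proof.
move=> m1 m2 h1 h2; rewrite /child; case: (eqVneq m1 ns) => [->|_]; case: (eqVneq m2 ns) => [->|_] //.
  case: ifP => _ e; [have := notin_cell h2 uND|have := notin_cell h2 NuND]; by rewrite -e mem_head.
case: ifP => _ e; [have := notin_cell h1 uND|have := notin_cell h1 NuND]; by rewrite e mem_head.
Qed.

Lemma parent1 : parent (u :: ns) = ns.
Proof. by rewrite /parent eqxx. Qed.
Lemma parent2 : parent (negv u :: ns) = ns.
Proof. by rewrite /parent eqxx orbT. Qed.
Lemma parent3 ms : ms \in nss -> parent ms = ms.
Proof.
move=> h; rewrite /parent; case: eqP => [e|_] /=; first by have := notin_cell h uND; rewrite e mem_head.
by case: eqP => [e|_] //; have := notin_cell h NuND; rewrite e mem_head.
Qed.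

Lemma parent_in ms : ms \in nss' -> parent ms \in nss.
Proof.
by rewrite mem /parent; case: eqP => [|_]; case: eqP => [|_] //=; rewrite ?nsin // => /andP[].
Qed.

Lemma parent_cone ms x : cone ms x -> cone (parent ms) x.
Proof.
by rewrite /parent; case: eqP => [->|_] /=; [case/andP | case: eqP => [->|//] /=; case/andP].
Qed.

(** Different new cells with the same parent must be the two halves, and these meet only on the
    circle of u. *)
Lemma new_side m1 m2 x : m1 \in nss' -> m2 \in nss' -> m1 <> m2 -> cone m1 x -> cone m2 x ->
  parent m1 = parent m2 -> dot u x = 0 /\ cone ns x.
Proof.
have aux : cone (u :: ns) x -> cone (negv u :: ns) x -> dot u x = 0 /\ cone ns x.
  move=> /= /andP[ux cx] /andP[]; rewrite dot_negl oppr_ge0 => ux' _; split=> //.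
  by apply/eqP; rewrite eq_le ux ux'.
rewrite !mem => /or3P[/eqP->|/eqP->|/andP[/eqP N1 h1]] /or3P[/eqP->|/eqP->|/andP[/eqP N2 h2]];
  rewrite ?parent1 ?parent2 ?parent3 // => n12 c1 c2 e; do ?[by case: n12|exact: aux|exact: (aux c2 c1)|by case: N1|by case: N2].
Qed.

(** The separating normal d is nonnegative and nonpositive at a common point. *)
Lemma common_boundary m1 m2 x : m1 \in nss -> m2 \in nss -> m1 <> m2 -> cone m1 x -> cone m2 x ->
  exists2 n, n \in m1 & dot n x = 0.
Proof.
move=> h1 h2 n12 /coneP c1 /coneP c2; have [d d1 d2] := g_sep g h1 h2 n12.
exists d => //; apply/eqP; rewrite eq_le c1 // andbT.
by have := c2 _ d2; rewrite dot_negl oppr_ge0.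
Qed.

(** If three new cells at x have different parents, x is an old vertex. Otherwise two of them are
    the halves of ns, so x is on the cut, and the third cell places x on the boundary of ns.
    Conversely, a boundary point of ns on the cut belongs to both halves and to a neighbour. *)
Lemma vtx_split x : vtx nss' x <->
  vtx nss x \/ [/\ sphere x, dot u x = 0, cone ns x & exists2 n, n \in ns & dot n x = 0].
Proof.
split.
  case=> sx [m1 [m2 [m3 [h1 h2 h3 [n12 n13 n23] [c1 c2 c3]]]]].
  have third m m' k : m \in nss' -> m' \in nss' -> k \in nss' -> m <> m' -> m <> k -> m' <> k ->
      cone m x -> cone m' x -> cone k x -> parent m = parent m' ->
      [/\ sphere x, dot u x = 0, cone ns x & exists2 n, n \in ns & dot n x = 0].
    move=> hm hm' hk mm' mk m'k cm cm' ck pe.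
    have [ux cx] := new_side hm hm' mm' cm cm' pe.
    have kN : parent k <> ns.
      move: hm hm' hk pe mm' mk m'k.
      by rewrite !mem => /or3P[/eqP->|/eqP->|/andP[/eqP N1 k1]] /or3P[/eqP->|/eqP->|/andP[/eqP N2 k2]]
        /or3P[/eqP->|/eqP->|/andP[/eqP N3 k3]]; rewrite ?parent1 ?parent2 ?parent3 // => *; congruence.
    split=> //; apply: common_boundary (parent_in hk) (nesym kN) cx (parent_cone ck) => //.
  have [e12|N12] := eqVneq (parent m1) (parent m2).
    by right; exact: (third m1 m2 m3).
  have [e13|N13] := eqVneq (parent m1) (parent m3).
    by right; apply: (third m1 m3 m2) => //; exact: nesym.
  have [e23|N23] := eqVneq (parent m2) (parent m3).
    by right; apply: (third m2 m3 m1) => //; exact: nesym.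
  left; split=> //; exists (parent m1), (parent m2), (parent m3).
  by split; rewrite ?parent_in //; split; [exact/eqP|exact/eqP|exact/eqP| | |]; exact: parent_cone.
case=> [[sx [m1 [m2 [m3 [h1 h2 h3 [n12 n13 n23] [c1 c2 c3]]]]]]|[sx ux cx [n nns nx]]].
  split=> //; exists (child x m1), (child x m2), (child x m3).
  split; rewrite ?child_in //; split; rewrite ?child_cone //.
  - by move=> /(child_inj h1 h2).
  - by move=> /(child_inj h1 h3).
  - by move=> /(child_inj h2 h3).
split=> //; have [ks [kin kN ck]] := g_bd g nsin nns cx nx.
exists (u :: ns), (negv u :: ns), ks; split=> //.
- by rewrite mem eqxx.
- by rewrite mem eqxx orbT.
- by rewrite mem kin (introN eqP kN) !orbT.
- split.
  + by move=> [/eqP]; rewrite (negbTE u_neq_negu).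
  + by move=> e; have := notin_cell kin uND; rewrite -e mem_head.
  + by move=> e; have := notin_cell kin NuND; rewrite -e mem_head.
- by split=> //=; rewrite ?dot_negl ux ?oppr0 lexx.
Qed.

End Split.
End Counts.

(** * The arc cut out of a cell by a generic great circle *)

Section SectionArc.
Variable R : realType.
Implicit Types (x y z u n c w d : V3 R) (a b th : R) (ns ms : seq (V3 R)).
Implicit Types (nss : seq (seq (V3 R))) (D : seq (V3 R)).

(** The circle of u in polar angle from a point c interior to the cell, with w the tangent
    direction: the section is the arc of angles from - th2 to th1, and only its two ends are on the
    boundary of the cell. *)
Record secdata ns u c w th1 th2 : Prop := SecData {
  sd_onp : onp c w;
  sd_uc : dot u c = 0;
  sd_uw : dot u w = 0;
  sd_th1 : 0 < th1 < pi;
  sd_th2 : 0 < th2 < pi;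
  sd_th12 : th1 + th2 <= pi;
  sd_n1 : exists2 n, n \in ns & dot n (pt c w th1) = 0;
  sd_n2 : exists2 n, n \in ns & dot n (pt c w (- th2)) = 0;
  sd_pt : forall x, sphere x -> dot u x = 0 -> exists2 th, - pi <= th <= pi & x = pt c w th;
  sd_cone : forall th, - pi <= th <= pi -> cone ns (pt c w th) = (- th2 <= th <= th1);
  sd_icone : forall th, - th2 < th < th1 -> icone ns (pt c w th) }.

Lemma sphere_pt u c x : dot u u = 1 -> dot c c = 1 -> dot u c = 0 -> sphere x -> dot u x = 0 ->
  exists2 th, - pi <= th <= pi & x = pt c (cross u c) th.
Proof.
move=> uu cc uc xx ux; have [|th [thI h1 h2]] := @unit_angle R (dot c x) (dot (cross u c) x).
  rewrite -[RHS]xx {3}(onf_expand uu cc uc ux) dot_lin2l; ring.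
by exists th => //; rewrite /pt -h1 -h2; exact: onf_expand.
Qed.

Lemma secdata_ex nss D ns u : good nss D -> generic D u -> ns \in nss -> hitc ns u ->
  exists c w th1 th2, secdata ns u c w th1 th2.
Proof.
move=> g gu nsin hit; have [c [ic uc cc]] := section_interior g gu nsin hit.
have [uu _ _] := gu; exists c, (cross u c).
have [th1 [th2 [n1 [n2 [[h1 h2 h12] [n1i n10] [n2i n20] hc hi]]]]] :=
  section_arc (cross u c) ic (g_ne g nsin).
have [_ _ ww [_ uw cw]] := onf_cross uu cc uc.
exists th1, th2; split=> //.
- by exists n1.
- by exists n2.
- by move=> x; exact: sphere_pt.
Qed.

Section Ends.
Variables (ns : seq (V3 R)) (u c w : V3 R) (th1 th2 : R).
Hypothesis sd : secdata ns u c w th1 th2.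

Lemma th_bounds : [/\ 0 < th1, th1 < pi, 0 < th2, th2 < pi & th1 + th2 <= pi].
Proof. by have /andP[? ?] := sd_th1 sd; have /andP[? ?] := sd_th2 sd; split=> //; exact: sd_th12 sd. Qed.

Lemma dot_u_pt th : dot u (pt c w th) = 0.
Proof. by rewrite dot_pt (sd_uc sd) (sd_uw sd); ring. Qed.

Lemma ends_neq : pt c w th1 <> pt c w (- th2).
Proof.
have [cc ww cw] := sd_onp sd; move=> /(congr1 (dot w)).
rewrite !dot_pt ww (dotC w) cw sinN !mulr0 !add0r !mulr1 => e.
by have := sin_gt0_pi (sd_th1 sd); have := sin_gt0_pi (sd_th2 sd); lra.
Qed.

Lemma sphere_pt1 th : sphere (pt c w th).
Proof. by rewrite /sphere /=; apply: onp_pt (sd_onp sd). Qed.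

Lemma end_cone : cone ns (pt c w th1) /\ cone ns (pt c w (- th2)).
Proof.
have [h1 h2 h3 h4 h5] := th_bounds.
by split; rewrite (sd_cone sd); lra.
Qed.

Lemma endsP x :
  [/\ sphere x, dot u x = 0, cone ns x & exists2 n, n \in ns & dot n x = 0] <->
  x = pt c w th1 \/ x = pt c w (- th2).
Proof.
have [c1 c2] := end_cone.
split; last first.
  by case=> ->; split; rewrite ?dot_u_pt //; do ?[exact: sphere_pt1|exact: (sd_n1 sd)|exact: (sd_n2 sd)].
move=> [sx ux + [n nns nx]]; have [th thI e] := sd_pt sd sx ux.
rewrite e (sd_cone sd) // => /andP[le1 le2].
have [->|N1] := eqVneq th th1; first by left.
have [->|N2] := eqVneq th (- th2); first by right.
have : icone ns (pt c w th).
  by apply: (sd_icone sd); rewrite !lt_neqAle eq_sym N2 N1 le1 le2.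
by move=> /iconeP /(_ _ nns); rewrite -e nx ltxx.
Qed.

End Ends.
End SectionArc.

(** * Sides *)

Section Sides.
Variable R : realType.
Implicit Types (x y z u n c w d : V3 R) (a b th : R) (ns ms : seq (V3 R)).
Implicit Types (nss : seq (seq (V3 R))) (D : seq (V3 R)).

(* The normal n of the cell ns is not redundant: it carries a side. *)
Definition facet ns n := exists x, [/\ x <> zerov R, dot n x = 0 &
  forall m, m \in ns -> m != n -> 0 < dot m x].

Definition nfacets ns := count (fun n => `[< facet ns n >]) ns.

(** A generic circle avoids the corners of the cell: two different normals vanishing at a point of
    it would contradict the nonzero determinant. *)
Lemma gp_unique_zero D ns c u n m x : genpos D -> generic D u -> {subset ns <= D} -> icone ns c ->
  n \in ns -> m \in ns -> x <> zerov R -> dot u x = 0 -> dot n x = 0 -> dot m x = 0 -> m = n.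
Proof.
move=> gD [_ _ ud] sD ic nns mns x0 ux nx mx; apply/eqP/negPn/negP => mn.
apply/x0/(@det_orth0 _ u n m) => //; apply: ud; rewrite ?sD //.
by rewrite apar_sym; exact: icone_apar ic _ _ mn.
Qed.

Lemma others_pos D ns c u n m x : genpos D -> generic D u -> {subset ns <= D} -> icone ns c ->
  n \in ns -> m \in ns -> x <> zerov R -> dot u x = 0 -> dot n x = 0 -> cone ns x ->
  m != n -> 0 < dot m x.
Proof.
move=> gD gu sD ic nns mns x0 ux nx /coneP cx mn; rewrite lt_neqAle cx // andbT eq_sym.
by apply: contra mn => /eqP mx; apply/eqP/(gp_unique_zero gD gu sD ic nns mns x0).
Qed.

Lemma facet_seq_pos ns n x y : uniq ns -> (forall m, m \in ns -> m != n -> 0 < dot m x) ->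
  exists2 e, 0 < e & forall t, `|t| <= e -> forall m, m \in ns -> m != n -> 0 < dot m (lin2 1 t x y).
Proof.
move=> un h; have [|e e0 he] := @icone_perturb R (rem n ns) x y.
  by apply/iconeP => m; rewrite mem_rem_uniq // !inE => /andP[mn mns]; exact: h.
exists e => // t /he /iconeP ht m mns mn; apply: ht.
by rewrite mem_rem_uniq // !inE mn mns.
Qed.

Lemma side_infinite ns n : uniq ns -> dot n n = 1 -> facet ns n -> infinite_set (spoly ns `&` gc n).
Proof.
move=> un nn [x0 [x0N nx0 hx0]]; pose x := normv x0.
have xx : dot x x = 1 by exact: normv1.
have nx : dot n x = 0 by apply/eqP; rewrite dot_normv_eq0 // nx0.
have hx m : m \in ns -> m != n -> 0 < dot m x by move=> h1 h2; rewrite dot_normv_gt0 // hx0.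
pose y := cross n x; have [_ _ yy [_ ny xy]] := onf_cross nn xx nx.
have [e e0 he] := facet_seq_pos y un hx.
(* The quotient is the slope in the tangent frame x, y; it is unchanged by normalization, so it
   recovers t. *)
apply: (@infinite_of_interval _ _ _ (fun z => dot y z / dot x z) e e0) => t /andP[t0 te].
pose z := lin2 1 t x y.
have xz : dot x z = 1 by rewrite dot_lin2r xx xy; ring.
have yz : dot y z = t by rewrite dot_lin2r yy (dotC y) xy; ring.
have z0 : z <> zerov R by move=> z0; move: xz; rewrite z0 dot0r => /esym/eqP; rewrite oner_eq0.
have nz : dot n z = 0 by rewrite dot_lin2r nx ny; ring.
exists (normv z); last first.
  rewrite !dot_normv xz yz mulr1 mulrC mulKf // gt_eqF //; exact: sqrt_dot_gt0.
split; last by split; [exact: normv1|apply/eqP; rewrite dotC dot_normv_eq0 // nz].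
split; first exact: normv1.
rewrite cone_normv //; apply/coneP => m mns; have [->|mn] := eqVneq m n; first by rewrite nz.
by apply: ltW; apply: he => //; rewrite ger0_norm.
Qed.

(** The square of the length of x - y is 2 - 2 [dot x y]. *)
Lemma unit_dot1 x y : dot x x = 1 -> dot y y = 1 -> dot x y = 1 -> y = x.
Proof.
move=> xx yy e; have : lin2 1 (-1) x y = zerov R.
  apply/eqP; rewrite -dotxx_eq0; apply/eqP; rewrite dot_lin2r !dot_lin2l xx yy (dotC y) e; ring.
by clear; case: x y => [[? ?] ?] [[? ?] ?]; rewrite /lin2 /= => -[*]; congr (_, _, _); lra.
Qed.

Lemma unit_cross0 x y : dot x x = 1 -> dot y y = 1 -> cross x y = zerov R -> y = x \/ y = negv x.
Proof.
move=> xx yy xy0; have := dot_crossxx x y; rewrite xy0 dot0r xx yy => /esym/eqP.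
rewrite mulr1 subr_eq0 eq_sym sqrf_eq1 => /orP[] /eqP e; [left|right]; apply: unit_dot1 => //.
  by rewrite dot_negl dot_negr opprK.
by rewrite dot_negl e opprK.
Qed.

(** The only unit vectors dependent on x are x and its opposite, which are finitely many. *)
Lemma infinite_two (S : set (V3 R)) : infinite_set S -> S `<=` @sphere R ->
  exists x y, [/\ S x, S y & cross x y <> zerov R].
Proof.
move=> iS sS; have [x Sx] := infinite_setN0 iS.
apply: contrapT => h; apply: iS.
apply: (@sub_finite_set _ _ [set x; negv x]); last exact: finite_set2.
move=> y Sy; apply: contrapT => hn; apply: h.
exists x, y; split=> // /(unit_cross0 (sS _ Sx) (sS _ Sy)); exact: hn.
Qed.

(** If n and v were independent, x and y would both be multiples of their cross product, hence
    dependent. *)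
Lemma cross_orth n v x y : cross x y <> zerov R -> dot n n = 1 -> dot v v = 1 ->
  dot n x = 0 -> dot n y = 0 -> dot v x = 0 -> dot v y = 0 -> v = n \/ v = negv n.
Proof.
move=> xy nn vv nx ny vx vy; apply: unit_cross0 => //.
apply: contrapT => k0; pose k := cross n v; have kk := dotxx_gt0 k0.
have par m z : dot n z = 0 -> dot v z = 0 -> dot k k * dot m z = dot k z * dot m k.
  move=> nz vz; have := cramer n v k z m; rewrite nz vz !mul0r !add0r => <-.
  by congr (_ * _); rewrite detC1 detC1.
apply: xy; apply: V3P => m; rewrite dot0r; apply/eqP.
have e1 : dot m (cross x y) = dot (cross y m) x by rewrite /dot /cross /=; ring.
have e2 : dot (cross y m) k = dot (cross m k) y by rewrite /dot /cross /=; ring.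
rewrite -(mulrI_eq0 _ (mulfI (lt0r_neq0 kk))) e1 par // e2.
rewrite -(mulrI_eq0 _ (mulfI (lt0r_neq0 kk))) mulrCA par // (dotC _ k) dot_crossr; apply/eqP; ring.
Qed.

(** A supporting circle with infinite contact contains two independent points of the cell. Their sum
    z is not interior, since a small move against v would leave the hemisphere; so a normal n
    vanishes at z, hence at both points, and v = n because the cell has interior. *)
Lemma is_side_facet nss D ns s : good nss D -> ns \in nss -> 
  is_side (spoly ns) s <-> exists n, [/\ n \in ns, facet ns n & s = spoly ns `&` gc n].
Proof.
move=> g nsin; have [Du Dc Dd] := g_gp g; have sD := g_sub g nsin.
have un := g_un g nsin; have [c ic] := g_int g nsin.
split; last first.
  case=> n [nns fn ->]; exists n; have nn := Du _ (sD _ nns); split=> //.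
    by move=> x [sx cx]; split=> //; rewrite dotC; exact: (coneP _ _ cx).
  exact: side_infinite.
case=> v [vv sub -> inf].
have subv x : cone ns x -> 0 <= dot v x.
  have [->|/eqP x0] := eqVneq x (zerov R); first by rewrite dot0r.
  move=> cx; have : spoly ns (normv x) by split; [exact: normv1|rewrite cone_normv].
  by move=> /sub[_]; rewrite dotC dot_normv pmulr_rge0 // sqrt_dot_gt0.
have [x [y [[[sx cx] [_ xv]] [[sy cy] [_ yv]] xy]]] := infinite_two inf (fun z h => h.1.1).
rewrite dotC in xv; rewrite dotC in yv.
pose z := lin2 1 1 x y.
have cz : cone ns z by apply: cone_lin2.
have vz : dot v z = 0 by rewrite dot_lin2r xv yv; ring.
have zero m : m \in ns -> dot m z = 0 -> dot m x = 0 /\ dot m y = 0.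
  move=> mns; rewrite dot_lin2r !mul1r; move/coneP: cx => /(_ _ mns); move/coneP: cy => /(_ _ mns).
  by move=> *; split; lra.
have z0 : z <> zerov R.
  move=> z0; apply: xy; have <- : cross x z = cross x y.
    by rewrite /cross /z /lin2 /=; congr (_, _, _); ring.
  by rewrite z0 /cross /zerov /= !mulr0 !subr0.
have [n nns nz] : exists2 n, n \in ns & dot n z = 0.
  have [/iconeP iz|/allPn[n nns]] := boolP (icone ns z); last first.
    rewrite -leNgt => nz; exists n => //; apply/eqP; rewrite eq_le nz /=.
    exact: (coneP _ _ cz).
  have [e e0 he] := icone_perturb (negv v) (introT (iconeP _ _) iz).
  have := he e; rewrite ger0_norm ?lexx ?ltW // => /(_ isT)/icone_cone/subv.
  by rewrite dot_lin2r vz dot_negr vv => ?; lra.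
have [nx ny] := zero _ nns nz; have nn := Du _ (sD _ nns).
have en : v = n.
  have [//|e] := cross_orth xy nn vv nx ny xv yv.
  have := subv c (icone_cone ic); rewrite e dot_negl oppr_ge0 leNgt.
  by move/iconeP: ic => /(_ _ nns) ->.
exists n; rewrite en; split=> //; exists z; split=> // m mns mn.
rewrite lt_neqAle (coneP _ _ cz) // andbT eq_sym; apply/eqP => /(zero _ mns)[mx my].
have /andP[] := icone_apar ic mns nns mn; have [->|->] := cross_orth xy nn (Du _ (sD _ mns)) nx ny mx my.
  by rewrite eqxx.
by rewrite eqxx.
Qed.

Lemma facet_inj nss D ns n m : good nss D -> ns \in nss -> n \in ns -> m \in ns ->
  facet ns n -> spoly ns `&` gc n = spoly ns `&` gc m -> n = m.
Proof.
move=> g nsin nns mns [x [x0 nx hx]] e; apply/eqP; rewrite eq_sym; apply/negPn/negP => mn.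
have : (spoly ns `&` gc n) (normv x).
  have xx := normv1 x0; split; last by split=> //; apply/eqP; rewrite dotC dot_normv_eq0 // nx.
  split=> //; rewrite cone_normv //; apply/coneP => k kns.
  by have [->|kn] := eqVneq k n; [rewrite nx|exact/ltW/hx].
rewrite e => -[_ [_ /eqP]]; rewrite dotC dot_normv_eq0 // gt_eqF //; exact: hx.
Qed.

Lemma count_sides nss D ns : good nss D -> ns \in nss ->
  count_set (is_side (spoly ns)) = nfacets ns.
Proof.
move=> g nsin; pose fs := [seq n <- ns | `[< facet ns n >]].
rewrite (@count_setE _ _ (map (fun n => spoly ns `&` gc n) fs)).
- by rewrite size_map size_filter.
- rewrite map_inj_in_uniq ?filter_uniq ?(g_un g) //.
  move=> n m; rewrite !mem_filter => /andP[/asboolP fn nns] /andP[_ mns].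
  exact: (facet_inj g nsin nns mns fn).
- move=> s; rewrite (is_side_facet s g nsin); split.
    by case=> n [nns fn ->]; apply: map_f; rewrite mem_filter nns andbT; apply/asboolP.
  by case/mapP => n; rewrite mem_filter => /andP[/asboolP fn nns] ->; exists n.
Qed.

Lemma nSE nss D segs : good nss D -> nS (mktess nss segs) = (\sum_(ns <- nss) nfacets ns)%N.
Proof.
move=> g; have us : uniq (map (@spoly R) nss).
  by rewrite map_inj_in_uniq ?(g_uniq g) //; exact: spoly_inj g.
have e : [set` [fset p in map (@spoly R) nss]%fset] = cellset (mktess nss segs).
  apply/seteqP; split=> p /=; rewrite inE /= => h.
    by apply/cellsetP; case/mapP: h => ns nsin ->; exists ns.
  by have /cellsetP[ns nsin ->] := h; exact: map_f.
rewrite /nS -e set_fsetK.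
rewrite (perm_big (map (@spoly R) nss)) /=; last first.
  by apply: uniq_perm => // [|p]; [exact: fset_uniq|rewrite inE].
rewrite big_map big_seq [RHS]big_seq; apply: eq_bigr => ns nsin.
exact: count_sides g nsin.
Qed.

End Sides.

(** * Effect of a split on the number of sides *)

Section FacetSplit.
Variable R : realType.
Implicit Types (x y z u n c w d : V3 R) (a b th : R) (ns ms : seq (V3 R)).
Implicit Types (nss : seq (seq (V3 R))) (D : seq (V3 R)).

(** The circle of u meets the side carried by n in its relative interior. *)
Definition crossed ns u n := exists x, [/\ x <> zerov R, dot n x = 0, dot u x = 0 &
  forall m, m \in ns -> m != n -> 0 < dot m x].

Lemma nonzero_pos n x : 0 < dot n x -> x <> zerov R.
Proof. by move=> + x0; rewrite x0 dot0r ltxx. Qed.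

Lemma crossed_neg ns u n : crossed ns (negv u) n <-> crossed ns u n.
Proof.
by split=> -[x [x0 nx ux hx]]; exists x; split=> //; move: ux; rewrite ?dot_negl => h; lra.
Qed.

(** From the crossing point one moves along the circle of n towards u, that is, along the projection
    of u to the plane of n. *)
Lemma crossed_facet D ns u n : genpos D -> generic D u -> {subset ns <= D} -> uniq ns -> n \in ns ->
  crossed ns u n -> facet (u :: ns) n.
Proof.
move=> [Du _ _] [uu uc _] sD un nns [x [x0 nx ux hx]].
pose y := lin2 1 (- dot n u) u n; have nn := Du _ (sD _ nns).
have ny : dot n y = 0 by rewrite dot_lin2r nn; ring.
have uy : 0 < dot u y.
  rewrite dot_lin2r uu (dotC n).
  by have := dotxx_gt0 (uc _ (sD _ nns)); rewrite dot_crossxx uu nn; lra.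
have [e e0 he] := facet_seq_pos y un hx.
pose z := lin2 1 e x y; have uz : 0 < dot u z by rewrite dot_lin2r ux mulr0 add0r mulr_gt0.
exists z; split; [exact: nonzero_pos uz|by rewrite dot_lin2r nx ny; ring|].
move=> m; rewrite inE => /orP[/eqP->//|mns mn]; apply: he => //.
by rewrite ger0_norm // ltW.
Qed.

Lemma facet_sub u ns n : facet (u :: ns) n -> facet ns n.
Proof.
by move=> [x [x0 nx hx]]; exists x; split=> // m mns; apply: hx; rewrite inE mns orbT.
Qed.

Lemma facet_or D ns u n : genpos D -> generic D u -> {subset ns <= D} -> uniq ns -> n \in ns ->
  facet ns n -> facet (u :: ns) n \/ facet (negv u :: ns) n.
Proof.
move=> gD gu sD un nns [x [x0 nx hx]]; have [ux|ux|ux] := ltrgtP (dot u x) 0.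
- right; exists x; split=> // m; rewrite inE => /orP[/eqP->|]; last exact: hx.
  by rewrite dot_negl oppr_gt0.
- by left; exists x; split=> // m; rewrite inE => /orP[/eqP->|]; last exact: hx.
- by left; apply: crossed_facet gD gu sD un nns _; exists x.
Qed.

(** The positive combination of the two witnesses that is annihilated by u crosses the side. For a
    hemisphere there is no other normal to keep this combination away from zero, and [cross u n] is
    used instead. *)
Lemma facet_and D ns u n : genpos D -> generic D u -> {subset ns <= D} -> n \in ns ->
  facet (u :: ns) n -> facet (negv u :: ns) n -> crossed ns u n.
Proof.
move=> gD gu sD nns [x [x0 nx hx]] [y [y0 ny hy]].
have uD : u \notin D by apply/negP => /(generic_apar gu); rewrite apar_irr.
have NuD : negv u \notin D by apply/negP => /(generic_apar gu); rewrite apar_negr apar_irr.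
have ux : 0 < dot u x.
  by apply: hx; rewrite ?mem_head //; apply: contra uD => /eqP->; exact: sD.
have uy : 0 < dot (negv u) y.
  by apply: hy; rewrite ?mem_head //; apply: contra NuD => /eqP->; exact: sD.
rewrite dot_negl in uy.
have [/hasP[m mns mn]|/hasPn hn] := boolP (has (fun m => m != n) ns); last first.
  exists (cross u n); have [_ uc _] := gu; split; rewrite ?dot_crossl ?dot_crossr //.
    by apply: uc; exact: sD.
  by move=> m /hn /negPn ->.
pose z := lin2 (- dot u y) (dot u x) x y.
have pos k : k \in ns -> k != n -> 0 < dot k z.
  move=> kns kn; rewrite dot_lin2r addr_gt0 // mulr_gt0 //.
    by apply: hx; rewrite // inE kns orbT.
  by apply: hy; rewrite // inE kns orbT.
exists z; split=> //; first exact: nonzero_pos (pos _ mns mn).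
  by rewrite dot_lin2r nx ny; ring.
by rewrite dot_lin2r; ring.
Qed.

(** The crossed sides carry the two ends of the section. If both ends are on the same normal they
    are antipodal, so no other normal can be positive at both, and the cell is a hemisphere. *)
Lemma count_crossed nss D ns u : good nss D -> generic D u -> ns \in nss -> hitc ns u ->
  count (fun n => `[< crossed ns u n >]) ns = if size ns == 1%N then 1%N else 2%N.
Proof.
move=> g gu nsin hit; have [c [w [th1 [th2 sd]]]] := secdata_ex g gu nsin hit.
have sD := g_sub g nsin; have gD := g_gp g; have [c0 ic] := g_int g nsin.
have un := g_un g nsin.
have [n1 n1in n1a] := sd_n1 sd; have [n2 n2in n2b] := sd_n2 sd.
set a := pt c w th1 in n1a; set b := pt c w (- th2) in n2b.
have ua : dot u a = 0 := dot_u_pt sd _; have ub : dot u b = 0 := dot_u_pt sd _.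
have a1 : dot a a = 1 := sphere_pt1 sd _; have b1 : dot b b = 1 := sphere_pt1 sd _.
have [ca cb] := end_cone sd.
have a0 := unit_neq0 a1; have b0 := unit_neq0 b1.
have apos m : m \in ns -> m != n1 -> 0 < dot m a.
  by move=> mns; exact: (others_pos gD gu sD ic n1in mns a0 ua n1a ca).
have bpos m : m \in ns -> m != n2 -> 0 < dot m b.
  by move=> mns; exact: (others_pos gD gu sD ic n2in mns b0 ub n2b cb).
have E : {in ns, (fun n => `[< crossed ns u n >]) =1 [pred n | (n == n1) || (n == n2)]}.
  move=> n nns /=; apply/asboolP/orP; last first.
    by case=> /eqP->; [exists a|exists b].
  case=> x [x0 nx ux hx]; have cx : cone ns x.
    by apply/coneP => m mns; have [->|mn] := eqVneq m n; [rewrite nx|exact/ltW/hx].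
  have /(endsP sd) : [/\ sphere (normv x), dot u (normv x) = 0, cone ns (normv x) & exists2 n, n \in ns & dot n (normv x) = 0].
    split; [exact: normv1| |by rewrite cone_normv|exists n => //]; apply/eqP; rewrite dot_normv_eq0 ?ux ?nx //.
  have nx' : dot n (normv x) = 0 by apply/eqP; rewrite dot_normv_eq0 // nx.
  move=> [] e; rewrite e -/a -/b in nx'.
    by left; apply/eqP; exact: (gp_unique_zero gD gu sD ic n1in nns a0 ua).
  by right; apply/eqP; exact: (gp_unique_zero gD gu sD ic n2in nns b0 ub).
rewrite (eq_in_count E).
have [e|n12] := eqVneq n1 n2.
  rewrite ifT; last first.
    apply: contrapT => sz; have [m mns mn1] : exists2 m, m \in ns & m != n1.
      apply: contrapT => h; apply: sz.
      have : {subset ns <= [:: n1]}.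
        move=> m mns; rewrite inE; apply/negPn/negP => mn; apply: h; by exists m.
      move=> /(uniq_leq_size un) /=; move: (g_ne g nsin); by case: (ns) => // ? [].
    have ab0 : cross a b = zerov R.
      apply: contrapT => ab; have nn := let: And3 Du _ _ := gD in Du _ (sD _ n1in).
      have uu := let: And3 Du _ _ := gu in Du.
      have n1b : dot n1 b = 0 by rewrite e.
      have [e'|e'] := cross_orth ab uu nn ua ub n1a n1b.
        by have := generic_apar gu (sD _ n1in); rewrite e' apar_irr.
      by have := generic_apar gu (sD _ n1in); rewrite e' apar_negr apar_irr.
    have mn2 : m != n2 by rewrite -e.
    have [e'|e'] := unit_cross0 a1 b1 ab0; first by apply: (ends_neq sd).
    have := apos _ mns mn1; have := bpos _ mns mn2; rewrite e' dot_negr => *; lra.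
  rewrite -e (eq_count (a2 := pred1 n1)); last by move=> n /=; rewrite orbb.
  by rewrite count_uniq_mem // n1in.
rewrite ifF; last first.
  apply/negbTE; move: n1in n2in n12; case: (ns) => // m [|//].
  by rewrite !inE => /eqP -> /eqP->; rewrite eqxx.
have := count_predUI (pred1 n1) (pred1 n2) ns.
rewrite !count_uniq_mem // n1in n2in (eq_count (a1 := predI _ _) (a2 := pred0)).
  by rewrite count_pred0 addn0.
move=> n /=; apply/negbTE/negP => /andP[/eqP-> /eqP]; exact/eqP.
Qed.

(** Each old side survives in one half, a crossed side in both, and the cut adds one side to each
    half. So the gain is 2 plus the number of crossed sides. *)
Lemma nfacets_split nss D ns u : good nss D -> generic D u -> ns \in nss -> hitc ns u ->
  (nfacets (u :: ns) + nfacets (negv u :: ns) = nfacets ns + if size ns == 1 then 3 else 4)%N.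
Proof.
move=> g gu nsin hit; have sD := g_sub g nsin; have gD := g_gp g; have un := g_un g nsin.
have [c [ic uc cc]] := section_interior g gu nsin hit.
have gNu := generic_neg gu.
have f1 : facet (u :: ns) u.
  exists c; split=> //; first exact: unit_neq0.
  by move=> m; rewrite inE => /orP[/eqP->|mns _]; rewrite ?eqxx // (iconeP _ _ ic).
have f2 : facet (negv u :: ns) (negv u).
  exists c; split=> //; [exact: unit_neq0|by rewrite dot_negl uc oppr0|].
  by move=> m; rewrite inE => /orP[/eqP->|mns _]; rewrite ?eqxx // (iconeP _ _ ic).
have key : (count (fun n => `[< facet (u :: ns) n >]) ns + count (fun n => `[< facet (negv u :: ns) n >]) ns
   = nfacets ns + count (fun n => `[< crossed ns u n >]) ns)%N.
  rewrite /nfacets -!sum1_count.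
  rewrite !(big_mkcond (fun _ => `[< _ >])) /= -!big_split big_seq [RHS]big_seq /=.
  apply: eq_bigr => n nns.
  have i1 := @facet_and D ns u n gD gu sD nns; have i2 := @facet_sub u ns n.
  have i3 := @facet_sub (negv u) ns n; have i4 := crossed_facet gD gu sD un nns.
  have i5 : crossed ns u n -> facet (negv u :: ns) n.
    by move=> /crossed_neg; exact: crossed_facet gD gNu sD un nns.
  have i6 := facet_or gD gu sD un nns.
  case: (asboolP (facet (u :: ns) n)) => h1; case: (asboolP (facet (negv u :: ns) n)) => h2;
    case: (asboolP (facet ns n)) => h3; case: (asboolP (crossed ns u n)) => h4 //; exfalso; tauto.
rewrite /nfacets /= -/(nfacets ns).
rewrite (introT (asboolP _) f1) (introT (asboolP _) f2) /= addnACA key.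
by rewrite (count_crossed g gu nsin hit); case: ifP => _; rewrite addnC -addnA.
Qed.

End FacetSplit.

(** * Edges *)

Section Boundary.
Variable R : realType.
Implicit Types (x y z u n c w d : V3 R) (a b th : R) (ns ms : seq (V3 R)).

Lemma continuous_dot n : continuous (dot n : V3 R -> R).
Proof.
move=> x; rewrite /dot; apply: cvgD; first apply: cvgD.
- apply: cvgM; first exact: cvg_cst.
  apply: (@cvg_comp _ _ _ (fst : V3 R -> _) fst _ (nbhs x.1)); exact: cvg_fst.
- apply: cvgM; first exact: cvg_cst.
  by apply: (@cvg_comp _ _ _ (fst : V3 R -> _) snd _ (nbhs x.1)); [exact: cvg_fst|exact: cvg_snd].
- apply: cvgM; first exact: cvg_cst.
  exact: cvg_snd.
Qed.

Lemma continuous_pt c w : continuous (pt c w).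
Proof.
case: c w => [[c1 c2] c3] [[w1 w2] w3] t; rewrite /pt /lin2 /=.
have aux (p q : R) : {for t, continuous (fun x : R => cos x * p + sin x * q)}.
  apply: cvgD; (apply: cvgM; last exact: cvg_cst).
    exact: continuous_cos.
  exact: continuous_sin.
have pair (T U : topologicalType) (f : R -> T) (h : R -> U) :
    {for t, continuous f} -> {for t, continuous h} -> {for t, continuous (fun r => (f r, h r))}.
  by move=> cf ch; exact: cvg_pair.
apply: (pair _ _ (fun r : R => (cos r * c1 + sin r * w1, cos r * c2 + sin r * w2))
  (fun r : R => cos r * c3 + sin r * w3)); last exact: aux.
by apply: (pair _ _ (fun r : R => cos r * c1 + sin r * w1) (fun r : R => cos r * c2 + sin r * w2)); exact: aux.
Qed.

Definition bd ns x := cone ns x /\ exists2 n, n \in ns & dot n x = 0.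

Lemma icone_nbhs ns x : icone ns x -> nbhs x [set y | icone ns y].
Proof.
elim: ns => [_|n ns ih /= /andP[nx /ih ix]]; first by apply: (@filterS _ (nbhs x) _ setT) => //; exact: filterT.
have h : nbhs x [set y | 0 < dot n y].
  exact: (cvgr_gt _ (@continuous_dot n x) _ nx).
by apply: filterS (filterI h ix) => y [/= -> ->].
Qed.

(** Replaces the topological boundary by the vanishing of a normal. A point where n vanishes is a
    limit of points of its circle through x and [negv n], which are outside the cell. *)
Lemma bdryP ns x : (forall n, n \in ns -> dot n n = 1) -> sphere x ->
  bdry (spoly ns) x <-> bd ns x.
Proof.
move=> un sx; split.
  move=> [[_ cx] cl]; split=> //; apply: contrapT => h.
  have ix : icone ns x.
    apply/iconeP => n nns; rewrite lt_neqAle (coneP _ _ cx) // andbT eq_sym.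
    by apply/eqP => nx; apply: h; exists n.
  have [y [[sy ny] iy]] := cl _ (icone_nbhs ix).
  by apply: ny; split=> //; exact: icone_cone.
move=> [cx [n nns nx]]; split=> // B Bx.
have nn := un _ nns.
have xn : onp x (negv n).
  by split=> //; rewrite ?dot_negl ?dot_negr ?opprK // dotC nx oppr0.
have : nbhs 0 (pt x (negv n) @^-1` B).
  by apply: continuous_pt; rewrite pt0.
move=> /nbhs_ballP[e /= e0 he].
(* Small enough for the ball, and below pi so that [sin t] is positive. *)
pose t := Num.min (e / 2) 1.
have t0 : 0 < t by rewrite lt_min divr_gt0 //=.
have te : t < e by rewrite gt_min; apply/orP; left; lra.
have t1 : t <= 1 by rewrite ge_min lexx orbT.
exists (pt x (negv n) t); split; last by apply: he; rewrite /ball /= sub0r normrN gtr0_norm.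
split; first exact: onp_pt.
move=> [_ /coneP /(_ _ nns)]; rewrite dot_pt nx dot_negr nn mulr0 add0r mulrN1 oppr_ge0 leNgt.
by rewrite sin_gt0_pi // t0 /=; apply: (le_lt_trans t1); have := @pi_ge2 R; lra.
Qed.

End Boundary.

Section Edges.
Variable R : realType.
Implicit Types (x y z u n c w d : V3 R) (a b th p q : R) (ns ms : seq (V3 R)).
Implicit Types (nss : seq (seq (V3 R))) (D : seq (V3 R)) (e : set (V3 R)).

Definition carc y w p q : set (V3 R) := [set pt y w t | t in [set t | - p <= t <= q]].

(* The arc e seen from one of its points y: it runs from the vertex at angle -p to the vertex at angle q. *)
Record edgec nss e y w p q : Prop := EdgeC {
  ec_onp : onp y w;
  ec_p : 0 <= p;
  ec_q : 0 <= q;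
  ec_pq : 0 < p + q <= pi;
  ec_e : e = carc y w p q;
  ec_bd : exists2 ns, ns \in nss & forall t, - p <= t <= q -> bd ns (pt y w t);
  ec_vp : vtx nss (pt y w (- p));
  ec_vq : vtx nss (pt y w q);
  ec_nv : forall t, - p < t < q -> ~ vtx nss (pt y w t) }.

(** Two edges with a common point can thus be compared from the same base point. *)
Lemma edgec_recenter nss e y w p q s : edgec nss e y w p q -> - p <= s <= q ->
  edgec nss e (pt y w s) (pt y w (s + pi / 2)) (p + s) (q - s).
Proof.
move=> [yw p0 q0 pq -> [ns nsin hb] vp vq nv] /andP[s1 s2]; split.
- exact: onp_rot.
- by lra.
- by lra.
- by lra.
- apply/seteqP; split=> _ [t /= tI <-]; [exists (t - s)|exists (s + t)]; rewrite /= ?pt_rot ?(addrC s) ?subrK //; lra.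
- by exists ns => // t tI; rewrite pt_rot; apply: hb; lra.
- by rewrite pt_rot opprD addrCA subrr addr0.
- by rewrite pt_rot addrC subrK.
- by move=> t tI; rewrite pt_rot; apply: nv; lra.
Qed.

Lemma edgec_flip nss e y w p q : edgec nss e y w p q -> edgec nss e y (negv w) q p.
Proof.
move=> [[yy ww yw] p0 q0 pq -> [ns nsin hb] vp vq nv].
have e1 t : pt y (negv w) t = pt y w (- t) by rewrite ptN.
split=> //; rewrite ?e1 ?opprK //.
- by split; rewrite ?dot_negl ?dot_negr ?opprK // yw oppr0.
- by rewrite addrC.
- by apply/seteqP; split=> _ [t /= tI <-]; exists (- t); rewrite /= ?e1 ?opprK //; lra.
- by exists ns => // t tI; rewrite e1; apply: hb; lra.
- by move=> t tI; rewrite e1; apply: nv; lra.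
Qed.

(** From an inner point, the shorter of two different arcs would end at a vertex strictly inside the
    longer one. *)
Lemma edgec_uniq nss e e' y w p q p' q' : edgec nss e y w p q -> edgec nss e' y w p' q' ->
  0 < p -> 0 < q -> 0 < p' -> 0 < q' -> e = e'.
Proof.
move=> E E' p0 q0 p0' q0'.
have ep : p = p'.
  have [h|h|//] := ltrgtP p p'.
    by case: (ec_nv E' _ (ec_vp E)); lra.
  by case: (ec_nv E _ (ec_vp E')); lra.
have eq : q = q'.
  have [h|h|//] := ltrgtP q q'.
    by case: (ec_nv E' _ (ec_vq E)); lra.
  by case: (ec_nv E _ (ec_vq E')); lra.
by rewrite (ec_e E) (ec_e E') ep eq.
Qed.

Lemma edgec_uniq2 nss e e' d y w w' p q p' q' : dot d d = 1 -> edgec nss e y w p q ->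
  edgec nss e' y w' p' q' -> dot d y = 0 -> dot d w = 0 -> dot d w' = 0 ->
  0 < p -> 0 < q -> 0 < p' -> 0 < q' -> e = e'.
Proof.
move=> dd E E' dy dw dw' p0 q0 p0' q0'.
have [yy ww yw] := ec_onp E; have [_ ww' yw'] := ec_onp E'.
have dy0 : cross d y <> zerov R.
  by move=> h; have := dot_crossxx d y; rewrite h dot0r dd yy dy => ?; lra.
have [ew|ew] : w' = w \/ w' = negv w.
  by apply: (cross_orth dy0); rewrite // dotC.
- by move: E'; rewrite ew => E'; exact: edgec_uniq E E' p0 q0 p0' q0'.
- by move: (edgec_flip E'); rewrite ew negvK => {}E'; exact: edgec_uniq E E' p0 q0 q0' p0'.
Qed.

(** As the arc has length at most pi, [acos] of the product with its first end recovers the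
    angle. *)
Lemma carc_infinite y w p q : onp y w -> 0 <= p -> 0 <= q -> 0 < p + q <= pi -> infinite_set (carc y w p q).
Proof.
move=> yw p0 q0 /andP[pq0 pq].
apply: (@infinite_of_interval _ _ _ (fun x => acos (dot (pt y w (- p)) x)) (p + q)) => // t tI.
exists (pt y w (- p + t)); first by (exists (- p + t) => //=; lra).
have onpr := onp_rot (- p) yw; case: onpr => o1 _ o2.
rewrite -pt_rot dot_pt o1 o2 mulr0 addr0 mulr1 cosK // in_itv /=; lra.
Qed.

Lemma is_edgeE nss D segs e : good nss D ->
  is_edge (mktess nss segs) e <-> exists y w p q, edgec nss e y w p q.
Proof.
move=> g; have un ns n : ns \in nss -> n \in ns -> dot n n = 1.
  by move=> h /(g_sub g h); have [Du _ _] := g_gp g; exact: Du.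
split.
  case=> y [w [a [yy ww yw /andP[a0 api] [-> [P /cellsetP[ns nsin ->] hb] vy va nv]]]].
  have yw' : onp y w by [].
  exists y, w, 0, a; split=> //.
  - exact: ltW.
  - by rewrite add0r a0.
  - by rewrite /carc oppr0; apply/seteqP; split=> _ [t /= tI <-]; exists t => //; move: tI; rewrite /= in_itv.
  - exists ns => // t tI; apply/(bdryP (un ns ^~ nsin)); first exact: onp_pt.
    by apply: hb; exists t => //; rewrite /= in_itv /= -oppr0.
  - by rewrite oppr0 pt0; apply/(is_vertexE _ _ g); exact: vy.
  - by apply/(is_vertexE _ _ g); exact: va.
  - by move=> t tI /(is_vertexE segs _ g); apply: nv; rewrite oppr0 in tI.
case=> y0 [w0 [p0 [q0 E0]]].
have [y [w [a [[yy ww yw] _ _ + -> [ns nsin hb] vp vq nv]]]] : exists y w a, edgec nss e y w 0 a.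
  have I : - p0 <= - p0 <= q0 by have := ec_p E0; have := ec_q E0; lra.
  by have := edgec_recenter E0 I; rewrite subrr => h; eexists; eexists; eexists; exact: h.
rewrite add0r => aI.
exists y, w, a; split=> //; split.
- by rewrite /carc oppr0; apply/seteqP; split=> _ [t /= tI <-]; exists t => //; move: tI; rewrite /= in_itv.
- exists (spoly ns); first by apply/cellsetP; exists ns.
  move=> _ [t /= tI <-]; apply/(bdryP (un ns ^~ nsin)); first exact: onp_pt.
  by apply: hb; move: tI; rewrite oppr0.
- by apply/(is_vertexE segs _ g); move: vp; rewrite oppr0 pt0.
- by apply/(is_vertexE segs _ g); exact: vq.
- by move=> t tI /(is_vertexE segs _ g); apply: nv; rewrite oppr0.
Qed.

End Edges.

(* lra rejects hypotheses that are equations between vectors or sequences. *)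
Ltac vlra := repeat match goal with
  | H : @eq (seq _) _ _ |- _ => clear H
  | H : @eq (V3 _) _ _ |- _ => clear H
  end; lra.

Lemma uniq3 (T : eqType) (x y z : T) : x <> y -> x <> z -> y <> z -> uniq [:: x; y; z].
Proof.
by move=> /eqP xy /eqP xz /eqP yz; rewrite /= !in_cons in_nil !orbF negb_or xy xz yz.
Qed.

Section EdgeLists.
Variable R : realType.
Implicit Types (x y z u n c w d : V3 R) (a b th p q : R) (ns ms : seq (V3 R)).
Implicit Types (nss : seq (seq (V3 R))) (D : seq (V3 R)) (e : set (V3 R)).
Implicit Types (EL : seq (set (V3 R))).

(** The normal d records which circle of D carries the edge, so that genericity of u with respect to
    D applies to the edge. *)
Definition edgeD nss D e := exists y w p q d,
  [/\ d \in D, dot d y = 0, dot d w = 0 & edgec nss e y w p q].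

Definition skel nss x := sphere x /\ exists m1 m2,
  [/\ m1 \in nss, m2 \in nss, m1 <> m2, cone m1 x & cone m2 x].

Lemma bd_skel nss D ns x : good nss D -> ns \in nss -> sphere x -> bd ns x -> skel nss x.
Proof.
move=> g nsin sx [cx [n nns nx]]; split=> //.
have [ms [min mN cm]] := g_bd g nsin nns cx nx.
by exists ns, ms; split=> //; exact: nesym.
Qed.

Definition covers nss EL := forall x, skel nss x -> exists2 e, e \in EL & e x.

Lemma infinite_pigeon (S : set (V3 R)) EL : infinite_set S ->
  (forall x, S x -> exists2 e, e \in EL & e x) -> exists2 e, e \in EL & infinite_set (S `&` e).
Proof.
elim: EL S => [|e EL ih] S iS cov.
  by have [x /cov[]] := infinite_setN0 iS.
have [fin|inf] := pselect (finite_set (S `&` e)); last by exists e; rewrite ?mem_head.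
have iD : infinite_set (S `\` e) by move=> f; apply: iS; rewrite -(setUIDK S e) finite_setU.
have [|e0 e0in inf] := ih _ iD.
  move=> x [Sx ex]; have [e0] := cov x Sx; rewrite inE => /orP[/eqP->//|h h']; by exists e0.
exists e0; rewrite ?inE ?e0in ?orbT //; apply: sub_infinite_set inf => x [[Sx _] ?]; by split.
Qed.

Lemma edgec_sphere nss e y w p q x : edgec nss e y w p q -> e x -> sphere x.
Proof. by move=> E; rewrite (ec_e E) => -[t _ <-]; exact: onp_pt (ec_onp E). Qed.

Lemma edgec_in_interior nss e y w p q x : edgec nss e y w p q -> e x -> ~ vtx nss x ->
  exists2 s, - p < s < q & x = pt y w s.
Proof.
move=> E; rewrite {1}(ec_e E) => -[s /= /andP[s1 s2] <-] nv; exists s => //.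
rewrite !lt_neqAle s1 s2 !andbT; apply/andP; split; apply/eqP => h; apply: nv.
  by rewrite -h; exact: ec_vp E.
by rewrite h; exact: ec_vq E.
Qed.

Lemma orth_pt d y w t : dot d y = 0 -> dot d w = 0 -> dot d (pt y w t) = 0.
Proof. by move=> dy dw; rewrite dot_pt dy dw; ring. Qed.

(** The listed edges cover the skeleton, so an edge e, being infinite, shares infinitely many points
    with some listed e0. Discarding the four ends leaves two independent common inner points: both
    arcs lie on one circle, and sharing an inner point they coincide. *)
Lemma edges_okP nss D EL segs e : good nss D -> (forall e, e \in EL -> edgeD nss D e) ->
  covers nss EL -> is_edge (mktess nss segs) e <-> e \in EL.
Proof.
move=> g EE cov; rewrite (is_edgeE _ _ g); split; last first.
  by move=> /EE[y [w [p [q [d [_ _ _ E]]]]]]; exists y, w, p, q.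
case=> y [w [p [q E]]].
have [ms min hb] := ec_bd E.
have einf : infinite_set e.
  rewrite (ec_e E); apply: carc_infinite; [exact: ec_onp E|exact: ec_p E|exact: ec_q E|exact: ec_pq E].
have [|e0 e0in inf] := infinite_pigeon (EL := EL) einf.
  move=> x ex; apply: cov; apply: (bd_skel g min); first exact: edgec_sphere E ex.
  by move: ex; rewrite (ec_e E) => -[t /= tI <-]; exact: hb.
have [y0 [w0 [p0 [q0 [d [dD dy0 dw0 E0]]]]]] := EE _ e0in.
pose V := [set pt y w (- p); pt y w q] `|` [set pt y0 w0 (- p0); pt y0 w0 q0].
have inf' : infinite_set ((e `&` e0) `\` V).
  by apply: infinite_setD => //; rewrite finite_setU; split; exact: finite_set2.
have intr x : ((e `&` e0) `\` V) x ->
    (exists2 s, - p < s < q & x = pt y w s) /\ (exists2 s, - p0 < s < q0 & x = pt y0 w0 s).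
  move=> [[]]; rewrite {1}(ec_e E) {1}(ec_e E0) => -[s /= /andP[s1 s2] <-] [t /= /andP[t1 t2] et] nV.
  split.
    exists s => //; rewrite !lt_neqAle s1 s2 !andbT.
    by apply/andP; split; apply/eqP => h; apply: nV; left; [left|right]; rewrite /= ?h // -h.
  exists t => //; rewrite !lt_neqAle t1 t2 !andbT.
  by apply/andP; split; apply/eqP => h; apply: nV; right; [left|right]; rewrite /= -et ?h // -h.
have [x [z [xI zI xz]]] : exists x y, [/\ ((e `&` e0) `\` V) x, ((e `&` e0) `\` V) y & cross x y <> zerov R].
  by apply: infinite_two => // x [[ex _] _]; exact: edgec_sphere E ex.
have [[s1 s1I ex] [t1 t1I ex']] := intr _ xI; have [[s2 s2I ez] [t2 t2I ez']] := intr _ zI.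
have dd : dot d d = 1 by have [Du _ _] := g_gp g; exact: Du.
have [yy ww yw] := ec_onp E.
have dyw : dot d y = 0 /\ dot d w = 0.
  have [f1 f2 _ [f3 f4 f5]] := onf_cross yy ww yw.
  have nn : dot (cross y w) (cross y w) = 1 by rewrite dot_crossxx yy ww yw; ring.
  have [e1|e1] : d = cross y w \/ d = negv (cross y w).
    apply: (cross_orth xz) => //.
    - by rewrite ex orth_pt // dotC.
    - by rewrite ez orth_pt // dotC.
    - by rewrite ex' orth_pt.
    - by rewrite ez' orth_pt.
  - by rewrite e1 ![dot (cross _ _) _]dotC.
  - by rewrite e1 !dot_negl ![dot (cross _ _) _]dotC f4 f5 oppr0.
have [dy dw] := dyw.
have W (s a b : R) : - a < s < b -> - a <= s <= b by move=> /andP[? ?]; rewrite !ltW.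
have F := edgec_recenter E (W _ _ _ s1I); have F0 := edgec_recenter E0 (W _ _ _ t1I).
rewrite -ex in F; rewrite -ex' in F0.
suff -> : e = e0 by [].
apply: (edgec_uniq2 dd F F0); rewrite ?orth_pt //; try lra.
by rewrite ex orth_pt.
Qed.

(** Two different great circles meet exactly in an antipodal pair. *)
Lemma ends_opp D u n x y : generic D u -> n \in D -> dot n n = 1 -> sphere x -> sphere y ->
  dot u x = 0 -> dot u y = 0 -> dot n x = 0 -> dot n y = 0 -> x <> y -> y = negv x.
Proof.
move=> gu nD nn xx yy ux uy nx ny xNy.
have xy0 : cross x y = zerov R.
  apply: contrapT => xy; have [uu _ _] := gu.
  have := generic_apar gu nD; have [->|->] := cross_orth xy nn uu nx ny ux uy.
    by rewrite apar_irr.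
  by rewrite apar_negl apar_irr.
by have [e|//] := unit_cross0 xx yy xy0; case: xNy.
Qed.

Section Step.
Variables (nss : seq (seq (V3 R))) (D : seq (V3 R)) (ns : seq (V3 R)) (u : V3 R).
Variables (nss' : seq (seq (V3 R))) (c w : V3 R) (th1 th2 : R).
Hypotheses (g : good nss D) (gu : generic D u) (nsin : ns \in nss) (hit : hitc ns u).
Hypothesis ref : refines nss ns u nss'.
Hypothesis sd : secdata ns u c w th1 th2.
Hypothesis vu : forall x, vtx nss x -> dot u x <> 0.

Let va := pt c w th1.
Let vb := pt c w (- th2).
Let mem ms := mem_refines ms g ref.

Lemma vtx_step x : vtx nss' x <-> vtx nss x \/ (x = va \/ x = vb).
Proof.
rewrite (vtx_split g gu nsin ref); split; (case=> [h|h]; [by left|right]).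
  exact/(endsP sd).
by have /(endsP sd) := h.
Qed.

Definition eu : set (V3 R) := carc c w th2 th1.

Lemma eu_edge : edgeD nss' (u :: negv u :: D) eu.
Proof.
have [h1 h2 h3 h4 h5] := th_bounds sd.
exists c, w, th2, th1, u; split; [exact: mem_head|exact: sd_uc sd|exact: sd_uw sd|].
have uND := uND gu.
split=> //.
- exact: sd_onp sd.
- exact: ltW.
- exact: ltW.
- by lra.
- exists (u :: ns); first by rewrite mem eqxx.
  move=> t tI; split; last by exists u; rewrite ?mem_head // (dot_u_pt sd).
  by rewrite /= (dot_u_pt sd) lexx (sd_cone sd); lra.
- by apply/vtx_step; right; right.
- by apply/vtx_step; right; left.
- move=> t tI /vtx_step; rewrite -(endsP sd) => -[/vu|[_ _ _ [n nns nx]]].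
    by rewrite (dot_u_pt sd).
  by have /iconeP /(_ _ nns) := sd_icone sd tI; rewrite nx ltxx.
Qed.

Lemma eu_cover x : sphere x -> dot u x = 0 -> cone ns x -> eu x.
Proof.
move=> sx ux; have [t tI ->] := sd_pt sd sx ux; rewrite (sd_cone sd) // => h.
by exists t.
Qed.

(** An edge must lie in the boundary of a single cell; after the split of m this requires that u
    does not change sign along the arc. *)
Lemma bd_child y v p q m : m \in nss -> (forall t, - p <= t <= q -> bd m (pt y v t)) ->
  (m = ns -> (forall t, - p <= t <= q -> 0 <= dot u (pt y v t)) \/
             (forall t, - p <= t <= q -> dot u (pt y v t) <= 0)) ->
  exists2 m', m' \in nss' & forall t, - p <= t <= q -> bd m' (pt y v t).
Proof.
move=> min hb sgn; have [em|/eqP mN] := eqVneq m ns; last first.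
  by exists m => //; rewrite mem min (introN eqP mN) !orbT.
have [h|h] := sgn em.
  exists (u :: ns); first by rewrite mem eqxx.
  move=> t tI; have [cm [n nm nt]] := hb t tI; split; first by rewrite /= h // -em.
  by exists n; rewrite // inE -em nm orbT.
exists (negv u :: ns); first by rewrite mem eqxx !orbT.
move=> t tI; have [cm [n nm nt]] := hb t tI; split; first by rewrite /= dot_negl oppr_ge0 h // -em.
by exists n; rewrite // inE -em nm orbT.
Qed.

Lemma skel_step x : skel nss' x -> eu x \/ skel nss x.
Proof.
case=> sx [m1 [m2 [h1 h2 n12 c1 c2]]].
have [e12|/eqP N12] := eqVneq (parent ns u m1) (parent ns u m2).
  have [ux cx] := new_side g gu ref h1 h2 n12 c1 c2 e12.
  by left; exact: eu_cover.
right; split=> //; exists (parent ns u m1), (parent ns u m2).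
by split; rewrite ?(parent_in g nsin ref) ?parent_cone.
Qed.

Lemma vtx_bounds nss0 e y v p q : edgec nss0 e y v p q -> 0 < p -> 0 < q -> p < pi /\ q < pi.
Proof. by move=> E p0 q0; have /andP[_ ?] := ec_pq E; split; lra. Qed.

Definition is_end v := v = va \/ v = vb.

Lemma end_u v : is_end v -> dot u v = 0.
Proof. by case=> ->; exact: dot_u_pt sd _. Qed.

(** The end v of the cut is no old vertex, so it is an inner point of e. The tangent v' is not
    orthogonal to u, as otherwise an old vertex, the end of e, would be on the circle of u. *)
Lemma edge_through v e : is_end v -> edgeD nss D e -> e v -> exists v' p q d,
  [/\ d \in D, dot d v = 0, dot d v' = 0 & edgec nss e v v' p q] /\ [/\ 0 < p, 0 < q & dot u v' <> 0].
Proof.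
move=> vend [y [v0 [p [q [d [dD dy dv E]]]]]] ev; have uv := end_u vend.
have nv : ~ vtx nss v by move=> /vu.
have [s /andP[s1 s2] es] := edgec_in_interior E ev nv.
have sI : - p <= s <= q by rewrite !ltW.
have F := edgec_recenter E sI; rewrite -es in F.
exists (pt y v0 (s + pi / 2)), (p + s), (q - s), d; split; split; try lra.
- exact: dD.
- by rewrite es orth_pt.
- by rewrite orth_pt.
- exact: F.
- by move=> h; case: (vu (ec_vq F)); rewrite dot_pt uv h; ring.
Qed.

(** Seen from v, the product of u with the point of angle t is [sin t * dot u v'], which has a
    constant sign for angles between 0 and q, because q < pi. *)
Lemma half_edge v v' e p q d : is_end v -> d \in D -> dot d v = 0 -> dot d v' = 0 ->
  edgec nss e v v' p q -> 0 < p -> 0 < q -> dot u v' <> 0 ->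
  edgeD nss' (u :: negv u :: D) (carc v v' 0 q).
Proof.
move=> vend dD dv dv' E p0 q0 uv'; have uv := end_u vend.
have [pp qp] := vtx_bounds E p0 q0.
have upt t : dot u (pt v v' t) = sin t * dot u v' by rewrite dot_pt uv; ring.
exists v, v', 0, q, d; split=> //; first by rewrite !inE dD !orbT.
split=> //; rewrite ?oppr0.
- exact: ec_onp E.
- exact: ltW.
- by rewrite add0r q0 ltW.
- have [m min hb] := ec_bd E.
  suff : exists2 m', m' \in nss' & forall t, - 0 <= t <= q -> bd m' (pt v v' t) by rewrite oppr0.
  apply: (bd_child min) => [t tI|_]; first by apply: hb; lra.
  have sg t : - 0 <= t <= q -> 0 <= sin t by move=> tI; apply: sin_ge0_pi; lra.
  have [h|h] := lerP 0 (dot u v').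
    by left=> t /sg ht; rewrite upt mulr_ge0.
  by right=> t /sg ht; rewrite upt mulr_ge0_le0 // ltW.
- by rewrite pt0; apply/vtx_step; right.
- by apply/vtx_step; left; exact: ec_vq E.
- move=> t tI /vtx_step[h|h]; first by apply: (ec_nv E _ h); lra.
  have st : 0 < sin t by apply: sin_gt0_pi; lra.
  have : sin t * dot u v' = 0 by rewrite -upt; exact: end_u.
  by move=> /eqP; rewrite mulf_eq0 gt_eqF //= => /eqP.
Qed.

Lemma const_sign (f : R -> R) p q : continuous f -> (forall t, p <= t <= q -> f t <> 0) ->
  (forall t, p <= t <= q -> 0 <= f t) \/ (forall t, p <= t <= q -> f t <= 0).
Proof.
move=> cf f0; apply: contrapT => /not_orP[/existsNP[s /not_implyP[sI]] ] + /existsNP[t /not_implyP[tI]].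
move=> /negP; rewrite -ltNge => fs /negP; rewrite -ltNge => ft.
have cw (a b : R) : {within `[a, b], continuous f} by apply: continuous_subspaceT.
have [st|ts] := lerP s t.
  have [|r] := IVT (v := 0) st (cw s t).
    by rewrite ge_min le_max (ltW fs) (ltW ft) orbT.
  by rewrite in_itv /= => rI; apply: f0; lra.
have [|r] := IVT (v := 0) (ltW ts) (cw t s).
  by rewrite ge_min le_max (ltW fs) (ltW ft) orbT.
by rewrite in_itv /= => rI; apply: f0; lra.
Qed.

(** A sign change of u along an edge in the boundary of ns would produce a boundary point of ns on
    the cut, which is an end. *)
Lemma edge_persist e : edgeD nss D e -> ~ e va -> ~ e vb -> edgeD nss' (u :: negv u :: D) e.
Proof.
move=> [y [v [p [q [d [dD dy dv E]]]]]] na nb.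
exists y, v, p, q, d; split=> //; first by rewrite !inE dD !orbT.
have notend t : - p <= t <= q -> ~ is_end (pt y v t).
  by move=> tI [h|h]; [apply: na|apply: nb]; rewrite -h (ec_e E); exists t.
case: (E) => yv p0 q0 pq ee [m min hb] vp vq nv; split=> //.
- apply: (bd_child min) => // em; apply: const_sign => [|t tI ut].
    by move=> t; apply: continuous_comp; [exact: continuous_pt|exact: continuous_dot].
  apply: (notend t tI); apply/(endsP sd).
  by have := hb t tI; rewrite em => -[ct nt]; split=> //; exact: onp_pt.
- by apply/vtx_step; left.
- by apply/vtx_step; left.
- by move=> t tI /vtx_step[|h]; [exact: nv|apply: notend h; lra].
Qed.

(** If the carrying circles differed, they would meet the circle of u at v, against genericity. On a
    common circle, edges with a common inner point coincide. *)
Lemma edge_through_uniq v e e' : is_end v -> edgeD nss D e -> edgeD nss D e' -> e v -> e' v -> e = e'.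
Proof.
move=> vend Ee Ee' ev ev'; have uv := end_u vend.
have [v1 [p [q [d [[dD dv dv1 E] [p0 q0 _]]]]]] := edge_through vend Ee ev.
have [v2 [p' [q' [d' [[dD' dv' dv2 E'] [p0' q0' _]]]]]] := edge_through vend Ee' ev'.
have [Du _ _] := g_gp g; have [_ _ ud] := gu.
have v0 : v <> zerov R by have [vv _ _] := ec_onp E; exact: unit_neq0.
have {}dv2 : dot d v2 = 0.
  have [ap|] := boolP (apar d d'); first by case: v0; apply: (det_orth0 (ud _ _ dD dD' ap)).
  by rewrite negb_and !negbK => /orP[]/eqP->; rewrite ?dot_negl dv2 ?oppr0.
exact: (edgec_uniq2 (Du _ dD) E E').
Qed.

(** Within less than pi of v, the circle carrying e meets the circle of u at v only. *)
Lemma other_end v v1 e : is_end v -> is_end v1 -> v <> v1 -> edgeD nss D e -> e v -> ~ e v1.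
Proof.
move=> vend vend1 vN Ee ev.
have [v' [p [q [d [[dD dv dv' E] [p0 q0 uv']]]]]] := edge_through vend Ee ev.
have [pp qp] := vtx_bounds E p0 q0.
rewrite (ec_e E) => -[t /= tI e1]; have := end_u vend1.
rewrite -e1 dot_pt (end_u vend) mulr0 add0r => /eqP; rewrite mulf_eq0 => /orP[]/eqP; last by [].
have [t0|t0|t0] := ltrgtP t 0; last by move=> _; apply: vN; rewrite -e1 t0 pt0.
  have : 0 < sin (- t) by move: e1 => _; apply: sin_gt0_pi; lra.
  by rewrite sinN => + h; rewrite h oppr0 ltxx.
have : 0 < sin t by move: e1 => _; apply: sin_gt0_pi; lra.
by move=> + h; rewrite h ltxx.
Qed.

Lemma edge_cut v e : is_end v -> edgeD nss D e -> e v -> exists e1 e2,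
  [/\ edgeD nss' (u :: negv u :: D) e1, edgeD nss' (u :: negv u :: D) e2, e1 <> e2, e1 v /\ e2 v &
      e = e1 `|` e2].
Proof.
move=> vend Ee ev.
have [v' [p [q [d [[dD dv dv' E] [p0 q0 uv']]]]]] := edge_through vend Ee ev.
have [pp qp] := vtx_bounds E p0 q0; have E' := edgec_flip E.
have uv := end_u vend.
exists (carc v v' 0 q), (carc v (negv v') 0 p); split.
- exact: (half_edge vend dD dv dv' E).
- apply: (half_edge vend dD dv _ E') => //; first by rewrite dot_negr dv' oppr0.
  by rewrite dot_negr => /eqP; rewrite oppr_eq0 => /eqP.
(* The product with u has opposite signs on the two halves away from v. *)
- move=> e12; have : carc v v' 0 q (pt v v' q) by exists q => //=; lra.
  rewrite e12 => -[t /= tI /(congr1 (dot u))]; rewrite !dot_pt uv dot_negr => h.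
  have sq : 0 < sin q by apply: sin_gt0_pi; lra.
  have st : 0 <= sin t by apply: sin_ge0_pi; lra.
  have : (sin q + sin t) * dot u v' = 0 by lra.
  by move=> /eqP; rewrite mulf_eq0 => /orP[]/eqP ?; [lra|].
- by split; exists 0; rewrite ?pt0 //= oppr0 lexx /= ltW.
- rewrite (ec_e E); apply/seteqP; split.
    move=> _ [t /= tI <-]; have [t0|t0] := lerP 0 t; [left|right].
      by exists t => //=; lra.
    by exists (- t); [rewrite /=; lra|rewrite -ptN opprK].
  move=> _ [[t /= tI <-]|[t /= tI <-]]; first by exists t => //=; lra.
  by exists (- t); [rewrite /=; lra|rewrite ptN].
Qed.

Definition edge_list nss D EL :=
  [/\ uniq EL, forall e, e \in EL -> edgeD nss D e & covers nss EL].

(** The cut is one new edge, and its two ends lie on different old edges, each of which is replaced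
    by two: 1 + 2 more edges. *)
Lemma edge_list_step EL : edge_list nss D EL ->
  exists2 EL', edge_list nss' (u :: negv u :: D) EL' & size EL' = (size EL + 3)%N.
Proof.
move=> [uEL EE cov].
have enda : is_end va by left.
have endb : is_end vb by right.
have ab : va <> vb := ends_neq sd.
have skel_end v : is_end v -> skel nss v.
  move=> /(endsP sd)[sv uv cv hv]; exact: (bd_skel g nsin sv (conj cv hv)).
have [ea ein ea_a] := cov _ (skel_end _ enda); have [eb ebin eb_b] := cov _ (skel_end _ endb).
have Ea := EE _ ein; have Eb := EE _ ebin.
have ea_b := other_end enda endb ab Ea ea_a.
have eb_a := other_end endb enda (nesym ab) Eb eb_b.
have [a1 [a2 [A1 A2 a12 [a1a a2a] ae]]] := edge_cut enda Ea ea_a.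
have [b1 [b2 [B1 B2 b12 [b1b b2b] be]]] := edge_cut endb Eb eb_b.
have eab : eb <> ea by move=> h; apply: ea_b; rewrite -h.
pose rest := rem eb (rem ea EL).
have urest : uniq rest by rewrite !rem_uniq.
have inrest e : (e \in rest) = [&& e != eb, e != ea & e \in EL].
  by rewrite mem_rem_uniq ?rem_uniq // !inE mem_rem_uniq // !inE.
have resta e : e \in rest -> ~ e va.
  rewrite inrest => /and3P[_ /eqP h eEL] ev; apply: h.
  exact: (edge_through_uniq enda (EE _ eEL) Ea).
have restb e : e \in rest -> ~ e vb.
  rewrite inrest => /and3P[/eqP h _ eEL] ev; apply: h.
  exact: (edge_through_uniq endb (EE _ eEL) Eb).
have [eua eub] : eu va /\ eu vb.
  have [h1 h2 h3 h4 h5] := th_bounds sd.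
  by split; [exists th1|exists (- th2)] => //=; lra.
have a1b : ~ a1 vb by move=> h; apply: ea_b; rewrite ae; left.
have a2b : ~ a2 vb by move=> h; apply: ea_b; rewrite ae; right.
have b1a : ~ b1 va by move=> h; apply: eb_a; rewrite be; left.
have b2a : ~ b2 va by move=> h; apply: eb_a; rewrite be; right.
exists [:: eu, a1, a2, b1, b2 & rest]; last first.
  rewrite /= /rest size_rem ?size_rem //; last by rewrite mem_rem_uniq // !inE ebin (introN eqP eab).
  have : (1 < size EL)%N.
    have : {subset [:: ea; eb] <= EL} by move=> e; rewrite !inE => /orP[]/eqP->.
    by move=> /uniq_leq_size; apply; rewrite /= inE eq_sym (introN eqP eab).
  by case: (size EL) => [|[|n]] //= _; rewrite !addnS addn0.
split.
- have nr e v : is_end v -> e v -> e \notin rest.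
    by move=> [->|->] ev; apply/negP => h; [exact: (resta _ h)|exact: (restb _ h)].
  rewrite !cons_uniq urest !in_cons !negb_or (nr _ _ enda eua) (nr _ _ enda a1a) (nr _ _ enda a2a) (nr _ _ endb b1b) (nr _ _ endb b2b) ?andbT.
  have ne e e' x : e x -> ~ e' x -> e <> e' by move=> ex nx h; apply: nx; rewrite -h.
  by do ![apply/andP; split]; case: pselect => // h;
    do ?[by case: (ne _ _ vb _ _ h)|by case: (ne _ _ va _ _ h)|by case: a12|by case: b12].
- move=> e; rewrite !in_cons => /or4P[/eqP->|/eqP->|/eqP->|/or3P[/eqP->|/eqP->|er]] //.
  + exact: eu_edge.
  + apply: edge_persist; [|exact: resta|exact: restb].
    by move: er; rewrite inrest => /and3P[_ _ /EE].
- move=> x /skel_step[h|/cov[e eEL ex]]; first by exists eu; rewrite ?mem_head.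
  have [ea'|na] := eqVneq e ea.
    by move: ex; rewrite ea' ae => -[h|h]; [exists a1|exists a2]; rewrite ?inE ?eqxx ?orbT.
  have [eb'|nb] := eqVneq e eb.
    by move: ex; rewrite eb' be => -[h|h]; [exists b1|exists b2]; rewrite ?inE ?eqxx ?orbT.
  by exists e => //; rewrite !inE inrest na nb eEL !orbT.
Qed.

(* Before the first split the boundary circle of the two hemispheres carries no vertex, hence no edge. *)
Lemma edge_list_base n : ns = [:: n] -> [:: negv n] \in nss ->
  (forall m, m \in nss -> m = [:: n] \/ m = [:: negv n]) ->
  exists2 EL', edge_list nss' (u :: negv u :: D) EL' & size EL' = 3%N.
Proof.
move=> ens nnin two.
have nns : n \in ns by rewrite ens mem_head.
have nD : n \in D by exact: (g_sub g nsin).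
have [Du _ _] := g_gp g; have nn := Du _ nD; have [uu _ _] := gu.
have sa := sphere_pt1 sd th1; have sb := sphere_pt1 sd (- th2); rewrite -/va -/vb in sa sb.
have ua : dot u va = 0 := dot_u_pt sd _; have ub : dot u vb = 0 := dot_u_pt sd _.
have na : dot n va = 0 by have [k] := sd_n1 sd; rewrite ens inE => /eqP->.
have nb : dot n vb = 0 by have [k] := sd_n2 sd; rewrite ens inE => /eqP->.
(* The cut of a hemisphere is a half circle; its antipodal ends divide the boundary circle into two
   edges of length pi, the extreme value allowed for an edge. *)
have ab : vb = negv va := ends_opp gu nD nn sa sb ua ub na nb (ends_neq sd).
have novtx x : ~ vtx nss x.
  move=> [_ [m1 [m2 [m3 [/two h1 /two h2 /two h3 [n12 n13 n23] _]]]]].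
  by case: h1 => e1; case: h2 => e2; case: h3 => e3; congruence.
pose w0 := cross n va; have [_ _ ww [_ nw aw]] := onf_cross nn sa na.
have uw0 : dot u w0 <> 0.
  move=> uw; have aw0 : cross va w0 <> zerov R.
    by move=> h; have := dot_crossxx va w0; rewrite h dot0r sa ww aw => ?; vlra.
  have := generic_apar gu nD; have [->|->] := cross_orth aw0 nn uu na nw ua uw.
    by rewrite apar_irr.
  by rewrite apar_negl apar_irr.
have upt v t : dot u (pt va v t) = sin t * dot u v by rewrite dot_pt ua; ring.
have nnin' : [:: negv n] \in nss'.
  rewrite mem nnin ens andbT; apply/orP; right; apply/orP; right.
  by apply/eqP => -[/(congr1 (dot n))]; rewrite dot_negr nn => ?; vlra.
have half v : onp va v -> dot n v = 0 -> dot u v <> 0 ->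
    edgeD nss' (u :: negv u :: D) (carc va v 0 pi).
  move=> ov nv uv; exists va, v, 0, pi, n; split=> //; first by rewrite !inE nD !orbT.
  split=> //; rewrite ?oppr0 ?pt0.
  - exact: pi_ge0.
  - by rewrite add0r pi_gt0 lexx.
  - exists [:: negv n] => // t _; have nt : dot n (pt va v t) = 0 by apply: orth_pt.
    split; first by rewrite /= dot_negl nt oppr0 lexx.
    by exists (negv n); rewrite ?mem_head // dot_negl nt oppr0.
  - by apply/vtx_step; right; left.
  - apply/vtx_step; right; right; rewrite ab; apply: V3P => m.
    by rewrite dot_pt cospi sinpi dot_negr; ring.
  - move=> t tI /vtx_step[/novtx//|h].
    have st : 0 < sin t by exact: sin_gt0_pi.
    have : sin t * dot u v = 0 by rewrite -upt; case: h => ->.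
    by move=> /eqP; rewrite mulf_eq0 gt_eqF //= => /eqP.
have o1 : onp va w0 by [].
have o2 : onp va (negv w0) by split; rewrite ?dot_negl ?dot_negr ?opprK // aw oppr0.
have H1 := half w0 o1 nw uw0.
have H2 : edgeD nss' (u :: negv u :: D) (carc va (negv w0) 0 pi).
  apply: half => //; first by rewrite dot_negr nw oppr0.
  by rewrite dot_negr => /eqP; rewrite oppr_eq0 => /eqP.
have nc : 0 < dot n c.
  have [h1 h2 h3 h4 h5] := th_bounds sd.
  have : icone ns (pt c w 0) by apply: (sd_icone sd); vlra.
  by move=> /iconeP /(_ _ nns); rewrite pt0.
have euc : eu c.
  have [h1 h2 h3 h4 h5] := th_bounds sd.
  by exists 0; rewrite ?pt0 //=; vlra.
have notc v : dot n v = 0 -> ~ carc va v 0 pi c.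
  by move=> nv [t _ h]; move: nc; rewrite -h orth_pt // ltxx.
have nw' : dot n (negv w0) = 0 by rewrite dot_negr nw oppr0.
exists [:: eu; carc va w0 0 pi; carc va (negv w0) 0 pi] => //; split.
- apply: uniq3 => h.
  + by apply: (notc w0 nw); rewrite -h.
  + by apply: (notc _ nw'); rewrite -h.
  + have : carc va w0 0 pi (pt va w0 (pi / 2)) by exists (pi / 2) => //=; have := @pi_gt0 R; vlra.
    rewrite h => -[t /= tI /(congr1 (dot u))]; rewrite !upt dot_negr sin_pihalf => e.
    have st : 0 <= sin t by apply: sin_ge0_pi; vlra.
    have : (1 + sin t) * dot u w0 = 0 by vlra.
    by move=> /eqP; rewrite mulf_eq0 => /orP[]/eqP ?; [vlra|].
- move=> e; rewrite !in_cons in_nil orbF => /or3P[/eqP->|/eqP->|/eqP->] //; exact: eu_edge.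
- move=> x /skel_step[h|[sx [m1 [m2 [/two h1 /two h2 n12 c1 c2]]]]]; first by exists eu; rewrite ?mem_head.
  have nx : dot n x = 0.
    case: h1 => e1; case: h2 => e2; rewrite {}e1 {}e2 in n12 c1 c2 => //; move: c1 c2;
      by rewrite /= !andbT dot_negl => ? ?; vlra.
  have [t tI ->] := sphere_pt nn sa na sx nx.
  have [t0|t0] := lerP 0 t.
    by exists (carc va w0 0 pi); rewrite ?in_cons ?eqxx ?orbT //; exists t => //=; vlra.
  exists (carc va (negv w0) 0 pi); rewrite ?in_cons ?eqxx ?orbT //.
  by exists (- t); [rewrite /=; vlra|rewrite -ptN opprK].
Qed.

End Step.
End EdgeLists.

(** * The invariant of generic splitting *)

Section Invariant.
Variable R : realType.
Implicit Types (x y z u n c w d : V3 R) (ns ms : seq (V3 R)).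
Implicit Types (nss : seq (seq (V3 R))) (D : seq (V3 R)) (segs : seq (set (V3 R))).

Definition nhemi nss := count (fun ns => size ns == 1%N) nss.

(** Each segment is tied to a circle of D so that a new cut, on a new circle, differs from all
    earlier ones. The edges need an alternative because the equator of the initial tessellation
    belongs to the skeleton but contains no edge, so that no list of edges covers it. *)
Record tess_inv nss segs D : Prop := Inv {
  inv_good : good nss D;
  inv_size : (2 <= size nss)%N;
  inv_segs : [/\ uniq segs, size segs = (size nss - 2)%N &
    forall s, s \in segs -> exists2 d, d \in D & forall x, s x -> dot d x = 0];
  inv_vtx : exists VL, [/\ uniq VL, size VL = (2 * (size nss - 2))%N & forall x, vtx nss x <-> x \in VL];
  inv_facets : (\sum_(ns <- nss) nfacets ns = 4 * (size nss - 2) + nhemi nss)%N;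
  inv_edges : (exists2 EL, edge_list nss D EL & size EL = (3 * (size nss - 2))%N /\ (2 < size nss)%N) \/
    exists n, nss = [:: [:: n]; [:: negv n]] }.

Lemma nhemi_refines nss D ns u nss' : good nss D -> ns \in nss -> refines nss ns u nss' ->
  (nhemi nss' + (size ns == 1) = nhemi nss)%N.
Proof.
move=> g nsin p; have ne := g_ne g nsin.
rewrite /nhemi (permP p) (permP (perm_to_rem nsin)) /= eqSS size_eq0 (negbTE ne) /= !add0n addnC.
by [].
Qed.

(** If an old circle contained the section, the interior point c and the end of angle th1 would be
    antipodal, but a normal that is positive at c vanishes at that end. *)
Lemma section_not_old nss D ns u d : good nss D -> generic D u -> ns \in nss -> hitc ns u ->
  d \in D -> ~ (forall x, (spoly ns `&` gc u) x -> dot d x = 0).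
Proof.
move=> g gu nsin hit dD h; have [c [w [th1 [th2 sd]]]] := secdata_ex g gu nsin hit.
have [h1 h2 h3 h4 h5] := th_bounds sd.
have [Du _ _] := g_gp g; have dd := Du _ dD.
have sec t : - th2 <= t <= th1 -> (spoly ns `&` gc u) (pt c w t).
  move=> tI; have st := sphere_pt1 sd t; split; first split=> //.
    by rewrite (sd_cone sd) //; lra.
  by split=> //; rewrite dotC; exact: dot_u_pt sd t.
have ic : icone ns c by rewrite -(pt0 c w); apply: (sd_icone sd); lra.
have [n nns na] := sd_n1 sd.
have nc : 0 < dot n c by exact: (iconeP _ _ ic).
have sa := sphere_pt1 sd th1; have sc : sphere c by have [? _ _] := sd_onp sd.
have ca : c <> pt c w th1 by move=> e; move: nc; rewrite e na ltxx.
have dc : dot d c = 0 by apply: h; rewrite -(pt0 c w); apply: sec; lra.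
have da : dot d (pt c w th1) = 0 by apply: h; apply: sec; lra.
have e := ends_opp gu dD dd sc sa (sd_uc sd) (dot_u_pt sd th1) dc da ca.
by move: na; rewrite e dot_negr => ?; lra.
Qed.

Lemma inv_split nss segs D ns u nss' : tess_inv nss segs D -> generic D u ->
  (forall x, vtx nss x -> dot u x <> 0) -> ns \in nss -> hitc ns u -> refines nss ns u nss' ->
  tess_inv nss' (rcons segs (spoly ns `&` gc u)) (u :: negv u :: D).
Proof.
move=> [g sz [us ss hs] [VL [uV sV hV]] hf hE] gu vu nsin hit ref.
have g' := good_split g gu nsin hit ref.
have [c [w [th1 [th2 sd]]]] := secdata_ex g gu nsin hit.
have sz' := size_refines nsin ref.
have sub2 : (size nss' - 2 = (size nss - 2).+1)%N by rewrite sz' subSn.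
split=> //.
- by rewrite sz' leqW.
- split.
  + rewrite rcons_uniq us andbT; apply/negP => /hs[d dD h].
    exact: (section_not_old g gu nsin hit dD h).
  + by rewrite size_rcons ss sub2.
  + move=> s; rewrite mem_rcons in_cons => /orP[/eqP->|/hs[d dD h]].
      exists u; first exact: mem_head.
      by move=> x [_ [_]]; rewrite dotC.
    by exists d => //; rewrite !inE dD !orbT.
- exists [:: pt c w th1, pt c w (- th2) & VL]; split.
  + have nV t : pt c w t \notin VL.
      by apply/negP => /hV/vu; rewrite (dot_u_pt sd).
    by rewrite !cons_uniq in_cons negb_or !nV uV !andbT; apply/eqP; exact: ends_neq sd.
  + by rewrite /= sV sub2 mulnS.
  + move=> x; rewrite (vtx_step g gu nsin ref sd) hV !in_cons.
    split; first by case=> [->|[]->]; rewrite ?eqxx ?orbT.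
    by case/or3P => [/eqP->|/eqP->|]; [right; left|right; right|left].
- have e1 := refines_sum (@nfacets R) nsin ref; rewrite hf -addnA (nfacets_split g gu nsin hit) in e1.
  have e2 := nhemi_refines g nsin ref; rewrite -e2 in e1.
  apply/eqP; rewrite -(eqn_add2r (nfacets ns)) e1 sub2; apply/eqP.
  case: (size ns == 1%N) => /=; ring.
- left; case: hE => [[EL hEL [sEL sz2]]|[n e]].
    have [EL' h s] := edge_list_step g gu nsin ref sd vu hEL.
    by exists EL' => //; rewrite s sEL sub2 sz' mulnS addnC; split=> //; exact: ltnW.
  have two m : m \in nss -> m = [:: n] \/ m = [:: negv n].
    by rewrite e !in_cons in_nil orbF => /orP[]/eqP->; [left|right].
  have [EL' h s] : exists2 EL', edge_list nss' (u :: negv u :: D) EL' & size EL' = 3%N.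
    case: (two _ nsin) => ens.
      apply: (edge_list_base g gu nsin ref sd vu ens) => //.
      by rewrite e !in_cons eqxx orbT.
    apply: (edge_list_base (n := negv n) g gu nsin ref sd vu ens).
      by rewrite negvK e mem_head.
    by move=> m /two; rewrite negvK => -[]; [right|left].
  by exists EL' => //; rewrite s sub2 sz' e.
Qed.

Lemma inv_nZ nss segs D : tess_inv nss segs D -> nZ (mktess nss segs) = size nss.
Proof. by move=> h; exact: nZE (inv_good h). Qed.

Lemma inv_nM nss segs D : tess_inv nss segs D -> nM (mktess nss segs) = (size nss - 2)%N.
Proof. by move=> h; have [us <- _] := inv_segs h; exact: nME. Qed.

Lemma inv_nV nss segs D : tess_inv nss segs D -> nV (mktess nss segs) = (2 * (size nss - 2))%N.
Proof.
move=> h; have [VL [uV <- hV]] := inv_vtx h; apply: count_setE => // x.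
by rewrite -hV; exact: is_vertexE (inv_good h).
Qed.

Lemma inv_nS nss segs D : tess_inv nss segs D -> nS (mktess nss segs) = (4 * (size nss - 2) + nhemi nss)%N.
Proof. by move=> h; rewrite (nSE _ (inv_good h)); exact: inv_facets h. Qed.

Lemma inv_nE nss segs D : tess_inv nss segs D -> nE (mktess nss segs) = (3 * (size nss - 2))%N.
Proof.
move=> h; case: (inv_edges h) => [[EL [uE EE cov] [<- _]]|[n e]].
  by apply: count_setE => // e; exact: edges_okP (inv_good h) EE cov.
rewrite {2}e /=; apply: (count_setE (s := [::])) => // E; split=> //.
move=> /(is_edgeE segs _ (inv_good h))[y [v [p [q EE]]]].
have [_ [m1 [m2 [m3 []]]]] := ec_vp EE.
by rewrite e !in_cons !in_nil !orbF => /orP[]/eqP-> /orP[]/eqP-> /orP[]/eqP-> [h1 h2 h3] _; congruence.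
Qed.

Lemma tess_inv0 : tess_inv [:: [:: e3 R]; [:: negv (e3 R)]] [::] [:: e3 R; negv (e3 R)].
Proof.
have e1 : dot (e3 R) (e3 R) = 1 by rewrite /dot /e3 /=; ring.
have eN : e3 R <> negv (e3 R).
  by move=> /(congr1 (dot (e3 R))); rewrite dot_negr e1 => ?; lra.
have ss : [:: e3 R] <> [:: negv (e3 R)] by move=> /(congr1 (head (e3 R))); exact: eN.
have apar0 d d' : d \in [:: e3 R; negv (e3 R)] -> d' \in [:: e3 R; negv (e3 R)] -> apar d d' = false.
  by rewrite !inE => /orP[]/eqP-> /orP[]/eqP->; rewrite ?apar_negl ?apar_negr apar_irr.
have novtx x : ~ vtx [:: [:: e3 R]; [:: negv (e3 R)]] x.
  move=> [_ [m1 [m2 [m3 []]]]].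
  by rewrite !in_cons !in_nil !orbF => /orP[]/eqP-> /orP[]/eqP-> /orP[]/eqP-> [h1 h2 h3] _; congruence.
have fac n : dot n (1, 0, 0) = 0 -> nfacets [:: n] = 1%N.
  move=> nx; rewrite /nfacets /= addn0; case: asboolP => // -[]; exists (1, 0, 0); split=> //.
    by move=> [/eqP]; rewrite oner_eq0.
  by move=> m; rewrite inE => ->.
have e3x : dot (e3 R) (1, 0, 0) = 0 by rewrite /dot /=; ring.
split=> //.
- split=> //.
  + by rewrite /= inE andbT; apply/eqP => -[]; lra.
  + split; first by move=> d; rewrite !inE => /orP[]/eqP->; rewrite ?dot_negl ?dot_negr ?opprK.
      by move=> d d' h h'; rewrite apar0.
    by move=> d1 d2 d3 h1 h2 h3; rewrite apar0.
  + by move=> ns; rewrite !inE => /orP[]/eqP-> m; rewrite !inE => ->; rewrite ?orbT.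
  + by move=> ns; rewrite !inE => /orP[]/eqP->.
  + by move=> ns; rewrite !inE => /orP[]/eqP->.
  + move=> ns; rewrite !inE => /orP[]/eqP->; [exists (e3 R)|exists (negv (e3 R))].
      by rewrite /= e1 ltr01.
    by rewrite /= dot_negl dot_negr opprK e1 ltr01.
  + move=> ns ms; rewrite !inE => /orP[]/eqP-> /orP[]/eqP-> // _.
      by exists (e3 R); rewrite inE.
    by exists (negv (e3 R)); rewrite ?negvK inE.
  + move=> x; have [h|h] := lerP 0 (dot (e3 R) x); [exists [:: e3 R]|exists [:: negv (e3 R)]];
      rewrite ?inE ?eqxx ?orbT //= andbT // dot_negl; lra.
  + move=> ns n x; rewrite !inE => /orP[]/eqP->; rewrite inE => /eqP-> _ nx.
      exists [:: negv (e3 R)]; split; [by rewrite !inE eqxx orbT|exact: nesym|].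
      by rewrite /= dot_negl nx oppr0 lexx.
    exists [:: e3 R]; split=> //; first by rewrite !inE eqxx.
    by move: nx; rewrite /= dot_negl => ?; rewrite andbT; lra.
- by exists [::]; split=> // x; split=> // /novtx.
- by rewrite !big_cons big_nil /= !fac ?dot_negl ?e3x ?oppr0.
- by right; exists (e3 R).
Qed.

End Invariant.

(** * Spherical integrals *)

Section LowerIntegral.
Context d (T : measurableType d) (R : realType) (mu : {measure set T -> \bar R}).
Local Open Scope ereal_scope.
Import HBNNSimple.

(* No measurability is assumed: the integral of a nonnegative function is the supremum of
   the integrals of the simple functions below it, whatever the function. *)
Lemma ae_le_integral (f g : T -> \bar R) : (forall x, 0 <= f x) -> (forall x, 0 <= g x) ->
  {ae mu, forall x, f x <= g x} -> \int[mu]_x f x <= \int[mu]_x g x.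
Proof.
move=> f0 g0 [N [mN N0 sub]]; rewrite !ge0_integralTE //=.
apply: ge_ereal_sup => _ [h /= hf <-].
pose h' : {nnsfun T >-> R} := proj_nnsfun h (measurableC mN).
apply: le_ereal_sup_tmp; exists (sintegral mu h').
  exists h' => //= x; rewrite mindicE; case: (boolP (x \in ~` N)) => xN.
    rewrite mulr1; apply: (le_trans (hf x)).
    by apply: contrapT => h1; move: xN; rewrite inE; apply; exact: sub.
  by rewrite mulr0.
rewrite -!integralT_nnsfun le_eqVlt; apply/orP; left; apply/eqP.
apply: ge0_ae_eq_integral => //.
- by apply/measurable_EFinP.
- by apply/measurable_EFinP.
- by move=> x _; rewrite lee_fin.
- by move=> x _; rewrite lee_fin.
exists N; split=> // x /= /not_implyP[_]; apply: contra_notP => xN.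
by rewrite mindicE mem_set // mulr1.
Qed.

Lemma le_lower_integral (D : set T) (f g : T -> \bar R) : (forall x, D x -> 0 <= f x) ->
  (forall x, D x -> f x <= g x) -> \int[mu]_(x in D) f x <= \int[mu]_(x in D) g x.
Proof.
move=> f0 fg; have g0 x : D x -> 0 <= g x by move=> Dx; exact: le_trans (f0 _ Dx) (fg _ Dx).
rewrite !ge0_integralE //=; apply: ge_ereal_sup => _ [h /= hf <-].
apply: ereal_sup_ubound; exists h => //= x; apply: le_trans (hf x) _.
by rewrite !patchE; case: ifPn => // /set_mem; exact: fg.
Qed.

End LowerIntegral.

Section SphereIntegral.
Variable R : realType.
Notation leb := (@lebesgue_measure R).
Implicit Types (u x n : V3 R) (th ph : R).

(** The density of the spherical measure, extended by zero outside the coordinate rectangle, so that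
    the integrals run over the whole line and Tonelli measurability applies. *)
Definition weight ph th : R :=
  \1_(`[0%R, (2 * pi)%R]%classic : set R) ph * (\1_(`[0%R, pi%R]%classic : set R) th * sin th).

Lemma weight_ge0 ph th : 0 <= weight ph th.
Proof.
rewrite /weight mulr_ge0 // !indicE; case: (boolP (th \in _)) => [|_]; last by rewrite mul0r.
by rewrite inE /= in_itv /= mul1r; exact: sin_ge0_pi.
Qed.

Lemma sig2intE (h : V3 R -> \bar R) : sig2int h =
  ((4 * pi)^-1%:E * \int[leb]_ph \int[leb]_th (h (sph th ph) * (weight ph th)%:E))%E.
Proof.
rewrite /sig2int; congr (_ * _)%E; rewrite integral_mkcond; apply: eq_integral => ph _.
rewrite patchE; case: ifPn => phI; last first.
  rewrite integral0_eq // => th _; rewrite /weight !indicE (negbTE phI) mul0r mule0 //.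
rewrite integral_mkcond; apply: eq_integral => th _; rewrite patchE /weight !indicE phI mul1r.
by case: ifPn => thI; rewrite /= ?mul1r ?mul0r ?mule0.
Qed.

Lemma measurable_weight : measurable_fun setT (fun p : R * R => weight p.1 p.2).
Proof.
have mi (a b : R) : measurable_fun setT (\1_(`[a, b]%classic : set R) : R -> R).
  exact: measurable_indic.
have ms : measurable_fun setT (@sin R) by apply: continuous_measurable_fun; exact: continuous_sin.
apply: measurable_funM; first exact: (measurableT_comp (mi _ _) measurable_fst).
apply: measurable_funM; first exact: (measurableT_comp (mi _ _) measurable_snd).
exact: (measurableT_comp ms measurable_snd).
Qed.

Lemma measurable_sph : measurable_fun setT (fun p : R * R => sph p.2 p.1).
Proof.
have mc : measurable_fun setT (@cos R) by apply: continuous_measurable_fun; exact: continuous_cos.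
have ms : measurable_fun setT (@sin R) by apply: continuous_measurable_fun; exact: continuous_sin.
have mc1 : measurable_fun setT (fun p : R * R => cos p.1) by exact: (measurableT_comp mc measurable_fst).
have mc2 : measurable_fun setT (fun p : R * R => cos p.2) by exact: (measurableT_comp mc measurable_snd).
have ms1 : measurable_fun setT (fun p : R * R => sin p.1) by exact: (measurableT_comp ms measurable_fst).
have ms2 : measurable_fun setT (fun p : R * R => sin p.2) by exact: (measurableT_comp ms measurable_snd).
apply: measurable_fun_pair => //; apply: measurable_fun_pair => /=; exact: measurable_funM.
Qed.

Lemma sph_unit th ph : dot (sph th ph) (sph th ph) = 1.
Proof.
rewrite /dot /sph /=; have := cos2Dsin2 th; have := cos2Dsin2 ph => h1 h2.
transitivity (sin th ^+ 2 * (cos ph ^+ 2 + sin ph ^+ 2) + cos th ^+ 2); first by ring.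
by rewrite h1 mulr1 addrC.
Qed.
End SphereIntegral.

Section SphereIntegralTheory.
Variable R : realType.
Notation leb := (@lebesgue_measure R).
Implicit Types (u x n : V3 R) (th ph : R).
Local Open Scope ereal_scope.

Let cpi : R := (4 * pi)^-1.
Lemma cpi_ge0 : (0 <= cpi)%R.
Proof. by rewrite invr_ge0 mulr_ge0 // pi_ge0. Qed.

Lemma weightE_ge0 (a : \bar R) th ph : 0 <= a -> 0 <= a * (weight ph th)%:E.
Proof. by move=> a0; rewrite mule_ge0 // lee_fin weight_ge0. Qed.

Lemma sig2int_ge0 (h : V3 R -> \bar R) : (forall u, 0 <= h u) -> 0 <= sig2int h.
Proof.
move=> h0; rewrite sig2intE mule_ge0 ?lee_fin ?cpi_ge0 //.
by apply: integral_ge0 => ph _; apply: integral_ge0 => th _; exact: weightE_ge0.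
Qed.

Lemma inner_ge0 (h : V3 R -> \bar R) ph : (forall u, 0 <= h u) ->
  0 <= \int[leb]_th (h (sph th ph) * (weight ph th)%:E).
Proof. by move=> h0; apply: integral_ge0 => th _; exact: weightE_ge0. Qed.

Section Measurability.
Context d (W : measurableType d) (f : W * V3 R -> \bar R).
Hypotheses (mf : measurable_fun setT f) (f0 : forall p, 0 <= f p).

Lemma measurable_sphere_integrand :
  measurable_fun setT (fun p : W * R * R => f (p.1.1, sph p.2 p.1.2) * (weight p.1.2 p.2)%:E).
Proof.
have mp : measurable_fun setT (fun p : W * R * R => (p.1.2, p.2)).
  by apply: measurable_fun_pair => //=; exact: (measurableT_comp measurable_snd measurable_fst).
apply: emeasurable_funM.
  apply: (measurableT_comp mf); apply: measurable_fun_pair => /=.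
    exact: (measurableT_comp measurable_fst measurable_fst).
  exact: (measurableT_comp (@measurable_sph R) mp).
apply/measurable_EFinP; exact: (measurableT_comp (@measurable_weight R) mp).
Qed.

Lemma measurable_inner_integral : measurable_fun setT
  (fun p : W * R => \int[leb]_th (f (p.1, sph th p.2) * (weight p.2 th)%:E)).
Proof.
have := @measurable_fun_fubini_tonelli_F _ _ (W * R)%type _ _ leb _ measurable_sphere_integrand.
by apply=> p; exact: weightE_ge0.
Qed.

Lemma measurable_sig2int : measurable_fun setT (fun w => sig2int (fun u => f (w, u))).
Proof.
under eq_fun do rewrite sig2intE.
apply: emeasurable_funM => //.
have := @measurable_fun_fubini_tonelli_F _ _ W _ _ leb _ measurable_inner_integral.
by apply=> p; apply: integral_ge0 => th _; exact: weightE_ge0.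
Qed.

End Measurability.

Lemma measurable_inner_integral1 (f : V3 R -> \bar R) : measurable_fun setT f -> (forall x, 0 <= f x) ->
  measurable_fun setT (fun ph => \int[leb]_th (f (sph th ph) * (weight ph th)%:E)) /\
  forall ph, measurable_fun setT (fun th => f (sph th ph) * (weight ph th)%:E).
Proof.
move=> mf f0.
(* A single integrand is a family over a one-point parameter space. *)
have m1 : measurable_fun setT (fun p : unit * V3 R => f p.2) by exact: (measurableT_comp mf measurable_snd).
split.
  have := measurable_inner_integral m1 (fun p => f0 p.2) => h.
  exact: (measurableT_comp h (@measurable_pair1 _ _ unit R tt)).
move=> ph; have := measurable_sphere_integrand m1 => h.
exact: (measurableT_comp h (@measurable_pair1 _ _ (unit * R)%type R (tt, ph))).
Qed.

Lemma sig2intD (f g : V3 R -> \bar R) : measurable_fun setT f -> measurable_fun setT g ->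
  (forall x, 0 <= f x) -> (forall x, 0 <= g x) ->
  sig2int (fun u => f u + g u) = sig2int f + sig2int g.
Proof.
move=> mf mg f0 g0; have [f1 f2] := measurable_inner_integral1 mf f0.
have [g1 g2] := measurable_inner_integral1 mg g0.
rewrite !sig2intE -ge0_muleDr; first last.
- by apply: integral_ge0 => ph _; exact: inner_ge0.
- by apply: integral_ge0 => ph _; exact: inner_ge0.
rewrite -ge0_integralD //; [|by move=> ph _; exact: inner_ge0|by move=> ph _; exact: inner_ge0].
congr (_ * _); apply: eq_integral => ph _.
rewrite -ge0_integralD //; [|by move=> th _; exact: weightE_ge0|exact: f2|by move=> th _; exact: weightE_ge0|exact: g2].
by apply: eq_integral => th _; rewrite ge0_muleDl.
Qed.

Lemma sig2intZ (k : R) (f : V3 R -> \bar R) : (0 <= k)%R -> measurable_fun setT f ->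
  (forall x, 0 <= f x) -> sig2int (fun u => k%:E * f u) = k%:E * sig2int f.
Proof.
move=> k0 mf f0; have [f1 f2] := measurable_inner_integral1 mf f0.
rewrite !sig2intE muleCA; congr (_ * _).
rewrite -ge0_integralZl_EFin //; last by move=> ph _; exact: inner_ge0.
apply: eq_integral => ph _.
rewrite -ge0_integralZl_EFin //; [|by move=> th _; exact: weightE_ge0|exact: f2].
by apply: eq_integral => th _; rewrite muleA.
Qed.

Lemma sig2int0 : sig2int (fun _ : V3 R => 0) = 0.
Proof.
rewrite sig2intE integral0_eq ?mule0 // => ph _; rewrite integral0_eq // => th _; by rewrite mul0e.
Qed.

Lemma sig2int_sum (I : Type) (s : seq I) (f : I -> V3 R -> \bar R) :
  (forall i, measurable_fun setT (f i)) -> (forall i x, 0 <= f i x) ->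
  sig2int (fun u => \sum_(i <- s) f i u) = \sum_(i <- s) sig2int (f i).
Proof.
move=> mf f0; elim: s => [|i s ih].
  rewrite big_nil; under eq_fun do rewrite big_nil.
  exact: sig2int0.
rewrite big_cons -ih -sig2intD //; last 2 first.
- exact: emeasurable_sum.
- by move=> x; exact: sume_ge0.
by under eq_fun do rewrite big_cons.
Qed.

Let aeF : Filter (nbhs (almost_everywhere leb)).
Proof. exact: ae_filter_ringOfSetsType. Qed.
#[local] Existing Instance aeF.

(** Almost every direction, in iterated form: it follows the nesting of the integrals in [sig2int],
    so exceptional sets need not be measurable on the sphere. *)
Definition aeS (Q : V3 R -> Prop) :=
  {ae leb, forall ph, {ae leb, forall th, (0 <= ph <= 2 * pi)%R -> (0 <= th <= pi)%R -> Q (sph th ph)}}.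

Lemma aeS_T (Q : V3 R -> Prop) : (forall u, dot u u = 1%R -> Q u) -> aeS Q.
Proof. by move=> h; apply: nearW => ph; apply: nearW => th _ _; apply: h; exact: sph_unit. Qed.

Lemma aeS_mono (Q Q' : V3 R -> Prop) : (forall u, Q u -> Q' u) -> aeS Q -> aeS Q'.
Proof.
move=> h; rewrite /aeS; apply: filterS => ph; apply: filterS => th q h1 h2.
by apply: h; exact: q.
Qed.

Lemma aeS_and (Q Q' : V3 R -> Prop) : aeS Q -> aeS Q' -> aeS (fun u => Q u /\ Q' u).
Proof.
rewrite /aeS; apply: filterS2 => ph; apply: filterS2 => th q q' h1 h2.
by split; [exact: q|exact: q'].
Qed.

Lemma aeS_all (T : eqType) (s : seq T) (Q : T -> V3 R -> Prop) :
  (forall i, i \in s -> aeS (Q i)) -> aeS (fun u => forall i, i \in s -> Q i u).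
Proof.
elim: s => [_|i s ih h]; first exact: aeS_T.
have hs j : j \in s -> aeS (Q j) by move=> js; apply: h; rewrite in_cons js orbT.
apply: aeS_mono (aeS_and (h i (mem_head _ _)) (ih hs)) => u [q qs] j.
by rewrite in_cons => /orP[/eqP->//|/qs].
Qed.

Lemma sig2int_le (f g : V3 R -> \bar R) : (forall x, 0 <= f x) -> (forall x, 0 <= g x) ->
  aeS (fun u => f u <= g u) -> sig2int f <= sig2int g.
Proof.
move=> f0 g0 fg; rewrite !sig2intE; apply: lee_wpmul2l; first by rewrite lee_fin cpi_ge0.
apply: ae_le_integral.
- by move=> ph; apply: integral_ge0 => th _; exact: weightE_ge0.
- by move=> ph; apply: integral_ge0 => th _; exact: weightE_ge0.
move: fg; rewrite /aeS; apply: filterS => ph h; apply: ae_le_integral => [th|th|]; try exact: weightE_ge0.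
move: h; apply: filterS => th; rewrite /weight !indicE.
case: (boolP (ph \in _)) => [phI|_]; last by rewrite mul0r !mule0.
case: (boolP (th \in _)) => [thI|_]; last by rewrite mul0r mulr0 !mule0.
have {}phI := set_mem phI; have {}thI := set_mem thI.
rewrite /= in_itv /= in phI; rewrite /= in_itv /= in thI.
by move=> /(_ phI thI) h'; apply: lee_wpmul2r => //; rewrite !mul1r lee_fin sin_ge0_pi.
Qed.

Lemma sig2int_ae_eq (f g : V3 R -> \bar R) : (forall x, 0 <= f x) -> (forall x, 0 <= g x) ->
  aeS (fun u => f u = g u) -> sig2int f = sig2int g.
Proof.
move=> f0 g0 fg; apply/eqP; rewrite eq_le !sig2int_le //; by apply: aeS_mono fg => u ->.
Qed.

Lemma finite_ae (P : R -> Prop) (s : seq R) : (forall x : R, ~ P x -> x \in s) -> {ae leb, forall x : R, P x}.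
Proof.
move=> h; exists [set` s]; split.
- elim: s {h} => [|y s ih].
    by rewrite (_ : [set` _] = set0) //; apply/seteqP; split=> z //=; rewrite in_nil.
  rewrite (_ : [set` _] = [set y] `|` [set` s]); last first.
    apply/seteqP; split=> z /=; rewrite in_cons.
      by case/orP => [/eqP->|]; [left|right].
    by case=> [->|->]; rewrite ?eqxx ?orbT.
  by apply: measurableU => //; exact: measurable_set1.
- exact: (countable_lebesgue_measure0 (finite_set_countable (finite_seq s))).
- by move=> x /= /h.
Qed.

(** Two zeros x0 and x satisfy [sin (x - x0) = 0], so they differ by a multiple of pi; on an
    interval of length 2 pi this leaves five candidates. *)
Lemma trig_zeros_ae (a b : R) : ((a != 0) || (b != 0))%R ->
  {ae leb, forall x : R, (0 <= x <= 2 * pi)%R -> (a * cos x + b * sin x != 0)%R}.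
Proof.
move=> ab.
have [[x0 x0I x00]|none] := pselect (exists2 x, (0 <= x <= 2 * pi)%R & (a * cos x + b * sin x = 0)%R); last first.
  apply: nearW => x xI; apply/eqP => h; apply: none; by exists x.
apply: (@finite_ae _ [:: x0; x0 - pi; x0 + pi; x0 - 2 * pi; x0 + 2 * pi]%R).
move=> x /not_implyP[xI] /negP; rewrite negbK => /eqP x1.
have s0 : sin (x - x0) = 0%R.
  rewrite sinB; have e1 : (a * (sin x * cos x0 - cos x * sin x0) = 0)%R.
    transitivity ((a * cos x0 + b * sin x0) * sin x - (a * cos x + b * sin x) * sin x0)%R; first by ring.
    by rewrite x00 x1; ring.
  have e2 : (b * (sin x * cos x0 - cos x * sin x0) = 0)%R.
    transitivity ((a * cos x + b * sin x) * cos x0 - (a * cos x0 + b * sin x0) * cos x)%R; first by ring.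
    by rewrite x00 x1; ring.
  by case/orP: ab => /mulfI inj; apply: inj; rewrite mulr0.
have p0 := @pi_gt0 R; rewrite !in_cons in_nil orbF.
have [d0|d0|d0] := ltrgtP (x - x0)%R 0%R.
- have [d1|d1|d1] := ltrgtP (x - x0)%R (- pi)%R.
  + have [d2|d2|d2] := ltrgtP (x - x0)%R (- (2 * pi))%R; first lra.
      have : (0 < sin (x - x0 + pi + pi))%R by apply: sin_gt0_pi; lra.
      by rewrite !sinDpi opprK s0 ltxx.
    by rewrite (_ : x = x0 - 2 * pi)%R ?eqxx ?orbT //; lra.
  + have : (0 < sin (- (x - x0)))%R by apply: sin_gt0_pi; lra.
    by rewrite sinN s0 oppr0 ltxx.
  + by rewrite (_ : x = x0 - pi)%R ?eqxx ?orbT //; lra.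
- have [d1|d1|d1] := ltrgtP (x - x0)%R pi.
  + have : (0 < sin (x - x0))%R by apply: sin_gt0_pi; lra.
    by rewrite s0 ltxx.
  + have [d2|d2|d2] := ltrgtP (x - x0)%R (2 * pi)%R; last 1 first.
    * by rewrite (_ : x = x0 + 2 * pi)%R ?eqxx ?orbT //; lra.
    * have : (0 < sin (x - x0 - pi))%R by apply: sin_gt0_pi; lra.
      by rewrite sinB s0 sinpi mul0r mulr0 subr0 ltxx.
    * lra.
  + by rewrite (_ : x = x0 + pi)%R ?eqxx ?orbT //; lra.
- by rewrite (_ : x = x0)%R ?eqxx //; lra.
Qed.

(** For fixed ph the product is c cos th + (a cos ph + b sin ph) sin th, with finitely many zeros in
    th unless both coefficients vanish; if c = 0 this happens for finitely many ph only. *)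
Lemma aeS_dot n : n <> zerov R -> aeS (fun u => dot u n != 0%R).
Proof.
case: n => [[a b] c] n0.
have p0 := @pi_gt0 R.
have inner ph : ((c != 0) || (a * cos ph + b * sin ph != 0))%R ->
    {ae leb, forall th : R, (0 <= ph <= 2 * pi)%R -> (0 <= th <= pi)%R -> dot (sph th ph) (a, b, c) != 0%R}.
  move=> h; apply: filterS (trig_zeros_ae h) => th hth _ thI.
  have : (0 <= th <= 2 * pi)%R by lra.
  move=> /hth; rewrite /dot /sph /=.
  by congr (~~ (_ == _)); ring.
have [c0|cN0] := eqVneq c 0%R; last by apply: nearW => ph; apply: inner; rewrite cN0.
have : ((a != 0) || (b != 0))%R.
  by rewrite -negb_and; apply: contra_notN n0 => /andP[/eqP-> /eqP->]; rewrite c0.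
move=> /trig_zeros_ae; apply: filterS => ph h.
have [phI|phI] := pselect (is_true (0 <= ph <= 2 * pi)%R); last by apply: nearW => th h1; case: phI.
by apply: inner; rewrite h ?orbT.
Qed.

(** The degenerate interval a = b is included because time 0 is allowed. *)
Lemma FTC_ge (f F : R -> R) (a b : R) : (a <= b)%R -> continuous f ->
  (forall x : R, is_derive x 1%R F (f x)) ->
  \int[leb]_(x in `[a, b]%classic) (f x)%:E = (F b - F a)%:E.
Proof.
rewrite le_eqVlt => /predU1P[->|ab] cf dF.
  by rewrite set_itv1 integral_set1 subrr.
have cF : continuous F by move=> x; apply/differentiable_continuous/derivable1_diffP.
rewrite (@continuous_FTC2 _ f F) //.
- exact: continuous_subspaceT.
- split.
  + by move=> x _.
  + by apply: cvg_at_right_filter; exact: cF.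
  + by apply: cvg_at_left_filter; exact: cF.
- by move=> x _; rewrite derive1E derive_val.
Qed.

Lemma sig2int_cst (c : R) : (0 <= c)%R -> sig2int (fun _ : V3 R => c%:E) = c%:E.
Proof.
move=> c0; rewrite /sig2int.
have dc (x : R) : is_derive x 1%R (fun x : R => - c * cos x)%R (c * sin x)%R.
  by apply: is_derive_eq (is_deriveZ (- c)%R (is_derive_cos x)) _; rewrite /GRing.scale /=; ring.
have cc : continuous (fun x : R => c * sin x)%R.
  by move=> x; apply: cvgM; [exact: cvg_cst|exact: continuous_sin].
have inner : \int[leb]_(th in `[0%R, pi%R]%classic) (c%:E * (sin th)%:E) = (2 * c)%:E.
  under eq_integral do rewrite -EFinM.
  rewrite (FTC_ge (@pi_ge0 R) cc dc) cospi cos0; congr (_%:E); ring.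
have d2 (x : R) : is_derive x 1%R (fun x : R => 2 * c * x)%R (2 * c)%R.
  by apply: is_derive_eq (is_deriveZ (2 * c)%R (is_derive_id x 1%R)) _; rewrite /GRing.scale /=; ring.
have c2 : continuous (fun _ : R => 2 * c)%R by move=> x; exact: cvg_cst.
transitivity ((4 * pi)^-1%:E * \int[leb]_(ph in `[0%R, (2 * pi)%R]%classic) (2 * c)%:E).
  by congr (_ * _); apply: eq_integral => ph _; exact: inner.
have p2 : (0 <= 2 * pi :> R)%R by rewrite mulr_ge0 // pi_ge0.
rewrite (FTC_ge p2 c2 d2) -EFinM; congr (_%:E).
have pN : (pi != 0 :> R)%R by rewrite gt_eqF // pi_gt0.
by move: (pi : R) pN => P PN; field.
Qed.

End SphereIntegralTheory.

(** * Great circles hitting a cell *)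

Section Hitting.
Variable R : realType.
Implicit Types (x y z u v n c w d : V3 R) (ns ms : seq (V3 R)).
Implicit Types (nss : seq (seq (V3 R))) (D : seq (V3 R)) (segs : seq (set (V3 R))).

(* A polygon met by a generic great circle v has a boundary point on it, which is the direction
   of v x n for some normal n: this makes "v hits the polygon" a finite, measurable condition. *)
Definition crit2 ns u v := cone ns (cross u v) || cone ns (negv (cross u v)).
Definition crit ns v := has (fun n => crit2 ns v n) ns.

(** A vector orthogonal to u and v equals its projection to their cross product. *)
Lemma cross_line u v x m : dot u x = 0 -> dot v x = 0 ->
  dot (cross u v) (cross u v) * dot m x = dot (cross u v) x * dot m (cross u v).
Proof.
move=> ux vx; have := cramer u v (cross u v) x m; rewrite ux vx !mul0r !add0r => <-.
by congr (_ * _); rewrite detC1 detC1.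
Qed.

Lemma crit2P ns u v x : cross u v <> zerov R -> x <> zerov R -> dot u x = 0 -> dot v x = 0 ->
  cone ns x -> crit2 ns u v.
Proof.
move=> k0 x0 ux vx cx; have kk := dotxx_gt0 k0.
have line m := cross_line m ux vx.
have [h|h] := lerP 0 (dot (cross u v) x); apply/orP; [left|right]; apply/coneP => m mns.
  have hx : 0 < dot (cross u v) x.
    rewrite lt_neqAle h andbT eq_sym; apply/eqP => e.
    have := line x; rewrite e mul0r => /eqP; rewrite mulf_eq0 gt_eqF //= dotxx_eq0 => /eqP; exact: x0.
  by rewrite -(pmulr_rge0 _ hx) -line mulr_ge0 // ?(coneP _ _ cx) // ltW.
rewrite dot_negr oppr_ge0 -(nmulr_rge0 _ h) -line mulr_ge0 // ?(coneP _ _ cx) // ltW //.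
Qed.

Lemma crit2_ex ns u v : cross u v <> zerov R -> crit2 ns u v ->
  exists x, [/\ x <> zerov R, dot u x = 0, dot v x = 0 & cone ns x].
Proof.
move=> k0 /orP[]h; [exists (cross u v)|exists (negv (cross u v))].
  by split; rewrite ?dot_crossl ?dot_crossr.
split; rewrite ?dot_negr ?dot_crossl ?dot_crossr ?oppr0 //.
by move=> /negv_eq; rewrite negv0.
Qed.

Lemma critP nss D ns v : good nss D -> generic D v -> ns \in nss -> crit ns v <-> hitc ns v.
Proof.
move=> g gv nsin; have [_ vc _] := gv; have sD := g_sub g nsin.
split.
  case/hasP => n nns /crit2_ex[|x [x0 vx _ cx]]; first exact: vc (sD _ nns).
  by exists x.
move=> hit; have [c [w [th1 [th2 sd]]]] := secdata_ex g gv nsin hit.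
have [n nns na] := sd_n1 sd; apply/hasP; exists n => //.
apply: (crit2P (vc _ (sD _ nns)) _ (dot_u_pt sd th1) na (end_cone sd).1).
exact: unit_neq0 (sphere_pt1 sd th1).
Qed.

Lemma hitsP ns u : hits (spoly ns) u <-> hitc ns u.
Proof.
split.
  by move=> [x [[sx ux] [_ cx]]]; exists x; split=> //; [exact: unit_neq0|rewrite dotC].
move=> [x [x0 ux cx]]; exists (normv x); have xx := normv1 x0; split; split=> //.
  by apply/eqP; rewrite dotC dot_normv_eq0 // ux.
by rewrite cone_normv.
Qed.

Lemma unit_orthogonal d : dot d d = 1 -> exists2 n, n <> zerov R & dot d n = 0.
Proof.
case: d => [[a b] c]; rewrite /dot /= => dd.
have [e|ne] := eqVneq ((b, - a, 0) : V3 R) (zerov R); last first.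
  by exists (b, - a, 0); [exact/eqP|rewrite /=; ring].
exists (1, 0, 0); first by move=> [/eqP]; rewrite oner_eq0.
by case: e => _ /eqP; rewrite oppr_eq0 /= => /eqP ->; ring.
Qed.

(** Every exceptional condition places u on a great circle: dependence on d forces u orthogonal to
    any n orthogonal to d, and a zero determinant makes u orthogonal to [cross d1 d2]. *)
Lemma aeS_generic D : genpos D -> aeS (generic D).
Proof.
move=> [Du Dc Dd].
have h1 d : d \in D -> aeS (fun u => dot u u = 1 -> cross u d <> zerov R).
  move=> dD; have [n n0 dn] := unit_orthogonal (Du _ dD).
  apply: aeS_mono (aeS_dot n0) => u /eqP un uu ud; apply: un.
  by have [e|e] := unit_cross0 uu (Du _ dD) ud; move: dn; rewrite e ?dot_negl // => /eqP; rewrite oppr_eq0 => /eqP.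
have h2 d1 : d1 \in D -> aeS (fun u => forall d2, d2 \in D -> apar d1 d2 -> det u d1 d2 != 0).
  move=> d1D; apply: aeS_all => d2 d2D.
  have [ap|nap] := boolP (apar d1 d2); last exact: aeS_T.
  by apply: aeS_mono (aeS_dot (Dc _ _ d1D d2D ap)) => u.
have h0 : aeS (fun u => dot u u = 1) by exact: aeS_T.
apply: aeS_mono (aeS_and h0 (aeS_and (aeS_all h1) (aeS_all h2))) => u [uu [k1 k2]].
by split=> // [d dD|d1 d2 h h']; [exact: k1|exact: k2].
Qed.

Definition generic_inv nss D u := generic D u /\ forall x, vtx nss x -> dot u x <> 0.

Lemma aeS_generic_inv nss segs D : tess_inv nss segs D -> aeS (generic_inv nss D).
Proof.
move=> I; have [VL [_ _ hV]] := inv_vtx I.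
apply: aeS_and; first exact: aeS_generic (g_gp (inv_good I)).
have : aeS (fun u => forall x, x \in VL -> dot u x != 0).
  by apply: aeS_all => x /hV[sx _]; apply: aeS_dot; exact: unit_neq0.
by apply: aeS_mono => u h x /hV /h /eqP.
Qed.

(** Inclusion-exclusion: v hits ns if and only if it hits one of the halves, and by convexity it
    hits both if and only if it hits their common side. *)
Lemma crit_split nss D ns u v nss' : good nss D -> generic D u -> ns \in nss -> hitc ns u ->
  refines nss ns u nss' -> generic (u :: negv u :: D) v ->
  (crit (u :: ns) v + crit (negv u :: ns) v = crit ns v + crit2 ns u v)%N.
Proof.
move=> g gu nsin hit ref gv'.
have g' := good_split g gu nsin hit ref.
have gv : generic D v.
  case: gv' => vv vc vd; split=> // [d dD|d1 d2 h1 h2].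
    by apply: vc; rewrite !inE dD !orbT.
  by apply: vd; rewrite !inE ?h1 ?h2 !orbT.
have in1 : u :: ns \in nss' by rewrite (mem_refines _ g ref) eqxx.
have in2 : negv u :: ns \in nss' by rewrite (mem_refines _ g ref) eqxx !orbT.
have P1 := critP g' gv' in1; have P2 := critP g' gv' in2; have P := critP g gv nsin.
have uv0 : cross u v <> zerov R.
  by rewrite crossC => /negv_eq; rewrite negv0; case: gv' => _ + _; apply; rewrite mem_head.
have i1 : crit (u :: ns) v -> crit ns v.
  by move=> /P1[x [x0 vx /= /andP[_ cx]]]; apply/P; exists x.
have i2 : crit (negv u :: ns) v -> crit ns v.
  by move=> /P2[x [x0 vx /= /andP[_ cx]]]; apply/P; exists x.
have i3 : crit ns v -> crit (u :: ns) v || crit (negv u :: ns) v.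
  move=> /P[x [x0 vx cx]]; have [ux|ux] := lerP 0 (dot u x); apply/orP; [left|right].
    by apply/P1; exists x; rewrite /= ux cx.
  by apply/P2; exists x; rewrite /= dot_negl oppr_ge0 ltW // cx.
have i4 : crit2 ns u v -> crit (u :: ns) v && crit (negv u :: ns) v.
  move=> /(crit2_ex uv0)[x [x0 ux vx cx]].
  apply/andP; split; [apply/P1|apply/P2]; exists x; split=> //=.
    by rewrite ux lexx.
  by rewrite dot_negl ux oppr0 lexx.
have i5 : crit (u :: ns) v -> crit (negv u :: ns) v -> crit2 ns u v.
  move=> /P1[x [x0 vx /= /andP[ux cx]]] /P2[y [y0 vy /= /andP[]]].
  rewrite dot_negl oppr_ge0 => uy cy.
  have [ux0|ux0] := eqVneq (dot u x) 0; first exact: (crit2P uv0 x0).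
  have {}ux : 0 < dot u x by rewrite lt_neqAle eq_sym ux0 ux.
  pose z := lin2 (- dot u y) (dot u x) x y.
  have cz : cone ns z by apply: cone_lin2; rewrite ?oppr_ge0 // ltW.
  have uz : dot u z = 0 by rewrite dot_lin2r; ring.
  have vz : dot v z = 0 by rewrite dot_lin2r vx vy; ring.
  (* The combination vanishes only if x and y are opposite. Then every normal of ns vanishes at x,
     which generic v allows for one normal at most; and a hemisphere contains one of any two
     opposite vectors. *)
  have [z0|/eqP z0] := eqVneq z (zerov R); last exact: (crit2P uv0 z0).
  have zero n : n \in ns -> dot n x = 0 \/ dot n x <> 0 by move=> _; apply: lem.
  have nx0 n : n \in ns -> 0 < dot n x -> dot n y < 0.
    move=> nns nx; have uy0 : dot u y < 0.
      rewrite lt_neqAle uy andbT; apply/eqP => uy0.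
      have : dot y z = 0 by rewrite z0 dot0r.
      rewrite dot_lin2r uy0 oppr0 mul0r add0r => /eqP; rewrite mulf_eq0 gt_eqF //= dotxx_eq0 => /eqP.
      exact: y0.
    have : dot n z = 0 by rewrite z0 dot0r.
    rewrite dot_lin2r => e; rewrite -(pmulr_rlt0 _ ux).
    have : 0 < - dot u y * dot n x by rewrite mulr_gt0 // oppr_gt0.
    by move=> h; vlra.
  have {}nx0 n : n \in ns -> dot n x = 0.
    move=> nns; apply/eqP; rewrite eq_le (coneP _ _ cx) // andbT leNgt; apply/negP => /(nx0 _ nns).
    by rewrite ltNge (coneP _ _ cy).
  have [c0 ic] := g_int g nsin.
  have ne := g_ne g nsin.
  case E : ns ne => [//|n [|m l]] _; last first.
    have nns : n \in ns by rewrite E mem_head.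
    have mns : m \in ns by rewrite E !inE eqxx orbT.
    have nm : n != m by have := g_un g nsin; rewrite E /= inE negb_or => /andP[/andP[]].
    have ap := icone_apar ic nns mns nm; have [_ _ vd] := gv.
    case: x0; apply: (det_orth0 (vd _ _ (g_sub g nsin nns) (g_sub g nsin mns) ap)) => //; exact: nx0.
  rewrite /crit2 /= !andbT dot_negr oppr_ge0; exact: le_total.
by case: (crit (u :: ns) v) (crit (negv u :: ns) v) (crit ns v) (crit2 ns u v) i1 i2 i3 i4 i5
  => [] [] [] [] //= i1 i2 i3 i4 i5; exfalso; do ?[by have := i1 isT|by have := i2 isT
  |by have := i3 isT|by have := i4 isT|by have := i5 isT isT].
Qed.

(** The circles of u and v meet in two antipodal points, which are on no circle of D. Each point
    lies in exactly one cell, and no cell contains both. *)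
Lemma crit2_sum nss D u v : good nss D -> generic D u -> generic (u :: negv u :: D) v ->
  (\sum_(ns <- nss) crit2 ns u v = 2)%N.
Proof.
move=> g gu gv'; pose z := cross u v.
have dz d : d \in D -> dot d z <> 0.
  move=> dD; have [_ _ vd] := gv'; have : det v u d != 0.
    apply: vd; rewrite ?inE ?eqxx ?dD ?orbT //; exact: generic_apar gu dD.
  by rewrite detC2 detC1 detC1 /det -/z => h e; move: h; rewrite e oppr0 eqxx.
have nz ns n : ns \in nss -> n \in ns -> dot n z <> 0.
  by move=> h /(g_sub g h) /dz.
have one y : (forall ns n, ns \in nss -> n \in ns -> dot n y <> 0) -> count (fun ns => cone ns y) nss = 1%N.
  move=> ny; have [ns nsin cy] := g_cover g y.
  rewrite (@eq_in_count _ _ (pred1 ns)); first by rewrite count_uniq_mem ?(g_uniq g) // nsin.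
  move=> ms min /=; apply/idP/eqP => [cm|->//].
  apply: contrapT => hN; have [n nns e] := common_boundary g min nsin hN cm cy.
  exact: (ny _ _ min nns).
have c1 := one z nz.
have c2 : count (fun ns => cone ns (negv z)) nss = 1%N.
  apply: one => ns n h h'; rewrite dot_negr => /eqP; rewrite oppr_eq0 => /eqP; exact: nz h h'.
have both : count (predI (fun ns => cone ns z) (fun ns => cone ns (negv z))) nss = 0%N.
  rewrite (@eq_in_count _ _ pred0) ?count_pred0 // => ns nsin /=.
  apply/negbTE/negP => /andP[/coneP h1 /coneP h2].
  have := g_ne g nsin; case E : ns => [//|n l] _.
  have nns : n \in ns by rewrite E mem_head.
  apply: (nz _ _ nsin nns); apply/eqP; rewrite eq_le h1 // andbT.
  by have := h2 _ nns; rewrite dot_negr oppr_ge0.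
have := count_predUI (fun ns => cone ns z) (fun ns => cone ns (negv z)) nss.
rewrite both addn0 c1 c2 => e; rewrite -[RHS]e -sum1_count [RHS]big_mkcond /=.
by apply: eq_bigr => ns _; rewrite /crit2 -/z; case: ifP.
Qed.

End Hitting.

(** * Measurable families of cells *)

Section MeasurableFamilies.
Variable R : realType.

Section Fixed.
Context d (W : measurableType d).

Lemma measurable_coords (h : W -> V3 R) : measurable_fun setT h ->
  [/\ measurable_fun setT (fun w => (h w).1.1), measurable_fun setT (fun w => (h w).1.2) &
    measurable_fun setT (fun w => (h w).2)].
Proof.
move=> mh; split.
- exact: (measurableT_comp measurable_fst (measurableT_comp measurable_fst mh)).
- exact: (measurableT_comp measurable_snd (measurableT_comp measurable_fst mh)).
- exact: (measurableT_comp measurable_snd mh).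
Qed.

Lemma measurable_dot (f g : W -> V3 R) : measurable_fun setT f -> measurable_fun setT g ->
  measurable_fun setT (fun w => dot (f w) (g w)).
Proof.
move=> /measurable_coords[f1 f2 f3] /measurable_coords[g1 g2 g3].
by apply: measurable_funD; [apply: measurable_funD|]; exact: measurable_funM.
Qed.

Lemma measurable_cross (f g : W -> V3 R) : measurable_fun setT f -> measurable_fun setT g ->
  measurable_fun setT (fun w => cross (f w) (g w)).
Proof.
move=> /measurable_coords[f1 f2 f3] /measurable_coords[g1 g2 g3].
by apply: measurable_fun_pair => /=; [apply: measurable_fun_pair => /=|];
  apply: measurable_funB; exact: measurable_funM.
Qed.

Lemma measurable_negv (f : W -> V3 R) : measurable_fun setT f -> measurable_fun setT (fun w => negv (f w)).
Proof.
move=> /measurable_coords[f1 f2 f3].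
by apply: measurable_fun_pair => /=; [apply: measurable_fun_pair => /=|];
  apply: measurableT_comp (@oppr_measurable _ _) _.
Qed.

Lemma measurable_all (b : nat -> W -> bool) k : (forall j, measurable_fun setT (b j)) ->
  measurable_fun setT (fun w => all (fun j => b j w) (iota 0 k)).
Proof.
move=> mb; elim: k 0%N => [|k ih] m /=; first exact: measurable_cst.
exact: measurable_and (mb m) (ih m.+1).
Qed.

Lemma measurable_has (b : nat -> W -> bool) k : (forall j, measurable_fun setT (b j)) ->
  measurable_fun setT (fun w => has (fun j => b j w) (iota 0 k)).
Proof.
move=> mb; elim: k 0%N => [|k ih] m /=; first exact: measurable_cst.
exact: measurable_or (mb m) (ih m.+1).
Qed.

(* A family of seqs counts as measurable when the lengths are constant and the entries are measurable;
   no sigma-algebra on seqs is needed. *)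
Definition mcell (ns : W -> seq (V3 R)) := (exists k, forall w, size (ns w) = k) /\
  forall j, measurable_fun setT (fun w => nth (zerov R) (ns w) j).

Definition mcells (nss : W -> seq (seq (V3 R))) := (exists sh, forall w, map size (nss w) = sh) /\
  forall i j, measurable_fun setT (fun w => nth (zerov R) (nth [::] (nss w) i) j).

Lemma measurable_cone ns (v : W -> V3 R) : mcell ns -> measurable_fun setT v ->
  measurable_fun setT (fun w => cone (ns w) (v w)).
Proof.
move=> [[k sk] mn] mv.
rewrite (_ : (fun w => _) = fun w => all (fun j => 0 <= dot (nth (zerov R) (ns w) j) (v w)) (iota 0 k)).
  by apply: measurable_all => j; apply: measurable_fun_ler => //; exact: measurable_dot.
apply/funext => w; rewrite /cone -(sk w) -[in LHS](mkseq_nth (zerov R) (ns w)) /mkseq all_map.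
by apply: eq_all.
Qed.

Lemma measurable_crit2 ns (u v : W -> V3 R) : mcell ns -> measurable_fun setT u ->
  measurable_fun setT v -> measurable_fun setT (fun w => crit2 (ns w) (u w) (v w)).
Proof.
move=> mn mu mv; have mc := measurable_cross mu mv.
by apply: measurable_or; apply: measurable_cone => //; exact: measurable_negv.
Qed.

Lemma measurable_crit ns (v : W -> V3 R) : mcell ns -> measurable_fun setT v ->
  measurable_fun setT (fun w => crit (ns w) (v w)).
Proof.
move=> mns mv; have [[k sk] mn] := mns.
rewrite (_ : (fun w => _) = fun w => has (fun j => crit2 (ns w) (v w) (nth (zerov R) (ns w) j)) (iota 0 k)).
  by apply: measurable_has => j; exact: measurable_crit2.
apply/funext => w; rewrite /crit -(sk w) -[X in has _ X = _](mkseq_nth (zerov R) (ns w)) /mkseq has_map.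
by apply: eq_has.
Qed.

Lemma measurable_natr (b : W -> bool) : measurable_fun setT b ->
  measurable_fun setT (fun w => ((b w)%:R : R)%:E).
Proof.
move=> mb; apply/measurable_EFinP.
rewrite (_ : (fun w => _) = fun w => if b w then 1 else 0 : R).
  by apply: measurable_fun_ifT.
by apply/funext => w; case: (b w).
Qed.

Lemma mcells_nth nss i : mcells nss -> mcell (fun w => nth [::] (nss w) i).
Proof.
move=> [[sh hs] mn]; split=> [|j]; last exact: mn.
exists (nth 0%N sh i) => w; rewrite -(hs w).
have [h|h] := ltnP i (size (nss w)); first by rewrite (nth_map [::]).
by rewrite !nth_default // size_map.
Qed.

Lemma mcell_cons ns (u : W -> V3 R) : mcell ns -> measurable_fun setT u ->
  mcell (fun w => u w :: ns w).
Proof.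
move=> [[k hk] mn] mu; split; first by exists k.+1 => w /=; rewrite hk.
by case=> [|j] /=.
Qed.

Lemma mcells_splitn nss i (u : W -> V3 R) : mcells nss -> measurable_fun setT u ->
  (forall w, (i < size (nss w))%N) -> mcells (fun w => splitn (nss w) i (u w)).
Proof.
move=> mn mu hi; have [[sh hs] mnth] := mn; have mi := mcells_nth i mn; split.
  have [[k hk] _] := mi; exists (take i sh ++ [:: k.+1; k.+1] ++ drop i.+1 sh) => w.
  by rewrite /splitn !map_cat /= map_take map_drop hs hk.
move=> i' j; have st w : size (take i (nss w)) = i by rewrite size_takel // ltnW.
have [lt|] := ltnP i' i.
  rewrite (_ : (fun w => _) = fun w => nth (zerov R) (nth [::] (nss w) i') j); first exact: mnth.
  by apply/funext => w; rewrite /splitn nth_cat st lt nth_take.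
move=> le; have E w : nth [::] (splitn (nss w) i (u w)) i' =
    nth [::] ([:: u w :: nth [::] (nss w) i; negv (u w) :: nth [::] (nss w) i] ++ drop i.+1 (nss w)) (i' - i).
  by rewrite /splitn nth_cat st ltnNge le.
under eq_fun do rewrite E.
case: (i' - i)%N => [|[|k]] /=.
- have [_ h] := mcell_cons mi mu; exact: h.
- have [_ h] := mcell_cons mi (measurable_negv mu); exact: h.
- by under eq_fun do rewrite nth_drop; exact: mnth.
Qed.

Lemma mcells_size nss : mcells nss -> exists k, forall w, size (nss w) = k.
Proof. by move=> [[sh hs] _]; exists (size sh) => w; rewrite -(hs w) size_map. Qed.

End Fixed.

Lemma mcells_comp d d' (W : measurableType d) (W' : measurableType d') (f : W' -> W)
  (nss : W -> seq (seq (V3 R))) : measurable_fun setT f -> mcells nss -> mcells (fun w => nss (f w)).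
Proof.
move=> mf [[sh hs] mn]; split; first by exists sh => w; rewrite hs.
by move=> i j; exact: (measurableT_comp (mn i j) mf).
Qed.

Lemma mcells_cst d (W : measurableType d) nss : mcells (fun _ : W => nss).
Proof. by split; [exists (map size nss)|move=> i j; exact: measurable_cst]. Qed.

End MeasurableFamilies.

(** * The jump chain on encoded tessellations *)

Section JumpOperator.
Variable R : realType.
Notation leb := (@lebesgue_measure R).
Implicit Types (u v : V3 R) (t s : R).
Local Open Scope ereal_scope.

(* [locked] keeps unification from unfolding the integrals. *)
Definition tauC : seq (V3 R) -> \bar R :=
  locked (fun ns => sig2int (fun u => ((crit ns u)%:R : R)%:E)).

Lemma tauCE ns : tauC ns = sig2int (fun u => ((crit ns u)%:R : R)%:E).
Proof. by rewrite /tauC -lock. Qed.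

Definition rateC (nss : seq (seq (V3 R))) : R := (\sum_(ns <- nss) fine (tauC ns))%R.

Definition jumpC (g : seq (seq (V3 R)) -> \bar R) (nss : seq (seq (V3 R))) : \bar R :=
  \sum_(0 <= i < size nss)
    sig2int (fun u => ((crit (nth [::] nss i) u)%:R : R)%:E * g (splitn nss i u)).

Definition firstjump (g : R -> seq (seq (V3 R)) -> \bar R) t nss : \bar R :=
  \int[leb]_(s in `[0%R, t]%classic) ((expR (- (rateC nss * s)))%:E * jumpC (g (t - s)%R) nss).

Lemma EFin_bool_ge0 (b : bool) : 0 <= ((b%:R : R)%:E).
Proof. by rewrite lee_fin. Qed.

Lemma jumpC_ge0 g nss : (forall ms, 0 <= g ms) -> 0 <= jumpC g nss.
Proof.
move=> g0; apply: sume_ge0 => i _; apply: sig2int_ge0 => u; exact: mule_ge0 (EFin_bool_ge0 _) (g0 _).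
Qed.

Lemma firstjump_ge0 g t nss : (forall s ms, 0 <= g s ms) -> 0 <= firstjump g t nss.
Proof.
move=> g0; apply: integral_ge0 => s _; apply: mule_ge0; first by rewrite lee_fin expR_ge0.
exact: jumpC_ge0.
Qed.

(** Quantified over all parameter spaces, because each application of [firstjump] adds a jump time
    and a split direction to the parameters. *)
Record regular (g : R -> seq (seq (V3 R)) -> \bar R) : Prop := Regular {
  reg_ge0 : forall t nss, 0 <= g t nss;
  reg_meas : forall d (W : measurableType d) (tau : W -> R) (nss : W -> seq (seq (V3 R))),
    measurable_fun setT tau -> mcells nss -> measurable_fun setT (fun w => g (tau w) (nss w)) }.

Section Family.
Context d (W : measurableType d) (nss : W -> seq (seq (V3 R))).
Hypothesis mn : mcells nss.

Lemma measurable_crit_nth i :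
  measurable_fun setT (fun p : W * V3 R => ((crit (nth [::] (nss p.1) i) p.2)%:R : R)%:E).
Proof.
apply/measurable_natr/measurable_crit; last exact: measurable_snd.
exact: mcells_nth (mcells_comp measurable_fst mn).
Qed.

Lemma measurable_rateC : measurable_fun setT (fun w => rateC (nss w)).
Proof.
have [k hk] := mcells_size mn; rewrite /rateC.
rewrite (_ : (fun w => _) = fun w => \sum_(0 <= i < k) fine (tauC (nth [::] (nss w) i)))%R; last first.
  by apply/funext => w; rewrite (big_nth [::]) hk.
apply: measurable_sum => i; apply: (measurableT_comp (@fine_measurable _ _ measurableT)).
under eq_fun do rewrite tauCE.
exact: (measurable_sig2int (measurable_crit_nth i) (fun p => EFin_bool_ge0 _)).
Qed.

Lemma measurable_split_integrand g (tau : W -> R) i : regular g -> measurable_fun setT tau ->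
  (forall w, (i < size (nss w))%N) ->
  measurable_fun setT (fun p : W * V3 R =>
    ((crit (nth [::] (nss p.1) i) p.2)%:R : R)%:E * g (tau p.1) (splitn (nss p.1) i p.2)).
Proof.
move=> rg mt hi; apply: emeasurable_funM; first exact: measurable_crit_nth.
apply: (reg_meas rg); first exact: (measurableT_comp mt measurable_fst).
by apply: mcells_splitn => //; exact: mcells_comp measurable_fst mn.
Qed.

Lemma measurable_jumpC g (tau : W -> R) : regular g -> measurable_fun setT tau ->
  measurable_fun setT (fun w => jumpC (g (tau w)) (nss w)).
Proof.
move=> rg mt; have [k hk] := mcells_size mn; rewrite /jumpC.
under eq_fun do rewrite hk big_mkord.
apply: emeasurable_sum => i.
apply: (measurable_sig2int (f := fun p => ((crit (nth [::] (nss p.1) i) p.2)%:R : R)%:E *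
    g (tau p.1) (splitn (nss p.1) i p.2))).
  by apply: (measurable_split_integrand rg mt) => w; rewrite hk.
by move=> p /=; apply: mule_ge0; [exact: EFin_bool_ge0|exact: reg_ge0 rg _ _].
Qed.

End Family.

Lemma regular_firstjump g : regular g -> regular (firstjump g).
Proof.
move=> rg; split=> [t nss|d W tau nss mt mn].
  by apply: firstjump_ge0 => s ms; exact: reg_ge0 rg _ _.
(* The moving upper limit of integration is absorbed into the integrand, so that the integral runs
   over a fixed space. *)
pose h (p : W * R) := (if (0 <= p.2)%R && (p.2 <= tau p.1)%R then
  (expR (- (rateC (nss p.1) * p.2)))%:E * jumpC (g (tau p.1 - p.2)%R) (nss p.1) else 0).
have mt1 : measurable_fun setT (fun p : W * R => tau p.1) by exact: (measurableT_comp mt measurable_fst).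
have mn1 : mcells (fun p : W * R => nss p.1) by exact: mcells_comp measurable_fst mn.
have mh : measurable_fun setT h.
  apply: measurable_fun_ifT.
  - by apply: measurable_and; apply: measurable_fun_ler => //; exact: measurable_snd.
  - apply: emeasurable_funM.
      apply/measurable_EFinP; apply: (measurableT_comp (@measurable_expR R)).
      apply: (measurableT_comp (@oppr_measurable _ _)); apply: measurable_funM.
        exact: measurable_rateC mn1.
      exact: measurable_snd.
    apply: (measurable_jumpC mn1 rg (tau := fun p => tau p.1 - p.2)%R).
    by apply: measurable_funB => //; exact: measurable_snd.
  - exact: measurable_cst.
have h0 p : 0 <= h p.
  rewrite /h; case: ifP => // _; apply: mule_ge0; first by rewrite lee_fin expR_ge0.
  by apply: jumpC_ge0 => ms; exact: reg_ge0 rg _ _.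
have := @measurable_fun_fubini_tonelli_F _ _ W _ _ leb h mh h0.
congr (measurable_fun _ _); apply/funext => w; rewrite /fubini_F /firstjump [RHS]integral_mkcond.
apply: eq_integral => s _; rewrite /h patchE /=.
have -> : (s \in (`[0%R, tau w]%classic : set R)) = (0 <= s)%R && (s <= tau w)%R.
  by rewrite mem_setE in_itv.
by [].
Qed.

Lemma measurable_split_integrand1 g t nss i : regular g -> (i < size nss)%N ->
  measurable_fun setT (fun u => ((crit (nth [::] nss i) u)%:R : R)%:E * g t (splitn nss i u)).
Proof.
move=> rg hi.
have := measurable_split_integrand (mcells_cst unit nss) (tau := fun=> t) rg (measurable_cst _) (fun=> hi).
by move=> h; exact: (measurableT_comp h (@measurable_pair1 _ _ unit _ tt)).
Qed.

Lemma jumpCD g1 g2 t nss : regular g1 -> regular g2 ->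
  jumpC (fun ms => g1 t ms + g2 t ms) nss = jumpC (g1 t) nss + jumpC (g2 t) nss.
Proof.
move=> r1 r2; rewrite /jumpC !big_mkord -big_split /=; apply: eq_bigr => i _.
rewrite -sig2intD.
- congr sig2int; apply/funext => u.
  by rewrite ge0_muleDr //; [exact: reg_ge0 r1 _ _|exact: reg_ge0 r2 _ _].
- exact: measurable_split_integrand1.
- exact: measurable_split_integrand1.
- by move=> u; apply: mule_ge0; [exact: EFin_bool_ge0|exact: reg_ge0 r1 _ _].
- by move=> u; apply: mule_ge0; [exact: EFin_bool_ge0|exact: reg_ge0 r2 _ _].
Qed.

Lemma measurable_firstjump_integrand g t nss : regular g ->
  measurable_fun setT (fun s : R => (expR (- (rateC nss * s)))%:E * jumpC (g (t - s)%R) nss).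
Proof.
move=> rg; apply: emeasurable_funM.
  apply/measurable_EFinP; apply: (measurableT_comp (@measurable_expR R)).
  by apply: (measurableT_comp (@oppr_measurable _ _)); apply: measurable_funM.
by apply: (measurable_jumpC (mcells_cst R nss)) => //; exact: measurable_funB.
Qed.

Lemma firstjumpD g1 g2 t nss : regular g1 -> regular g2 ->
  firstjump (fun s ms => g1 s ms + g2 s ms) t nss = firstjump g1 t nss + firstjump g2 t nss.
Proof.
move=> r1 r2; have j0 g s : regular g -> 0 <= jumpC (g s) nss.
  by move=> rg; apply: jumpC_ge0 => ms; exact: reg_ge0 rg _ _.
have e0 s g r : regular g -> 0 <= (expR (- (rateC nss * s)))%:E * jumpC (g r) nss.
  by move=> rg; apply: mule_ge0; [rewrite lee_fin expR_ge0|exact: j0].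
rewrite /firstjump -ge0_integralD //.
- apply: eq_integral => s _; rewrite -ge0_muleDr ?j0 //; congr (_ * _); exact: jumpCD.
- by move=> s _; exact: e0.
- by apply: measurable_funTS; exact: measurable_firstjump_integrand.
- by move=> s _; exact: e0.
- by apply: measurable_funTS; exact: measurable_firstjump_integrand.
Qed.

Lemma regularD g1 g2 : regular g1 -> regular g2 -> regular (fun s ms => g1 s ms + g2 s ms).
Proof.
move=> r1 r2; split=> [t nss|d W tau nss mt mn].
  by apply: adde_ge0; [exact: reg_ge0 r1 _ _|exact: reg_ge0 r2 _ _].
by apply: emeasurable_funD; [exact: reg_meas r1 _ _ _ _ mt mn|exact: reg_meas r2 _ _ _ _ mt mn].
Qed.

(** Such a function is constant along a measurable family, whose lengths do not vary. *)
Definition shapely (F : seq (seq (V3 R)) -> nat) :=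
  forall nss nss', map size nss = map size nss' -> F nss = F nss'.

Fixpoint PnC (F : seq (seq (V3 R)) -> nat) n t nss : \bar R :=
  if n is n'.+1 then firstjump (PnC F n') t nss
  else (expR (- (rateC nss * t)) * (F nss)%:R)%:E.

Lemma regular_PnC F n : shapely F -> regular (PnC F n).
Proof.
move=> sF; elim: n => [|n ih]; last exact: regular_firstjump.
split=> [t nss|d W tau nss mt mn] /=; first by rewrite lee_fin mulr_ge0 ?expR_ge0.
apply/measurable_EFinP; apply: measurable_funM.
  apply: (measurableT_comp (@measurable_expR R)).
  by apply: (measurableT_comp (@oppr_measurable _ _)); apply: measurable_funM => //; exact: measurable_rateC.
have [[sh hs] _] := mn.
(* The constant value is read off at a point of W, so an empty W is treated apart. *)
have [[w0 _]|nW] := pselect (exists w : W, True).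
  rewrite (_ : (fun w => _) = cst (F (nss w0))%:R) //.
  by apply/funext => w /=; congr (_%:R); apply: sF; rewrite !hs.
rewrite (_ : (fun w => _) = cst 0%R) //.
by apply/funext => w; case: nW; exists w.
Qed.

End JumpOperator.

(** * Transfer to encoded tessellations and the splitting rates *)

Section Rates.
Variable R : realType.
Implicit Types (u v : V3 R) (r s t : R) (ns ms : seq (V3 R)) (nss : seq (seq (V3 R))).
Implicit Types (D : seq (V3 R)) (segs : seq (set (V3 R))).
Local Open Scope ereal_scope.

Lemma indic_hits nss D ns u : good nss D -> ns \in nss -> generic D u ->
  (\1_(hits (spoly ns)) u : R) = (crit ns u)%:R.
Proof.
move=> g nsin gu; rewrite indicE; congr (nat_of_bool _)%:R; apply/idP/idP.
  by move=> /set_mem /hitsP h; apply/(critP g gu nsin).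
by move=> /(critP g gu nsin) /hitsP h; apply: mem_set.
Qed.

Lemma tau_hitE nss D ns : good nss D -> ns \in nss -> tau_hit (spoly ns) = tauC ns.
Proof.
move=> g nsin; rewrite tauCE; apply: sig2int_ae_eq => [u|u|].
- by rewrite lee_fin indicE.
- exact: EFin_bool_ge0.
- by apply: aeS_mono (aeS_generic (g_gp g)) => u gu; rewrite (indic_hits g).
Qed.

Lemma rateE nss segs D : good nss D -> rate (mktess nss segs) = rateC nss.
Proof.
move=> g; rewrite /rate /rateC big_map big_seq [RHS]big_seq; apply: eq_bigr => ns nsin.
by rewrite (tau_hitE g).
Qed.

Lemma split_mktess nss segs i u : (i < size nss)%N ->
  Defs.split (mktess nss segs) i u =
  mktess (splitn nss i u) (rcons segs (spoly (nth [::] nss i) `&` gc u)).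
Proof.
have P1 ns : spoly ns `&` hemi_p u = spoly (u :: ns).
  apply/seteqP; split=> x; rewrite /spoly /hemi_p /= => -[].
    by move=> [sx cx] [_ ux]; split=> //; rewrite dotC ux.
  by move=> sx /andP[ux cx]; split; split=> //; rewrite dotC.
have P2 ns : spoly ns `&` hemi_m u = spoly (negv u :: ns).
  apply/seteqP; split=> x; rewrite /spoly /hemi_m /= dot_negl oppr_ge0 => -[].
    by move=> [sx cx] [_ ux]; split=> //; rewrite dotC ux.
  by move=> sx /andP[ux cx]; split; split=> //; rewrite dotC.
move=> hi; rewrite /Defs.split /mktess /= (nth_map [::]) // P1 P2.
by rewrite /splitn !map_cat map_take map_drop.
Qed.

Lemma tess_inv_splitn nss segs D i u : tess_inv nss segs D -> generic_inv nss D u ->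
  (i < size nss)%N -> crit (nth [::] nss i) u ->
  tess_inv (splitn nss i u) (rcons segs (spoly (nth [::] nss i) `&` gc u)) (u :: negv u :: D).
Proof.
move=> I [gu vu] hi cr; have nsin : nth [::] nss i \in nss by exact: mem_nth.
apply: (inv_split I gu vu nsin); last exact: perm_splitn.
by apply/(critP (inv_good I) gu nsin).
Qed.

Lemma Pn_ge0 (f : tess R -> \bar R) n t T : (forall T, 0 <= f T) -> 0 <= Pn f n t T.
Proof.
move=> f0; elim: n t T => [|n ih] t T /=; first by apply: mule_ge0; rewrite // lee_fin expR_ge0.
apply: integral_ge0 => s _; apply: mule_ge0; first by rewrite lee_fin expR_ge0.
apply: sume_ge0 => i _; apply: sig2int_ge0 => u; exact: mule_ge0.
Qed.

Lemma PnC_ge0 F n t nss : 0 <= PnC F n t nss.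
Proof.
elim: n t nss => [|n ih] t nss /=; first by rewrite lee_fin mulr_ge0 // expR_ge0.
exact: firstjump_ge0.
Qed.

(* The indicator of [hits] may be replaced by the measurable [crit] since they agree for almost
   all great circles at each step, and lower integrals do not see null sets. *)
Lemma PnE (f : tess R -> \bar R) (F : seq (seq (V3 R)) -> nat) n t nss segs D :
  (forall T, 0 <= f T) ->
  (forall nss segs D, tess_inv nss segs D -> f (mktess nss segs) = ((F nss)%:R : R)%:E) ->
  tess_inv nss segs D -> Pn f n t (mktess nss segs) = PnC F n t nss.
Proof.
move=> f0 fF; elim: n t nss segs D => [|n ih] t nss segs D I /=.
  by rewrite (rateE _ (inv_good I)) (fF _ _ _ I) EFinM.
rewrite /firstjump (rateE _ (inv_good I)); apply: eq_integral => s _; congr (_ * _).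
rewrite /jump /jumpC big_mkord size_map; apply: eq_bigr => -[i hi] _ /=.
apply: sig2int_ae_eq => [u|u|].
- by apply: mule_ge0; [rewrite lee_fin indicE|exact: Pn_ge0].
- by apply: mule_ge0; [exact: EFin_bool_ge0|exact: PnC_ge0].
apply: aeS_mono (aeS_generic_inv I) => u gu; have [gu1 _] := gu.
rewrite (nth_map [::]) // (indic_hits (inv_good I)) ?mem_nth //.
case: (boolP (crit _ _)) => [cr|_]; last by rewrite !mul0e.
by rewrite split_mktess // (ih _ _ _ _ (tess_inv_splitn I gu hi cr)).
Qed.

Lemma tauC_fin ns : tauC ns \is a fin_num.
Proof.
rewrite tauCE ge0_fin_numE; last by apply: sig2int_ge0 => u; exact: EFin_bool_ge0.
apply: (@le_lt_trans _ _ (sig2int (fun _ : V3 R => 1%:E))).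
  apply: sig2int_le => [u|u|]; [exact: EFin_bool_ge0|by []|].
  by apply: aeS_T => u _; rewrite lee_fin; case: (crit _ _); rewrite ?ler01.
by rewrite sig2int_cst // ltry.
Qed.

Lemma fine_tauC_ge0 ns : (0 <= fine (tauC ns))%R.
Proof. by rewrite tauCE; apply: fine_ge0; apply: sig2int_ge0 => u; exact: EFin_bool_ge0. Qed.

Lemma fine_tauC_le1 ns : (fine (tauC ns) <= 1)%R.
Proof.
rewrite -lee_fin fineK ?tauC_fin // tauCE -(@sig2int_cst R 1) //.
apply: sig2int_le => [u|u|]; [exact: EFin_bool_ge0|by rewrite lee_fin|].
by apply: aeS_T => u _; rewrite lee_fin; case: (crit _ _); rewrite ?ler01.
Qed.

Lemma rateC_ge0 nss : (0 <= rateC nss)%R.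
Proof. by apply: sumr_ge0 => ns _; exact: fine_tauC_ge0. Qed.

Lemma rateC_le_size nss : (rateC nss <= (size nss)%:R)%R.
Proof.
rewrite /rateC -sum1_size natr_sum; apply: ler_sum => ns _; exact: fine_tauC_le1.
Qed.

(* The measure of the great circles through a point of the cell ns on the great circle of u. *)
Definition cutE : seq (V3 R) -> V3 R -> \bar R :=
  locked (fun ns u => sig2int (fun v => ((crit2 ns u v)%:R : R)%:E)).

Lemma cutEE ns u : cutE ns u = sig2int (fun v => ((crit2 ns u v)%:R : R)%:E).
Proof. by rewrite /cutE -lock. Qed.

Lemma cutE_ge0 ns u : 0 <= cutE ns u.
Proof. by rewrite cutEE; apply: sig2int_ge0 => v; exact: EFin_bool_ge0. Qed.

Lemma cutE_fin ns u : cutE ns u \is a fin_num.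
Proof.
rewrite ge0_fin_numE ?cutE_ge0 // cutEE.
apply: (@le_lt_trans _ _ (sig2int (fun _ : V3 R => 1%:E))).
  apply: sig2int_le => [v|v|]; [exact: EFin_bool_ge0|by []|].
  by apply: aeS_T => v _; rewrite lee_fin; case: (crit2 _ _ _); rewrite ?ler01.
by rewrite sig2int_cst // ltry.
Qed.

Lemma mcell_cst d (W : measurableType d) ns : mcell (fun _ : W => ns).
Proof. by split; [exists (size ns)|move=> j; exact: measurable_cst]. Qed.

Lemma measurable_crit1 ns : measurable_fun setT (fun u => ((crit ns u)%:R : R)%:E).
Proof. by apply/measurable_natr/measurable_crit => //; exact: mcell_cst. Qed.

Lemma measurable_crit21 ns u : measurable_fun setT (fun v => ((crit2 ns u v)%:R : R)%:E).
Proof. by apply/measurable_natr/measurable_crit2 => //; exact: mcell_cst. Qed.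

Lemma measurable_cutE ns : measurable_fun setT (cutE ns).
Proof.
rewrite (_ : cutE ns = fun u => cutE ns u) //; under eq_fun do rewrite cutEE.
apply: (measurable_sig2int (f := fun p => ((crit2 ns p.1 p.2)%:R : R)%:E)) => [|p]; last exact: EFin_bool_ge0.
by apply/measurable_natr/measurable_crit2; [exact: mcell_cst|exact: measurable_fst|exact: measurable_snd].
Qed.

Lemma tauC_split nss D ns u nss' : good nss D -> generic D u -> ns \in nss -> hitc ns u ->
  refines nss ns u nss' -> tauC (u :: ns) + tauC (negv u :: ns) = tauC ns + cutE ns u.
Proof.
move=> g gu nsin hit ref; rewrite !tauCE cutEE -!sig2intD; do ?exact: measurable_crit1;
  do ?exact: measurable_crit21; do ?by move=> v; exact: EFin_bool_ge0.
apply: sig2int_ae_eq => [v|v|]; do ?by rewrite adde_ge0 ?EFin_bool_ge0.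
apply: aeS_mono (aeS_generic (genpos_cons (g_gp g) gu)) => v gv.
by rewrite -!EFinD -!natrD (crit_split g gu nsin hit ref gv).
Qed.

Lemma cutE_miss nss D ns u : good nss D -> generic D u -> ns \in nss -> ~~ crit ns u -> cutE ns u = 0.
Proof.
move=> g gu nsin ncr; rewrite cutEE -(@sig2int0 R); apply: sig2int_ae_eq => [v|//|]; first exact: EFin_bool_ge0.
apply: aeS_mono (aeS_generic (genpos_cons (g_gp g) gu)) => v [_ vc _].
case: (boolP (crit2 _ _ _)) => // c2; case/negP: ncr; apply/(critP g gu nsin).
have uv0 : cross u v <> zerov R.
  by rewrite crossC => /negv_eq; rewrite negv0; apply: vc; rewrite mem_head.
by have [x [x0 ux vx cx]] := crit2_ex uv0 c2; exists x.
Qed.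

(** For almost all pairs u, v the count [crit2_sum] is 2; both integrations are over probability
    measures. *)
Lemma cutE_sum nss D : good nss D -> \sum_(ns <- nss) sig2int (cutE ns) = 2%:E.
Proof.
move=> g; rewrite -sig2int_sum; [|exact: measurable_cutE|exact: cutE_ge0].
rewrite -(@sig2int_cst R 2) //; apply: sig2int_ae_eq => [u|u|].
- by apply: sume_ge0 => ns _; exact: cutE_ge0.
- by rewrite lee_fin.
apply: aeS_mono (aeS_generic (g_gp g)) => u gu.
under eq_bigr do rewrite cutEE.
rewrite -sig2int_sum; [|by move=> ns; exact: measurable_crit21|by move=> ns v; exact: EFin_bool_ge0].
rewrite -(@sig2int_cst R 2) //; apply: sig2int_ae_eq => [v|v|].
- by apply: sume_ge0 => ns _; exact: EFin_bool_ge0.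
- by rewrite lee_fin.
apply: aeS_mono (aeS_generic (genpos_cons (g_gp g) gu)) => v gv.
by rewrite sumEFin -natr_sum (crit2_sum g gu gv).
Qed.

Lemma tauC_hemi (n : V3 R) : tauC [:: n] = 1%:E.
Proof.
have cr u : crit [:: n] u.
  have e : dot n (cross u n) = 0%R := dot_crossr u n.
  by rewrite /crit /crit2 /= e lexx.
rewrite tauCE -(@sig2int_cst R 1) //; congr sig2int; apply/funext => u; by rewrite cr.
Qed.

End Rates.

(** * The first-jump equation *)

Section Dynkin.
Variable R : realType.
Implicit Types (u v : V3 R) (r s t : R) (ns ms : seq (V3 R)) (nss : seq (seq (V3 R))).
Implicit Types (D : seq (V3 R)) (segs : seq (set (V3 R))).
Variables A B C : nat.

Definition objF nss : nat := (A * (size nss - 2) + B + C * nhemi nss)%N.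

Definition meanF t nss : R :=
  A%:R * ((size nss - 2)%:R + rateC nss * t + t ^+ 2) + B%:R + C%:R * (nhemi nss)%:R * expR (- t).

Lemma meanF_ge0 t nss : 0 <= t -> 0 <= meanF t nss.
Proof.
move=> t0; rewrite /meanF !addr_ge0 // ?mulr_ge0 // ?expR_ge0 // !addr_ge0 ?sqr_ge0 //.
by rewrite mulr_ge0 // rateC_ge0.
Qed.

Lemma meanF0 nss : meanF 0 nss = (objF nss)%:R.
Proof. by rewrite /meanF /objF !natrD !natrM oppr0 expR0 expr0n /=; ring. Qed.

Lemma rateC_splitn nss segs D i u : tess_inv nss segs D -> generic_inv nss D u -> (i < size nss)%N ->
  crit (nth [::] nss i) u ->
  rateC (splitn nss i u) = rateC nss + fine (cutE (nth [::] nss i) u).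
Proof.
move=> I [gu vu] hi cr; set ns := nth [::] nss i in cr *.
have g := inv_good I; have nsin : ns \in nss by exact: mem_nth.
have hit : hitc ns u by apply/(critP g gu nsin).
have ref : refines nss ns u (splitn nss i u) := perm_splitn u hi.
have := congr1 fine (tauC_split g gu nsin hit ref).
rewrite (fineD (tauC_fin (u :: ns)) (tauC_fin (negv u :: ns))) (fineD (tauC_fin ns) (cutE_fin ns u)).
rewrite /rateC (perm_big _ ref) (perm_big _ (perm_to_rem nsin)) !big_cons /=.
move: (fine (tauC (u :: ns))) (fine (tauC (negv u :: ns))) (fine (tauC ns)) (fine (cutE ns u)) => a b c d.
by rewrite addrA => ->; rewrite addrAC.
Qed.

Local Open Scope ereal_scope.

(** The right-hand side is the rate times [meanF r] plus the derivative of [meanF] in time: the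
    candidate solves the backward equation of the process. *)
Lemma jumpC_meanF nss segs D r : tess_inv nss segs D -> (0 <= r)%R ->
  jumpC (fun nss' => (meanF r nss')%:E) nss =
  (rateC nss * meanF r nss + A%:R * (rateC nss + 2 * r) - C%:R * (nhemi nss)%:R * expR (- r))%:E.
Proof.
move=> I r0; have g := inv_good I.
(* The value of [meanF] after a split of ns, except for the increase of the rate, which contributes
   [A%:R * r] times [cutE ns u]. *)
pose K (ns : seq (V3 R)) : R := (A%:R * ((size nss - 2)%:R + 1 + rateC nss * r + r ^+ 2) + B%:R +
  C%:R * ((nhemi nss)%:R - (size ns == 1)%:R) * expR (- r))%R.
have hK ns : ns \in nss -> ((size ns == 1)%:R <= (nhemi nss)%:R :> R)%R.
  move=> nsin; rewrite ler_nat /nhemi; case: eqP => // s1; rewrite -has_count.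
  by apply/hasP; exists ns => //; apply/eqP.
have K0 ns : ns \in nss -> (0 <= K ns)%R.
  move=> /hK h; rewrite /K !addr_ge0 //.
    by rewrite mulr_ge0 // !addr_ge0 ?sqr_ge0 // mulr_ge0 // rateC_ge0.
  by rewrite !mulr_ge0 ?expR_ge0 // subr_ge0.
have Ar0 : (0 <= A%:R * r)%R by rewrite mulr_ge0.
have main i : (i < size nss)%N ->
    sig2int (fun u => ((crit (nth [::] nss i) u)%:R : R)%:E * (meanF r (splitn nss i u))%:E) =
    (K (nth [::] nss i) * fine (tauC (nth [::] nss i)))%:E + (A%:R * r)%:E * sig2int (cutE (nth [::] nss i)).
  move=> hi; have nsin : nth [::] nss i \in nss by exact: mem_nth.
  have mK : measurable_fun setT (fun u => (K (nth [::] nss i))%:E * ((crit (nth [::] nss i) u)%:R : R)%:E).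
    by apply: emeasurable_funM => //; exact: measurable_crit1.
  have mc : measurable_fun setT (fun u => (A%:R * r)%:E * cutE (nth [::] nss i) u).
    by apply: emeasurable_funM => //; exact: measurable_cutE.
  have k0 u : 0 <= (K (nth [::] nss i))%:E * ((crit (nth [::] nss i) u)%:R : R)%:E.
    by apply: mule_ge0; [rewrite lee_fin K0|exact: EFin_bool_ge0].
  have c0 u : 0 <= (A%:R * r)%:E * cutE (nth [::] nss i) u.
    by apply: mule_ge0; [rewrite lee_fin|exact: cutE_ge0].
  transitivity (sig2int (fun u => (K (nth [::] nss i))%:E * ((crit (nth [::] nss i) u)%:R : R)%:E +
     (A%:R * r)%:E * cutE (nth [::] nss i) u)).
    apply: sig2int_ae_eq => [u|u|].
    - by apply: mule_ge0; [exact: EFin_bool_ge0|rewrite lee_fin meanF_ge0].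
    - exact: adde_ge0.
    apply: aeS_mono (aeS_generic_inv I) => u gu; have [gu1 _] := gu.
    (* The factor [crit] may be dropped from the second term, since [cutE] vanishes when the circle
       of u misses the cell. *)
    case: (boolP (crit _ _)) => cr; last by rewrite mul0e mule0 (cutE_miss g gu1 nsin cr) mule0 adde0.
    rewrite -(fineK (cutE_fin _ u)) mul1e mule1 -EFinM -EFinD; congr (_%:E).
    have hit : hitc (nth [::] nss i) u by apply/(critP g gu1 nsin).
    have ref : refines nss (nth [::] nss i) u (splitn nss i u) := perm_splitn u hi.
    rewrite /meanF (rateC_splitn I gu hi cr) (size_refines nsin ref) subSn ?(inv_size I) //.
    rewrite /K -(nhemi_refines g nsin ref) -natr1 natrD.
    by ring.
  rewrite sig2intD // sig2intZ; [|exact: K0|exact: measurable_crit1|by move=> u; exact: EFin_bool_ge0].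
  rewrite sig2intZ //; [|exact: measurable_cutE|exact: cutE_ge0].
  by rewrite -tauCE (EFinM (K _)) fineK // tauC_fin.
transitivity (\sum_(0 <= i < size nss) ((K (nth [::] nss i) * fine (tauC (nth [::] nss i)))%:E +
    (A%:R * r)%:E * sig2int (cutE (nth [::] nss i)))).
  by apply: eq_big_nat => i /andP[_ hi]; exact: main.
rewrite -(big_nth [::] xpredT (fun ns => (K ns * fine (tauC ns))%:E + (A%:R * r)%:E * sig2int (cutE ns))).
rewrite big_split /= sumEFin -ge0_sume_distrr; last by move=> ns _; apply: sig2int_ge0 => u; exact: cutE_ge0.
rewrite (cutE_sum g) -EFinM -EFinD; congr (_%:E).
(* Every great circle hits a hemisphere, so each hemisphere is split at rate 1. *)
have hemi : (\sum_(ns <- nss) (size ns == 1)%:R * fine (tauC ns) = (nhemi nss)%:R :> R)%R.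
  rewrite /nhemi -sum1_count natr_sum [RHS]big_mkcond /=; apply: eq_bigr => ns _.
  case: eqP => [|_]; last by rewrite mul0r.
  by case: ns => [|n []] // _; rewrite tauC_hemi mul1r.
transitivity ((A%:R * ((size nss - 2)%:R + 1 + rateC nss * r + r ^+ 2) + B%:R + C%:R * (nhemi nss)%:R * expR (- r)) * rateC nss
  - C%:R * expR (- r) * (nhemi nss)%:R + A%:R * r * 2)%R; last by rewrite /meanF; ring.
congr (_ + _)%R.
have E ns : (K ns * fine (tauC ns) = (A%:R * ((size nss - 2)%:R + 1 + rateC nss * r + r ^+ 2) + B%:R +
    C%:R * (nhemi nss)%:R * expR (- r)) * fine (tauC ns) -
    C%:R * expR (- r) * ((size ns == 1)%:R * fine (tauC ns)))%R by rewrite /K; ring.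
by under eq_bigr do rewrite E; rewrite sumrB -!mulr_sumr hemi.
Qed.

End Dynkin.

Section Primitive.
Variable R : realType.
Variables L n a b c t : R.

Let U (r : R) := a * (n + L * r + r ^+ 2) + b + c * expR (- r).

Lemma is_derive_sub (s : R) : is_derive s 1 (fun x : R => t - x) (- 1).
Proof.
by apply: is_derive_eq (is_deriveB (is_derive_cst t s 1) (is_derive_id s 1)) _; rewrite sub0r.
Qed.

Lemma is_derive_expRM (k s : R) : is_derive s 1 (fun x : R => expR (k * x)) (k * expR (k * s)).
Proof.
have d : is_derive s 1 (fun x : R => k * x) k.
  by apply: is_derive_eq (is_deriveZ k (is_derive_id s 1)) _; rewrite /GRing.scale /= mulr1.
by apply: is_derive_eq (is_derive1_comp (is_derive_expR (k * s)) d) _; rewrite mulrC.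
Qed.

(** U plays the part of the mean. Because U solves the backward equation, the integrand of the
    first-jump equation is an exact derivative. *)
Lemma is_derive_primitive (s : R) :
  is_derive s 1 (fun x : R => - (expR (- (L * x)) * U (t - x)))
    (expR (- (L * s)) * (L * U (t - s) + a * (L + 2 * (t - s)) - c * expR (- (t - s)))).
Proof.
have d1 := is_derive_sub s.
have d2 : is_derive s 1 (fun x : R => (t - x) * (t - x)) (- 2 * (t - s)).
  by apply: is_derive_eq (is_deriveM d1 d1) _; rewrite /GRing.scale /=; ring.
have d3 : is_derive s 1 (fun x : R => expR (- t) * expR (1 * x)) (expR (- t) * expR (1 * s)).
  by apply: is_derive_eq (is_deriveZ (expR (- t)) (is_derive_expRM 1 s)) _; rewrite /GRing.scale /=; ring.
have d4 : is_derive s 1 (fun x : R => n + (L * (t - x) + (t - x) * (t - x))) (- L - 2 * (t - s)).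
  apply: is_derive_eq (is_deriveD (is_derive_cst n s 1) (is_deriveD (is_deriveZ L d1) d2)) _.
  by rewrite /GRing.scale /=; ring.
have d5 : is_derive s 1 (fun x : R => a * (n + (L * (t - x) + (t - x) * (t - x))) + (b + c * (expR (- t) * expR (1 * x))))
    (a * (- L - 2 * (t - s)) + c * (expR (- t) * expR (1 * s))).
  apply: is_derive_eq (is_deriveD (is_deriveZ a d4) (is_deriveD (is_derive_cst b s 1) (is_deriveZ c d3))) _.
  by rewrite /GRing.scale /=; ring.
have d6 := is_derive_expRM (- L) s.
have := is_deriveN (is_deriveM d6 d5).
have eU x : a * (n + (L * (t - x) + (t - x) * (t - x))) + (b + c * (expR (- t) * expR (1 * x))) = U (t - x).
  by rewrite /U mul1r -expRD opprB (addrC (- t)); ring.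
have -> : (- ((fun x : R => expR (- L * x)) * (fun x : R => a * (n + (L * (t - x) + (t - x) * (t - x))) +
   (b + c * (expR (- t) * expR (1 * x))))))%R = (fun x : R => - (expR (- (L * x)) * U (t - x))).
  by apply/funext => x; rewrite -eU -(mulNr L x).
move=> h; apply: is_derive_eq h _; rewrite /GRing.scale /=.
rewrite eU mul1r -expRD opprB (addrC (- t)) mulNr; ring.
Qed.

Lemma continuous_primitive : continuous (fun s : R =>
  expR (- (L * s)) * (L * U (t - s) + a * (L + 2 * (t - s)) - c * expR (- (t - s)))).
Proof.
move=> s.
have c1 : {for s, continuous (fun x : R => t - x)} by apply: cvgB; [exact: cvg_cst|exact: cvg_id].
have c2 : {for s, continuous (fun x : R => expR (- (t - x)))}.
  by apply: (cvg_comp _ expR (cvgN c1)); exact: continuous_expR.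
have c3 : {for s, continuous (fun x : R => U (t - x))}.
  rewrite /U; apply: cvgD; last by apply: cvgM; [exact: cvg_cst|exact: c2].
  apply: cvgD; last exact: cvg_cst.
  apply: cvgM; first exact: cvg_cst.
  apply: cvgD; last by rewrite expr2; under eq_fun do rewrite expr2; exact: (cvgM c1 c1).
  apply: cvgD; first exact: cvg_cst.
  by apply: cvgM; [exact: cvg_cst|exact: c1].
apply: cvgM.
  have cL : {for s, continuous (fun x : R => - (L * x))}.
    by apply: cvgN; apply: cvgM; [exact: cvg_cst|exact: cvg_id].
  by apply: (cvg_comp _ expR cL); exact: continuous_expR.
apply: cvgB; last by apply: cvgM; [exact: cvg_cst|exact: c2].
apply: cvgD; first by apply: cvgM; [exact: cvg_cst|exact: c3].
apply: cvgM; first exact: cvg_cst.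
apply: cvgD; first exact: cvg_cst.
by apply: cvgM; [exact: cvg_cst|exact: c1].
Qed.

End Primitive.

Section Renewal.
Variable R : realType.
Implicit Types (u v : V3 R) (r s t : R) (nss : seq (seq (V3 R))).
Implicit Types (D : seq (V3 R)) (segs : seq (set (V3 R))).
Variables A B C : nat.
Notation F := (@objF R A B C).
Notation mean := (@meanF R A B C).
Local Open Scope ereal_scope.

(** The primitive is evaluated at both ends: s = 0 gives the mean at time t, and s = t gives the
    term for no split, as the mean at time 0 is [objF]. *)
Lemma firstjump_mean nss segs D t : tess_inv nss segs D -> (0 <= t)%R ->
  firstjump (fun s nss' => (mean s nss')%:E) t nss =
  (mean t nss - expR (- (rateC nss * t)) * (F nss)%:R)%:E.
Proof.
move=> I t0; pose L := rateC nss; pose n : R := (size nss - 2)%:R.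
pose c : R := (C%:R * (nhemi nss)%:R)%R.
have ft := FTC_ge t0 (@continuous_primitive R L n A%:R B%:R c t) (@is_derive_primitive R L n A%:R B%:R c t).
transitivity ((- (expR (- (L * t)) * mean (t - t) nss) - - (expR (- (L * 0)) * mean (t - 0) nss))%R)%:E; last first.
  by rewrite subrr subr0 meanF0 mulr0 oppr0 expR0 mul1r opprK addrC.
rewrite /mean -ft; apply: eq_integral => s /set_mem /=; rewrite in_itv /= => /andP[s0 st].
by rewrite (jumpC_meanF _ _ _ I) ?subr_ge0 // -EFinM.
Qed.

(** The comparison is required only after a generic split, where the invariant persists and there is
    one more cell; measurability of g1 and g2 plays no part, by monotonicity of lower integrals. *)
Lemma firstjump_le (g1 g2 : R -> seq (seq (V3 R)) -> \bar R) t nss segs D : tess_inv nss segs D ->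
  (forall s nss', (0 <= s)%R -> 0 <= g1 s nss') -> (forall s nss', (0 <= s)%R -> 0 <= g2 s nss') ->
  (forall s nss' segs' D', (0 <= s <= t)%R -> size nss' = (size nss).+1 -> tess_inv nss' segs' D' ->
    g1 s nss' <= g2 s nss') ->
  firstjump g1 t nss <= firstjump g2 t nss.
Proof.
move=> I g10 g20 g12; have e0 (x : R) : 0 <= (expR x)%:E by rewrite lee_fin expR_ge0.
apply: le_lower_integral => s /=; rewrite in_itv /= => sI.
  apply: mule_ge0 => //; apply: jumpC_ge0 => ms; apply: g10.
  by case/andP: sI => _ st; rewrite subr_ge0.
apply: (lee_wpmul2l (e0 _)); rewrite /jumpC !big_nat; apply: lee_sum => i /andP[_ hi].
have ts : (0 <= t - s)%R by case/andP: sI => _ st; rewrite subr_ge0.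
apply: sig2int_le => [u|u|].
- by apply: mule_ge0; [exact: EFin_bool_ge0|exact: g10].
- by apply: mule_ge0; [exact: EFin_bool_ge0|exact: g20].
apply: aeS_mono (aeS_generic_inv I) => u gu.
case: (boolP (crit _ _)) => [cr|_]; last by rewrite !mul0e.
have I' := tess_inv_splitn I gu hi cr.
rewrite !mul1e; apply: g12 I'; first by case/andP: sI => ? ?; lra.
exact: size_refines (mem_nth _ hi) (perm_splitn u hi).
Qed.

Definition partialE k t nss := \sum_(0 <= n < k) PnC (R := R) F n t nss.

Lemma shapely_objF : shapely (@objF R A B C).
Proof.
move=> nss nss' e; have sz : size nss = size nss' by rewrite -(size_map size nss) e size_map.
have hm : nhemi nss = nhemi nss'.
  by rewrite /nhemi -!(count_map size (pred1 1%N)) e.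
by rewrite /objF sz hm.
Qed.

Lemma partialE_recr k : partialE k.+1 = fun t nss => partialE k t nss + PnC (R := R) F k t nss.
Proof. by apply/funext => s; apply/funext => ms; rewrite /partialE big_nat_recr. Qed.

Lemma regular_partialE k : regular (partialE k).
Proof.
elim: k => [|k ih].
  split=> [t nss|d W tau nss mt mn]; first by rewrite /partialE big_geq.
  rewrite /partialE; under eq_fun do rewrite big_geq //; exact: measurable_cst.
rewrite partialE_recr; exact: regularD ih (regular_PnC k shapely_objF).
Qed.

(** Decomposition at the first split. Additivity of the integrals rests on the regularity of the
    partial sums. *)
Lemma partialES k t nss : partialE k.+1 t nss = PnC F 0 t nss + firstjump (partialE k) t nss.
Proof.
elim: k => [|k ih].
  rewrite /partialE big_nat1; rewrite /firstjump integral0_eq ?adde0 // => s _.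
  rewrite (_ : jumpC _ nss = 0) ?mule0 // /jumpC big1 // => i _.
  rewrite (_ : (fun u => _) = fun=> 0) ?sig2int0 //.
  by apply/funext => u; rewrite big_geq ?mule0.
have -> : partialE k.+2 t nss = partialE k.+1 t nss + firstjump (PnC F k) t nss.
  exact: (congr1 (fun f => f t nss) (partialE_recr k.+1)).
rewrite ih -addeA; congr (_ + _).
rewrite -(firstjumpD t nss (regular_partialE k) (regular_PnC k shapely_objF)).
by rewrite -partialE_recr.
Qed.

End Renewal.

(** * Convergence of the jump series *)

Section Mean.
Variable R : realType.
Notation leb := (@lebesgue_measure R).
Implicit Types (u v : V3 R) (r s t : R) (nss : seq (seq (V3 R))).
Implicit Types (D : seq (V3 R)) (segs : seq (set (V3 R))).
Variables A B C : nat.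
Notation F := (@objF R A B C).
Notation mean := (@meanF R A B C).
Notation partialE := (@partialE R A B C).
Local Open Scope ereal_scope.

Lemma partialE_le_mean k t nss segs D : tess_inv nss segs D -> (0 <= t)%R ->
  partialE k t nss <= (mean t nss)%:E.
Proof.
elim: k t nss segs D => [|k ih] t nss segs D I t0.
  by rewrite /partialE big_geq // lee_fin meanF_ge0.
have -> : (mean t nss)%:E = PnC F 0 t nss + firstjump (fun s nss' => (mean s nss')%:E) t nss.
  by rewrite (firstjump_mean _ _ _ I) //= -EFinD addrC subrK.
rewrite partialES; apply: leeD; [exact: lexx|apply: (firstjump_le I)].
- by move=> s nss' _; exact: (reg_ge0 (regular_partialE R A B C k)).
- by move=> s nss' s0; rewrite lee_fin meanF_ge0.
- by move=> s nss' segs' D' /andP[s0 _] _ I'; exact: ih I' s0.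
Qed.

Variable T : R.
Hypothesis T0 : (0 <= T)%R.

(** Chosen so that the mean is at most M N at all times up to T, using L <= N and H <= N. *)
Let M : R := (A%:R * (1 + T + T ^+ 2) + B%:R + C%:R)%R.

Lemma M_ge0 : (0 <= M)%R.
Proof. by rewrite /M !addr_ge0 // mulr_ge0 // !addr_ge0 // sqr_ge0. Qed.

(* The process with N cells splits at rate at most N, so N (N + 1) exp (2 t) dominates the
   expectation of N (N + 1); the remainder after k splits gains the factor 1 / (N + k + 1). *)
Definition err k t (N : nat) : R := (M * (N%:R * N.+1%:R) / (N + k).+1%:R * expR (2 * t))%R.

Lemma err_ge0 k t N : (0 <= err k t N)%R.
Proof. by rewrite /err mulr_ge0 ?expR_ge0 // divr_ge0 // mulr_ge0 ?M_ge0. Qed.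

Lemma mean_le_err0 t nss : (0 < size nss)%N -> (0 <= t <= T)%R ->
  (mean t nss <= err 0 t (size nss))%R.
Proof.
move=> N1 /andP[t0 tT].
have e1 : (1 <= expR (2 * t))%R by rewrite -expR0 ler_expR mulr_ge0.
have hN : ((nhemi nss)%:R <= (size nss)%:R :> R)%R by rewrite ler_nat count_size.
have sN : ((size nss - 2)%:R <= (size nss)%:R :> R)%R by rewrite ler_nat leq_subr.
have N1r : (1 <= (size nss)%:R :> R)%R by rewrite ler1n.
have rt : (rateC nss * t <= (size nss)%:R * T)%R by apply: ler_pM; rewrite ?rateC_ge0 ?rateC_le_size.
have t2 : (t ^+ 2 <= (size nss)%:R * T ^+ 2)%R.
  apply: (@le_trans _ _ (T ^+ 2)%R); first by rewrite lerXn2r // nnegrE.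
  by rewrite ler_peMl // sqr_ge0.
have ex1 : (expR (- t) <= 1)%R by rewrite -expR0 ler_expR; lra.
have -> : err 0 t (size nss) = (M * (size nss)%:R * expR (2 * t))%R.
  by rewrite /err addn0 (mulrA M) mulfK ?pnatr_eq0.
apply: (@le_trans _ _ (M * (size nss)%:R)%R); last by rewrite ler_peMr // mulr_ge0 // M_ge0.
rewrite /M /meanF !mulrDl; apply: lerD; first apply: lerD.
- rewrite -mulrA; apply: ler_wpM2l => //; nra.
- by rewrite ler_peMr.
- by rewrite -mulrA; apply: ler_wpM2l => //; apply: le_trans hN; rewrite ler_piMr.
Qed.

Lemma regular_err k : regular (fun s nss => (err k s (size nss))%:E).
Proof.
split=> [t nss|d W tau nss mt mn]; first by rewrite lee_fin err_ge0.
have [n hn] := mcells_size mn; under eq_fun do rewrite hn.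
apply/measurable_EFinP; rewrite /err; apply: measurable_funM => //.
by apply: (measurableT_comp (@measurable_expR R)); exact: measurable_funM.
Qed.

Lemma jumpC_err k r nss : (0 < size nss)%N ->
  jumpC (fun nss' => (err k r (size nss'))%:E) nss = (err k r (size nss).+1 * rateC nss)%:E.
Proof.
move=> N1; rewrite /jumpC.
transitivity (\sum_(0 <= i < size nss) (err k r (size nss).+1 * fine (tauC (nth [::] nss i)))%:E).
  apply: eq_big_nat => i /andP[_ hi].
  rewrite EFinM (fineK (tauC_fin _)) tauCE.
  rewrite -(sig2intZ (err_ge0 _ _ _) (measurable_crit1 _) (fun u => EFin_bool_ge0 R _)).
  congr sig2int; apply/funext => u; rewrite muleC.
  by rewrite (size_refines (mem_nth _ hi) (perm_splitn u hi)).
by rewrite -(big_nth [::] xpredT (fun ns => (err k r (size nss).+1 * fine (tauC ns))%:E)) sumEFin mulr_sumr.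
Qed.

(** The denominators agree, because a split turns N into N + 1 and uses up one step of k. What
    remains compares L (N + 2) with N (L + 2), that is, L with N. *)
Lemma firstjump_err k t nss : (0 < size nss)%N -> (0 <= t)%R ->
  firstjump (fun s nss' => (err k s (size nss'))%:E) t nss <= (err k.+1 t (size nss))%:E.
Proof.
move=> N1 t0; pose L := rateC nss; pose N : R := (size nss)%:R.
pose K : R := (M * (N * (size nss).+1%:R) / (size nss + k).+2%:R * expR (2 * t))%R.
have K0 : (0 <= K)%R by rewrite /K mulr_ge0 ?expR_ge0 // divr_ge0 // !mulr_ge0 // M_ge0.
have L0 : (0 <= L)%R := rateC_ge0 nss.
have LN : (L <= N)%R := rateC_le_size nss.
(* A multiple of the exponential density of rate L + 2, so its integral up to t is at most K; the 2
   comes from the factor exp (2 (t - s)). *)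
pose f (s : R) : R := (K * (L + 2) * expR (- (L + 2) * s))%R.
have dF (s : R) : is_derive s 1%R (fun x : R => - K * expR (- (L + 2) * x))%R (f s).
  apply: is_derive_eq (is_deriveZ (- K)%R (is_derive_expRM (- (L + 2))%R s)) _.
  by rewrite /f /GRing.scale /=; ring.
have cf : continuous f.
  move=> s; apply: cvgM; first exact: cvg_cst.
  have c1 : {for s, continuous (fun x : R => - (L + 2) * x)%R} by apply: cvgM; [exact: cvg_cst|exact: cvg_id].
  by apply: (cvg_comp _ expR c1); exact: continuous_expR.
have := FTC_ge t0 cf dF => ft.
apply: (@le_trans _ _ (\int[leb]_(s in `[0%R, t]%classic) (f s)%:E)); last first.
  rewrite ft lee_fin mulr0 expR0 mulr1 /err addnS -/N -/K.
  by rewrite opprK mulNr addrC gerBl mulr_ge0 // expR_ge0.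
apply: le_lower_integral => s /=; rewrite in_itv /= => /andP[s0 st].
  apply: mule_ge0; first by rewrite lee_fin expR_ge0.
  by apply: jumpC_ge0 => ms; rewrite lee_fin err_ge0.
rewrite jumpC_err // -EFinM lee_fin /f /K /err -/L addSn.
have -> : expR (2 * (t - s)) = (expR (2 * t) * expR (- 2 * s))%R by rewrite -expRD; congr expR; ring.
have -> : expR (- (L + 2) * s) = (expR (- (L * s)) * expR (- 2 * s))%R by rewrite -expRD; congr expR; ring.
set e1 := expR (2 * t); set e2 := expR (- 2 * s); set e3 := expR (- (L * s)).
have e10 : (0 <= e1)%R by exact: expR_ge0.
have e20 : (0 <= e2)%R by exact: expR_ge0.
have e30 : (0 <= e3)%R by exact: expR_ge0.
pose P : R := (M * (size nss).+1%:R / (size nss + k).+2%:R * e1 * e2 * e3)%R.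
have P0 : (0 <= P)%R by rewrite /P !mulr_ge0 // ?invr_ge0 // M_ge0.
have n2 : ((size nss).+2%:R = N + 2 :> R)%R by rewrite -addn2 natrD.
have key : ((size nss).+2%:R * L <= N * (L + 2))%R by rewrite n2; nra.
have -> : (e3 * (M * ((size nss).+1%:R * (size nss).+2%:R) / (size nss + k).+2%:R * (e1 * e2) * L) =
  P * ((size nss).+2%:R * L))%R by rewrite /P; ring.
have -> : (M * (N * (size nss).+1%:R) / (size nss + k).+2%:R * e1 * (L + 2) * (e3 * e2) =
  P * (N * (L + 2)))%R by rewrite /P; ring.
exact: ler_wpM2l.
Qed.

Lemma mean_le_partialE k t nss segs D : tess_inv nss segs D -> (0 <= t <= T)%R ->
  (mean t nss)%:E <= partialE k t nss + (err k t (size nss))%:E.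
Proof.
elim: k t nss segs D => [|k ih] t nss segs D I tI; have N1 := ltnW (inv_size I).
  by rewrite /partialE big_geq // add0e lee_fin mean_le_err0.
have [t0 tT] := andP tI.
have -> : (mean t nss)%:E = PnC F 0 t nss + firstjump (fun s nss' => (mean s nss')%:E) t nss.
  by rewrite (firstjump_mean _ _ _ I) //= -EFinD addrC subrK.
have r1 := regular_partialE R A B C k; have r2 := regular_err k.
rewrite partialES -addeA; apply: leeD; first exact: lexx.
apply: (@le_trans _ _ (firstjump (partialE k) t nss +
    firstjump (fun s nss' => (err k s (size nss'))%:E) t nss)); last first.
  by apply: leeD; [exact: lexx|exact: firstjump_err].
rewrite -(firstjumpD t nss r1 r2); apply: (firstjump_le I).
- by move=> s nss' s0; rewrite lee_fin meanF_ge0.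
- by move=> s nss' _; apply: adde_ge0; [exact: (reg_ge0 r1)|exact: (reg_ge0 r2)].
- by move=> s nss' segs' D' /andP[s0 st] _ I'; apply: ih I' _; rewrite s0 (le_trans st).
Qed.

End Mean.

Section Explicit.
Variable R : realType.
Local Open Scope ereal_scope.

Lemma mean_series (A B C : nat) (t : R) nss segs D : tess_inv nss segs D -> (0 <= t)%R ->
  \sum_(0 <= n <oo) PnC (objF A B C) n t nss = (meanF A B C t nss)%:E.
Proof.
move=> I t0; have g0 n : 0 <= PnC (objF A B C) n t nss.
  by apply: (reg_ge0 (regular_PnC n (@shapely_objF R A B C))).
apply/eqP; rewrite eq_le; apply/andP; split.
  apply: lime_le; first exact: is_cvg_nneseries.
  by apply: nearW => k; exact: partialE_le_mean I t0.
set S := \sum_(0 <= n <oo) _.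
have part k : partialE A B C k t nss <= S.
  by apply: nneseries_lim_ge => n _ _; exact: g0.
apply/lee_addgt0Pr => e e0.
(* With the denominator of [err] at k = 0 cleared, the error after k splits is c / (N + k + 1), and
   k is taken beyond c / e. *)
pose c : R := (err A B C t 0 t (size nss) * (size nss).+1%:R)%R.
have c0 : (0 <= c)%R by rewrite /c mulr_ge0 // err_ge0.
pose k := (Num.truncn (c / e)).+1; have kb : (c / e < k%:R)%R by exact: Num.Theory.truncnS_gt.
have tt : (0 <= t <= t)%R by rewrite t0 lexx.
apply: (le_trans (mean_le_partialE A B C t0 k I tt)).
apply: leeD; first exact: part.
rewrite lee_fin.
have -> : err A B C t k t (size nss) = (c / (size nss + k).+1%:R)%R.
  rewrite /c /err addn0 -[RHS]mulrA [RHS]mulrACA mulfVK ?pnatr_eq0 // -mulrA.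
  by congr (_ * _)%R; rewrite mulrC.
rewrite ler_pdivrMr ?ltr0n // mulrC -ler_pdivrMr //; apply: le_trans (ltW kb) _.
by rewrite ler_nat ltnW // ltnS leq_addl.
Qed.

(** * The initial tessellation and the explicit means *)

Lemma spoly1 (n : V3 R) : spoly [:: n] = hemi_p n.
Proof.
apply/seteqP; split=> x [xS h]; split=> //; first by rewrite dotC; move/coneP: h; apply; rewrite mem_head.
by apply/coneP => m; rewrite mem_seq1 => /eqP ->; rewrite dotC.
Qed.

Lemma hemi_p_negv (n : V3 R) : hemi_p (negv n) = hemi_m n.
Proof. by apply/seteqP; split=> x [xS h]; split=> //; move: h; rewrite dot_negr oppr_ge0. Qed.

Lemma lamE (n : tess R -> nat) (A B C : nat) (t : R) : (0 <= t)%R ->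
  (forall nss segs D, tess_inv nss segs D -> n (mktess nss segs) = objF A B C nss) ->
  lam n t = (A%:R * (t ^+ 2 + 2 * t) + B%:R + C%:R * 2 * expR (- t))%:E.
Proof.
move=> t0 nF; pose nss0 : seq (seq (V3 R)) := [:: [:: e3 R]; [:: negv (e3 R)]].
have Y0E : mktess nss0 [::] = Y0 R by rewrite /mktess /= !spoly1 hemi_p_negv.
have I := @tess_inv0 R.
have f0 (T : tess R) : 0 <= ((n T)%:R : R)%:E by rewrite lee_fin.
have fF nss segs D : tess_inv nss segs D ->
    ((n (mktess nss segs))%:R : R)%:E = ((objF A B C nss)%:R : R)%:E.
  by move=> /nF ->.
rewrite /lam /Expect -Y0E (eq_eseriesr (fun k _ => PnE k t f0 fF I)) (mean_series _ _ _ I t0).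
congr (_%:E); rewrite /meanF /nhemi /rateC /= !big_cons big_nil !tauC_hemi /=.
rewrite subnn !addn0 add0r addr0; ring.
Qed.

End Explicit.

Theorem theorem2 (R : realType) (t : R) : 0 <= t ->
  [/\ lam (@nZ R) t = (t ^+ 2 + 2 * t + 2)%:E,
      lam (@nE R) t = (3 * (t ^+ 2 + 2 * t))%:E,
      lam (@nV R) t = (2 * (t ^+ 2 + 2 * t))%:E,
      lam (@nS R) t = (2 * (2 * (t ^+ 2 + 2 * t) + expR (- t)))%:E
    & lam (@nM R) t = (t ^+ 2 + 2 * t)%:E].
Proof.
move=> t0; split.
- rewrite (@lamE R _ 1 2 0 t t0) => [|nss segs D I]; first by congr (_%:E); ring.
  by rewrite (inv_nZ I) /objF mul1n mul0n addn0 subnK ?(inv_size I).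
- rewrite (@lamE R _ 3 0 0 t t0) => [|nss segs D I]; first by congr (_%:E); ring.
  by rewrite (inv_nE I) /objF mul0n !addn0.
- rewrite (@lamE R _ 2 0 0 t t0) => [|nss segs D I]; first by congr (_%:E); ring.
  by rewrite (inv_nV I) /objF mul0n !addn0.
- rewrite (@lamE R _ 4 0 1 t t0) => [|nss segs D I]; first by congr (_%:E); ring.
  by rewrite (inv_nS I) /objF mul1n addn0.
- rewrite (@lamE R _ 1 0 0 t t0) => [|nss segs D I]; first by congr (_%:E); ring.
  by rewrite (inv_nM I) /objF mul1n mul0n !addn0.
Qed.
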